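(* For the $2$-torus $\mathbb{T}^2$ and the wedge sum space $\mathbb{S}^1\vee\mathbb{S}^2\vee\mathbb{S}^1$, $$\frac{\pi}{3}=d_{\mathrm{E}}\left(\mathbf{cup}(\mathbf{VR}(\mathbb{T}^2)),\mathbf{cup}(\mathbf{VR}(\mathbb{S}^1\vee\mathbb{S}^2\vee\mathbb{S}^1))\right)\le 2\cdot d_{\mathrm{GH}}\left(\mathbb{T}^2,\mathbb{S}^1\vee\mathbb{S}^2\vee\mathbb{S}^1\right),$$ where $d_{\mathrm{GH}}$ is the Gromov-Hausdorff distance.
   Context: Metrics: $\mathbb{S}^1$ and $\mathbb{S}^2$ are the unit circle and unit $2$-sphere with geodesic distance (so both have diameter $\pi$). $\mathbb{T}^2=\mathbb{S}^1\times\mathbb{S}^1$ carries the $\ell_\infty$-product metric. $\mathbb{S}^1\vee\mathbb{S}^2\vee\mathbb{S}^1$ is the wedge sum with the gluing metric (the distance between points in different summands is the sum of their distances to the wedge point). For a metric space $X$, $\mathbf{VR}_t(X)$ is the simplicial complex of finite non-empty subsets of diameter $\le t$; $\mathbf{VR}(X)$ is the persistent space $t\mapsto|\mathbf{VR}_t(X)|$ for $t\ge0$ and $t\mapsto|\mathbf{VR}_0(X)|$ for $t<0$, with inclusions as transition maps. $\mathbf{H}^*$ is the cohomology ring with coefficients in a fixed field. The length of a graded ring is the largest $\ell\ge0$ such that there are $\ell$ homogeneous elements of positive degree with non-zero product ($0$ if there are no non-zero elements of positive degree, $\infty$ if there is no largest $\ell$). $\mathbf{Int}$ is the set of closed intervals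 $[a,b]$ with $a\le b$ real. For a persistent space $\mathbf{X}$, $\mathbf{cup}(\mathbf{X})([a,b])$ is the length of the ring $\mathbf{Im}(\mathbf{H}^*(\mathbb{X}_b)\to\mathbf{H}^*(\mathbb{X}_a))$. Functions $J_1,J_2$ on $\mathbf{Int}$ are $\varepsilon$-eroded if $J_1([a,b])\ge J_2([a-\varepsilon,b+\varepsilon])$ and $J_2([a,b])\ge J_1([a-\varepsilon,b+\varepsilon])$ for all $[a,b]\in\mathbf{Int}$; $d_{\mathrm{E}}(J_1,J_2)$ is the infimum of the $\varepsilon\ge0$ for which they are $\varepsilon$-eroded ($\infty$ if none). *)

(* Defs.v *)
From HB Require Import structures.
From mathcomp Require Import all_boot all_order all_algebra finmap.
From mathcomp Require Import generic_quotient ring_quotient.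
From mathcomp Require Import all_classical all_reals all_analysis.
From mathcomp Require Import ring lra zify.

Set Implicit Arguments.
Unset Strict Implicit.
Unset Printing Implicit Defensive.

Import Order.TTheory GRing.Theory Num.Theory.
Import numFieldNormedType.Exports numFieldTopology.Exports.

Local Open Scope classical_set_scope.
Local Open Scope ring_scope.

(* The l_infinity metric.  It completes the pseudometric structure that the
   library puts on a product, whose balls are the products of balls. *)
Section product_metric.
Context {R : realFieldType} {U V : metricType R}.
Implicit Types x y : U * V.

Definition linf_dist x y := Num.max (mdist x.1 y.1) (mdist x.2 y.2).

Let linf_dist_ge0 x y : 0 <= linf_dist x y.
Proof. by rewrite /linf_dist le_max mdist_ge0. Qed.

Let linf_dist_eq0 x y : linf_dist x y = 0 -> x = y.
Proof.
case: x y => [x1 x2] [y1 y2]; rewrite /linf_dist /= => h.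
have := mdist_ge0 x1 y1; have := mdist_ge0 x2 y2.
have : mdist x1 y1 <= 0 by rewrite -h le_max lexx.
have : mdist x2 y2 <= 0 by rewrite -h le_max lexx orbT.
move=> h2 h1 h2' h1'.
by congr (_, _); apply: mdist_positivity; apply/eqP; rewrite eq_le ?h1 ?h2 ?h1' ?h2'.
Qed.

Let ballE_linf x d : ball x d = [set y | linf_dist x y < d].
Proof.
apply/seteqP; split=> y /=.
  by case; rewrite !ballEmdist /linf_dist /= gt_max => -> ->.
rewrite /linf_dist gt_max => /andP[h1 h2].
by split; rewrite ballEmdist.
Qed.

HB.instance Definition _ := PseudoMetric_isMetric.Build R (U * V)%type
  linf_dist_ge0 linf_dist_eq0 ballE_linf.

End product_metric.

Section spheres.
Context {R : realType}.

Definition dot n (u v : 'rV[R]_n) : R := \sum_i u 0 i * v 0 i.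

Lemma dotC n (u v : 'rV[R]_n) : dot u v = dot v u.
Proof. by apply: eq_bigr => i _; rewrite mulrC. Qed.

Lemma dot_ge0 n (u : 'rV[R]_n) : 0 <= dot u u.
Proof. by apply: sumr_ge0 => i _; rewrite -expr2 sqr_ge0. Qed.

Lemma dot_eq0 n (u : 'rV[R]_n) : dot u u = 0 -> u = 0.
Proof.
move/eqP; rewrite psumr_eq0; last by move=> i _; rewrite -expr2 sqr_ge0.
move/allP => h; apply/rowP => i; rewrite mxE.
by have := h i (mem_index_enum _); rewrite -expr2 sqrf_eq0 => /eqP.
Qed.

Lemma dot_lin n (a b : R) (u v w : 'rV[R]_n) :
  dot (a *: u + b *: v) w = a * dot u w + b * dot v w.
Proof.
rewrite /dot !mulr_sumr -big_split /=; apply: eq_bigr => i _.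
by rewrite !mxE mulrDl !mulrA.
Qed.

Lemma dot_cauchy n (u v : 'rV[R]_n) : dot u v ^+ 2 <= dot u u * dot v v.
Proof.
have [v0|vN0] := eqVneq (dot v v) 0.
  have -> : dot u v = 0.
    by rewrite (dot_eq0 v0) /dot big1 // => i _; rewrite mxE mulr0.
  by rewrite v0 mulr0 expr0n.
have vp : 0 < dot v v by rewrite lt_neqAle eq_sym vN0 dot_ge0.
have := dot_ge0 (dot v v *: u + (- dot u v) *: v).
rewrite dot_lin ![dot _ (_ + _)]dotC !dot_lin (dotC v u).
have -> : dot v v * (dot v v * dot u u + - dot u v * dot u v) +
  - dot u v * (dot v v * dot u v + - dot u v * dot v v) =
  dot v v * (dot u u * dot v v - dot u v ^+ 2) by ring.
by rewrite pmulr_rge0 // subr_ge0.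
Qed.

Definition sphere n := {x : 'rV[R]_n.+1 | dot x x == 1}.

HB.instance Definition _ n := Choice.on (sphere n).

(* The length of the shorter great-circle arc from [x] to [y]. *)
Definition geodesic n (x y : sphere n) : R := acos (dot (val x) (val y)).

Lemma sphere_dot n (x : sphere n) : dot (val x) (val x) = 1.
Proof. exact/eqP/(valP x). Qed.

Lemma sphere_dot_itv n (x y : sphere n) : -1 <= dot (val x) (val y) <= 1.
Proof.
have := dot_cauchy (val x) (val y); rewrite !sphere_dot mulr1 => h.
by rewrite -ler_norml -(ler_pXn2r (n:=2)) ?nnegrE // expr1n real_normK ?num_real.
Qed.

Let geodesicxx n (x : sphere n) : geodesic x x = 0.
Proof. by rewrite /geodesic sphere_dot acos1. Qed.

Let geodesic_eq0 n (x y : sphere n) : geodesic x y = 0 -> x = y.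
Proof.
move=> h; have : cos (geodesic x y) = 1 by rewrite h cos0.
rewrite /geodesic acosK ?in_itv /= ?sphere_dot_itv // => e.
apply/val_inj/eqP; rewrite -subr_eq0; apply/eqP/dot_eq0.
rewrite -[val x](scale1r) -scaleN1r dot_lin ![dot _ (_ + _)]dotC !dot_lin.
by rewrite !sphere_dot (dotC (val y)) e; ring.
Qed.

Let geodesic_sym n (x y : sphere n) : geodesic x y = geodesic y x.
Proof. by rewrite /geodesic dotC. Qed.

Let geodesic_triangle n (y x z : sphere n) :
  geodesic x z <= geodesic x y + geodesic y z.
Proof.
rewrite /geodesic.
have hb := sphere_dot_itv x y; have hc := sphere_dot_itv y z.
have ha := sphere_dot_itv x z.
set a := dot _ (val z) in ha *; set b := dot (val x) (val y) in hb *.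
set c := dot (val y) (val z) in hc *.
have [big|small] := ltP pi (acos b + acos c).
  by rewrite (le_trans (acos_lepi ha)) // ltW.
rewrite leNgt -ltr_cos ?in_itv /= ?acos_ge0 ?acos_lepi ?addr_ge0 ?acos_ge0 //.
rewrite -leNgt.
rewrite cosD !acosK ?in_itv //= !sin_acos //.
rewrite lerBlDr -lerBlDl -sqrtrM; last first.
  by case/andP: hb => b1 b2; nra.
have -> : (1 - b ^+ 2) * (1 - c ^+ 2) =
  dot (1 *: val x + - b *: val y) (1 *: val x + - b *: val y) *
  dot (1 *: val z + - c *: val y) (1 *: val z + - c *: val y).
  rewrite !dot_lin ![dot _ (_ + _)]dotC !dot_lin !sphere_dot.
  rewrite (dotC (val y) (val x)) (dotC (val z) (val y)) -/b -/c; ring.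
apply: le_trans (ler_wsqrtr (dot_cauchy _ _)); rewrite sqrtr_sqr.
apply: le_trans (_ : `|b * c - a| <= _); first exact: ler_norm.
rewrite dot_lin ![dot _ (_ + _)]dotC !dot_lin.
rewrite (dotC (val z) (val x)) (dotC (val y) (val x)) sphere_dot (dotC (val z)).
rewrite -/a -/b -/c -normrN le_eqVlt; apply/orP; left; apply/eqP.
congr (`| _ |); ring.
Qed.

HB.instance Definition _ n := isMetric.Build R (sphere n)
  (@geodesicxx n) (@geodesic_eq0 n) (@geodesic_sym n) (@geodesic_triangle n).

End spheres.

Arguments sphere : clear implicits.

(* The wedge of (X, x0) and (Y, y0), realised inside the product X * Y as the
   union of X * {y0} and {x0} * Y.  On that subset the l_1 metric is the gluing
   metric: it is the given metric on each summand, and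
   d((x, y0), (x0, y)) = d(x, x0) + d(y0, y). *)
Section wedge_metric.
Context {R : realType} {X Y : metricType R} (x0 : X) (y0 : Y).

Definition metric_wedge := {p : X * Y | (p.1 == x0) || (p.2 == y0)}.

HB.instance Definition _ := Choice.on metric_wedge.

Definition wedge_point : metric_wedge :=
  exist _ (x0, y0) (introT orP (or_introl (eqxx x0))).

Definition wedge_dist (p q : metric_wedge) : R :=
  mdist (val p).1 (val q).1 + mdist (val p).2 (val q).2.

Let wedge_distxx p : wedge_dist p p = 0.
Proof. by rewrite /wedge_dist !metric_structure.mdistxx addr0. Qed.

Let wedge_dist_eq0 p q : wedge_dist p q = 0 -> p = q.
Proof.
move=> /eqP; rewrite paddr_eq0 ?mdist_ge0 // => /andP[/eqP h1 /eqP h2].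
apply: val_inj; rewrite [LHS]surjective_pairing [RHS]surjective_pairing.
by rewrite (mdist_positivity _ _ h1) (mdist_positivity _ _ h2).
Qed.

Let wedge_dist_sym p q : wedge_dist p q = wedge_dist q p.
Proof. by rewrite /wedge_dist metric_sym (metric_sym _ (val q).2). Qed.

Let wedge_dist_triangle q p r :
  wedge_dist p r <= wedge_dist p q + wedge_dist q r.
Proof. by rewrite /wedge_dist addrACA lerD // metric_triangle. Qed.

HB.instance Definition _ := isMetric.Build R metric_wedge
  wedge_distxx wedge_dist_eq0 wedge_dist_sym wedge_dist_triangle.

End wedge_metric.

Section gromov_hausdorff.
Context {R : realType}.
Local Open Scope ereal_scope.

Definition hausdorff_dist (Z : metricType R) (A B : set Z) : \bar R :=
  maxe (ereal_sup [set ereal_inf [set (mdist a b)%:E | b in B] | a in A])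
       (ereal_sup [set ereal_inf [set (mdist a b)%:E | a in A] | b in B]).

Definition isometric_embedding (X Z : metricType R) (f : X -> Z) :=
  forall x x', mdist (f x) (f x') = mdist x x'.

Definition gromov_hausdorff_dist (X Y : metricType R) : \bar R :=
  ereal_inf [set d | exists (Z : metricType R) (f : X -> Z) (g : Y -> Z),
    [/\ isometric_embedding f, isometric_embedding g &
        d = hausdorff_dist (range f) (range g)]].

End gromov_hausdorff.

Section standard_simplex.
Context (R : realType).

Definition stdsimplex n : set 'rV[R]_n.+1 :=
  [set x | (forall i, 0 <= x 0 i) /\ \sum_i x 0 i = 1].
Arguments stdsimplex n : clear implicits.

(* The affine map that sends the vertex [i] to the vertex [g i]. *)
Definition vertex_map_fun m n (g : 'I_m.+1 -> 'I_n.+1) (x : 'rV[R]_m.+1) :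
    'rV[R]_n.+1 :=
  \row_j \sum_(i | g i == j) x 0 i.

Lemma vertex_map_subproof m n (g : 'I_m.+1 -> 'I_n.+1) (x : stdsimplex m) :
  vertex_map_fun g (val x) \in stdsimplex n.
Proof.
have [x0 x1] := set_mem (valP x); apply: mem_set; split=> [j|].
  by rewrite mxE sumr_ge0.
rewrite -x1 [RHS](partition_big g xpredT) //=.
by apply: eq_bigr => j _; rewrite mxE.
Qed.

Definition vertex_map m n (g : 'I_m.+1 -> 'I_n.+1) (x : stdsimplex m) :
    stdsimplex n :=
  exist _ (vertex_map_fun g (val x)) (vertex_map_subproof g x).

Lemma vertex_map_continuous m n (g : 'I_m.+1 -> 'I_n.+1) :
  continuous (vertex_map g).
Proof.
apply: continuous_comp_initial.
suff cg : continuous (vertex_map_fun g).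
  move=> x; apply: (@continuous_comp _ _ _ set_val (vertex_map_fun g)).
    exact: initial_continuous.
  exact: cg.
move=> x; apply/(@cvg_ballP R 'rV[R]_n.+1 _ _ (nbhs_filter x)) => e e0.
have d0 : 0 < e / m.+1%:R by rewrite divr_gt0.
near=> y; split=> // i j; rewrite !mxE /ball /=.
rewrite -sumrB (le_lt_trans (ler_norm_sum _ _ _)) //.
have xy : ball x (e / m.+1%:R) y by near: y; exact: nbhsx_ballx.
apply: (@le_lt_trans _ _ (\sum_(k < m.+1) `|x 0 k - y 0 k|)).
  rewrite [leRHS](bigID (fun k => g k == j)) /= lerDl sumr_ge0 //.
have -> : e = \sum_(k < m.+1) (e / m.+1%:R).
  by rewrite sumr_const card_ord -[RHS]mulr_natr divfK // pnatr_eq0.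
by apply: ltr_sum => [|k _]; [|exact: xy.2]; apply/hasP; exists ord0.
Unshelve. all: by end_near. Qed.

HB.instance Definition _ m n (g : 'I_m.+1 -> 'I_n.+1) :=
  isContinuous.Build _ _ (vertex_map g) (@vertex_map_continuous m n g).

Lemma vertex_map_comp l m n (g : 'I_m.+1 -> 'I_n.+1) (f : 'I_l.+1 -> 'I_m.+1) x :
  vertex_map g (vertex_map f x) = vertex_map (g \o f) x.
Proof.
apply: val_inj; apply/rowP => j; rewrite !mxE /=.
under eq_bigr do rewrite mxE.
rewrite [RHS](partition_big f (fun i => g i == j)) //=.
apply: eq_bigr => i /eqP gi; apply: eq_bigl => k.
by case: eqP => [->|]; rewrite ?gi ?eqxx ?andbF ?andbT.
Qed.

End standard_simplex.

Arguments stdsimplex R n : clear implicits.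
Arguments vertex_map R {m n} g x.

Section singular_cochains.
Context (R : realType) (K : fieldType).
Implicit Types X Y : topologicalType.

Definition singular_simplex n X := continuousType (stdsimplex R n) X.

Definition reindex X m n (s : singular_simplex n X)
    (g : 'I_m.+1 -> 'I_n.+1) : singular_simplex m X :=
  s \o vertex_map R g.

Definition push X Y n (f : continuousType X Y) (s : singular_simplex n X) :
    singular_simplex n Y :=
  f \o s.

Lemma reindex_reindex X l m n (s : singular_simplex n X)
    (g : 'I_m.+1 -> 'I_n.+1) (f : 'I_l.+1 -> 'I_m.+1) h :
  g \o f =1 h -> reindex (reindex s g) f = reindex s h.
Proof.
move=> /funext <-; apply/continuousEP => x.
by rewrite /reindex /= vertex_map_comp.
Qed.

Definition cochain n X := singular_simplex n X -> K.
HB.instance Definition _ n X := GRing.Zmodule.on (cochain n X).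

(* [reindex s (lift i)] is the face of [s] opposite to the vertex [i]. *)
Definition coboundary n X (phi : cochain n X) : cochain n.+1 X :=
  fun s => \sum_(i < n.+2) (-1) ^+ i * phi (reindex s (lift i)).

Definition front p q (i : 'I_p.+1) : 'I_(p + q).+1 := inord i.
Definition back p q (i : 'I_q.+1) : 'I_(p + q).+1 := inord (p + i).

Definition cup_cochain p q X (phi : cochain p X) (psi : cochain q X) :
    cochain (p + q) X :=
  fun s => phi (reindex s (@front p q)) * psi (reindex s (@back p q)).

Definition pull_cochain X Y n (f : continuousType X Y) (phi : cochain n Y) :
    cochain n X :=
  fun s => phi (push f s).

Definition is_cocycle n X : {pred cochain n X} :=
  [pred phi | `[< coboundary phi = 0 >]].

Lemma is_cocycle_zmod_closed n X : zmod_closed (@is_cocycle n X).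
Proof.
split=> [|phi psi /asboolP h1 /asboolP h2]; apply/asboolP/funext => s.
  by rewrite /coboundary big1 // => i _; rewrite mulr0.
transitivity (coboundary phi s - coboundary psi s); last first.
  by rewrite h1 h2 subrr.
rewrite /coboundary -sumrB; apply: eq_bigr => i _.
by rewrite -mulrBr.
Qed.

HB.instance Definition _ n X :=
  GRing.isZmodClosed.Build (cochain n X) (@is_cocycle n X)
    (@is_cocycle_zmod_closed n X).

Record cocycle n X := Cocycle {
  cocycle_val :> cochain n X;
  cocycleP : cocycle_val \in @is_cocycle n X
}.

HB.instance Definition _ n X := [isSub for @cocycle_val n X].
HB.instance Definition _ n X := [Choice of cocycle n X by <:].
HB.instance Definition _ n X := [SubChoice_isSubZmodule of cocycle n X by <:].

Definition is_coboundary n X : {pred cocycle n X} :=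
  match n return {pred cocycle n X} with
  | 0 => [pred z | z == 0]
  | m.+1 => [pred z : cocycle m.+1 X |
      `[< exists psi : cochain m X, cocycle_val z = coboundary psi >]]
  end.

Lemma is_coboundary_zmod_closed n X : zmod_closed (@is_coboundary n X).
Proof.
case: n => [|n]; split.
- exact: eqxx.
- by move=> x y /eqP-> /eqP->; rewrite inE subrr.
- apply/asboolP; exists 0; apply/funext => s.
  by rewrite /coboundary big1 // => i _; rewrite mulr0.
- move=> x y /asboolP[phi xphi] /asboolP[psi ypsi].
  apply/asboolP; exists (phi - psi).
  transitivity (cocycle_val x - cocycle_val y).
    exact: (raddfB (val : cocycle n.+1 X -> cochain n.+1 X)).
  rewrite xphi ypsi; apply/funext => s.
  rewrite /coboundary -[LHS]sumrB; apply: eq_bigr => i _.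
  by rewrite -mulrBr.
Qed.

HB.instance Definition _ n X :=
  GRing.isZmodClosed.Build (cocycle n X) (@is_coboundary n X)
    (@is_coboundary_zmod_closed n X).

Lemma cup_is_cocycle p q X (phi : cochain p X) (psi : cochain q X) :
  phi \in @is_cocycle p X -> psi \in @is_cocycle q X ->
  cup_cochain phi psi \in @is_cocycle (p + q) X.
Proof.
move=> /asboolP hphi /asboolP hpsi; apply/asboolP/funext => s.
pose fp1 (i : 'I_p.+2) : 'I_(p + q).+2 := inord i.
pose bq1 (i : 'I_q.+2) : 'I_(p + q).+2 := inord (p + i).
pose fp (i : 'I_p.+1) : 'I_(p + q).+2 := inord i.
pose bq (i : 'I_q.+1) : 'I_(p + q).+2 := inord (p.+1 + i).
pose A i := phi (reindex (reindex s fp1) (lift (inord i : 'I_p.+2))).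
pose C j := psi (reindex (reindex s bq1) (lift (inord j : 'I_q.+2))).
have sumA : \sum_(0 <= i < p.+2) (-1) ^+ i * A i = 0.
  rewrite big_mkord -[RHS](congr1 (fun f => f (reindex s fp1)) hphi).
  by apply: eq_bigr => i _; rewrite /A inord_val.
have sumC : \sum_(0 <= j < q.+2) (-1) ^+ j * C j = 0.
  rewrite big_mkord -[RHS](congr1 (fun f => f (reindex s bq1)) hpsi).
  by apply: eq_bigr => i _; rewrite /C inord_val.
have Alast : A p.+1 = phi (reindex s fp).
  congr phi; apply: reindex_reindex => i; apply: val_inj.
  have ip := ltn_ord i.
  by rewrite /fp /fp1 /= !inordK /= /bump ?inordK //; lia.
have C0 : C 0%N = psi (reindex s bq).
  congr psi; apply: reindex_reindex => i; apply: val_inj.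
  have ip := ltn_ord i.
  by rewrite /bq /bq1 /= !inordK /= /bump ?inordK //; lia.
transitivity (\sum_(0 <= i < (p + q).+2) (-1) ^+ i *
    cup_cochain phi psi (reindex s (lift (inord i : 'I_(p + q).+2)))).
  by rewrite big_mkord; apply: eq_bigr => i _; rewrite inord_val.
rewrite (@big_cat_nat _ _ _ p.+1) //=; last by lia.
have -> : \sum_(0 <= i < p.+1) (-1) ^+ i *
    cup_cochain phi psi (reindex s (lift (inord i : 'I_(p + q).+2))) =
    (\sum_(0 <= i < p.+1) (-1) ^+ i * A i) * psi (reindex s bq).
  rewrite mulr_suml; apply: eq_big_nat => i /andP[_ ip].
  rewrite -mulrA; congr (_ * _); rewrite /cup_cochain; congr (_ * _).
    congr phi; rewrite (@reindex_reindex _ _ _ _ _ _ _ (fp1 \o lift (inord i : 'I_p.+2))).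
      by rewrite (@reindex_reindex _ _ _ _ _ _ _ (fp1 \o lift (inord i : 'I_p.+2))).
    move=> j; apply: val_inj; have jp := ltn_ord j.
    by rewrite /fp1 /front /= !inordK /= /bump ?inordK //; lia.
  congr psi; apply: reindex_reindex => j; apply: val_inj; have jp := ltn_ord j.
  by rewrite /bq /back /= !inordK /= /bump ?inordK //; lia.
have -> : \sum_(p.+1 <= i < (p + q).+2) (-1) ^+ i *
    cup_cochain phi psi (reindex s (lift (inord i : 'I_(p + q).+2))) =
    (-1) ^+ p * phi (reindex s fp) * \sum_(1 <= j < q.+2) (-1) ^+ j * C j.
  pose G i := (-1) ^+ i *
    cup_cochain phi psi (reindex s (lift (inord i : 'I_(p + q).+2))).
  have -> : \sum_(p.+1 <= i < (p + q).+2) G i = \sum_(1 <= j < q.+2) G (j + p)%N.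
    have -> : (p + q).+2 = (q.+2 + p)%N by lia.
    by rewrite -{1}[p.+1]add1n big_addn addnK.
  rewrite mulr_sumr /G; apply: eq_big_nat => j /andP[j1 jq].
  rewrite mulrACA -exprD [(p + j)%N]addnC; congr (_ * _).
  rewrite /cup_cochain; congr (_ * _).
    congr phi; apply: reindex_reindex => i; apply: val_inj; have ip := ltn_ord i.
    by rewrite /fp /front /= !inordK /= /bump ?inordK //; lia.
  congr psi; rewrite (@reindex_reindex _ _ _ _ _ _ _ (bq1 \o lift (inord j : 'I_q.+2))).
    by rewrite (@reindex_reindex _ _ _ _ _ _ _ (bq1 \o lift (inord j : 'I_q.+2))).
  move=> i; apply: val_inj; have iq := ltn_ord i.
  by rewrite /bq1 /back /= !inordK /= /bump ?inordK //; lia.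
move: sumA; rewrite big_nat_recr //= Alast => /eqP; rewrite addr_eq0 => /eqP ->.
rewrite big_ltn // C0 expr0 mul1r addrC in sumC.
move/eqP: sumC; rewrite addr_eq0 => /eqP ->.
by rewrite exprS -[RHS]/(0 : K); ring.
Qed.

Lemma pull_is_cocycle X Y n (f : continuousType X Y) (phi : cochain n Y) :
  phi \in @is_cocycle n Y -> pull_cochain f phi \in @is_cocycle n X.
Proof.
move=> /asboolP hphi; apply/asboolP/funext => s.
rewrite -[RHS](congr1 (fun g => g (push f s)) hphi).
apply: eq_bigr => i _; congr (_ * phi _).
exact/continuousEP.
Qed.

Lemma one_is_cocycle X : (cst 1 : cochain 0 X) \in @is_cocycle 0 X.
Proof.
apply/asboolP/funext => s.
by rewrite /coboundary !big_ord_recl big_ord0 /= /cst !mulr1 expr1 addr0 subrr.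
Qed.

(* H^n(X; K), the quotient of the cocycles by the coboundaries.  The operations
   below are computed on the representative that [repr] picks in each class; the
   result does not depend on that choice. *)
Definition cohomology n X := Quotient.quot (@is_coboundary n X).
HB.instance Definition _ n X := GRing.Zmodule.on (cohomology n X).
HB.instance Definition _ n X := Quotient.on (cohomology n X).

Definition cohomology_class n X (z : cocycle n X) : cohomology n X :=
  (\pi_(cohomology n X) z)%qT.

Definition cup_product p q X (x : cohomology p X) (y : cohomology q X) :
    cohomology (p + q) X :=
  cohomology_class (Cocycle (cup_is_cocycle
    (cocycleP (repr x)) (cocycleP (repr y)))).

Definition cohomology_one X : cohomology 0 X :=
  cohomology_class (Cocycle (one_is_cocycle X)).

Definition cohomology_map X Y n (f : continuousType X Y) (y : cohomology n Y) :
    cohomology n X :=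
  cohomology_class (Cocycle (pull_is_cocycle f (cocycleP (repr y)))).

(* Homogeneous elements of the ring H^*(X), each with its degree. *)
Definition homogeneous X := {n : nat & cohomology n X}.

Definition homogeneous_class n X (x : cohomology n X) : homogeneous X :=
  existT (fun n => cohomology n X) n x.

Definition cup_prod X (s : seq (homogeneous X)) : homogeneous X :=
  foldr (fun x y : homogeneous X => homogeneous_class (cup_product (projT2 x) (projT2 y)))
    (homogeneous_class (cohomology_one X)) s.

Definition in_image X Y (f : continuousType X Y) (x : homogeneous X) : Prop :=
  range (@cohomology_map X Y (projT1 x) f) (projT2 x).

(* The length of the graded ring Im(f^* : H^*(Y) -> H^*(X)), a subring of H^*(X):
   [+oo] when products of arbitrarily many factors survive, and at least 0. *)
Definition image_length X Y (f : continuousType X Y) : \bar R :=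
  ereal_sup [set l%:R%:E | l in [set l : nat | l = 0%N \/
    exists s : seq (homogeneous X),
      [/\ size s = l,
          forall x, x \in s -> (0 < projT1 x)%N /\ in_image f x &
          projT2 (cup_prod s) <> 0]]].

End singular_cochains.

Record persistent_space (R : realType) := PersistentSpace {
  pspace :> R -> topologicalType;
  transition : forall a b, a <= b -> continuousType (pspace a) (pspace b);
  transition_id : forall a (aa : a <= a) x, transition aa x = x;
  transition_comp : forall a b c (ab : a <= b) (bc : b <= c) (ac : a <= c) x,
    transition ac x = transition bc (transition ab x)
}.

Section erosion.
Context {R : realType}.

Record closed_interval := ClosedInterval {
  left_end : R;
  right_end : R;
  left_le_right : left_end <= right_end
}.

Lemma thicken_subproof (I : closed_interval) (e : {nonneg R}) :
  left_end I - e%:num <= right_end I + e%:num.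
Proof. by rewrite lerBlDr -addrA (le_trans (left_le_right I)) // lerDl addr_ge0. Qed.

Definition thicken (I : closed_interval) (e : {nonneg R}) : closed_interval :=
  ClosedInterval (thicken_subproof I e).

Definition cup_length (K : fieldType) (X : persistent_space R)
    (I : closed_interval) : \bar R :=
  image_length R K (transition X (left_le_right I)).

Definition eroded (J1 J2 : closed_interval -> \bar R) (e : {nonneg R}) : Prop :=
  forall I, (J2 (thicken I e) <= J1 I)%E /\ (J1 (thicken I e) <= J2 I)%E.

Definition erosion_dist (J1 J2 : closed_interval -> \bar R) : \bar R :=
  ereal_inf [set e%:num%:E | e in [set e : {nonneg R} | eroded J1 J2 e]].

End erosion.

Record simplicial_complex (V : choiceType) := SimplicialComplex {
  simplices :> set {fset V};
  simplices_nonempty : forall s, simplices s -> s != fset0;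
  simplices_down : forall s t, simplices s -> t != fset0 ->
    (t `<=` s)%fset -> simplices t
}.

Section realization.
Context (R : realType) {V : choiceType}.
Implicit Types S T : simplicial_complex V.

(* A point of |S| is given by its barycentric coordinates: a finitely supported
   weight on the vertices, positive exactly on some simplex of S. *)
Definition barycentric S (p : {fsfun V -> R with 0}) : Prop :=
  [/\ forall v, 0 <= p v, \sum_(v <- finsupp p) p v = 1 & simplices S (finsupp p)].

Definition realization S : Type :=
  {p : {fsfun V -> R with 0} | `[< barycentric S p >]}.

HB.instance Definition _ S := Choice.on (realization S).

(* The coherent topology: [A] is open when its trace on each closed simplex
   {q in |S| : finsupp q is contained in s} is open for the Euclidean topology
   of that simplex. *)
Definition coherent_open S : set_system (realization S) :=
  [set A | forall (s : {fset V}) (p : realization S),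
    simplices S s -> (finsupp (val p) `<=` s)%fset -> A p ->
    exists2 e : R, 0 < e & forall q : realization S,
      (finsupp (val q) `<=` s)%fset ->
      (forall v, `|val p v - val q v| < e) -> A q].

Lemma coherent_openT S : coherent_open [set: realization S].
Proof. by move=> s p _ _ _; exists 1. Qed.

Lemma coherent_openI S : setI_closed (@coherent_open S).
Proof.
move=> A B hA hB s p Ss ps [Ap Bp].
have [e e0 he] := hA s p Ss ps Ap; have [d d0 hd] := hB s p Ss ps Bp.
exists (Num.min e d); first by rewrite lt_min e0.
move=> q qs pq; split; [apply: he|apply: hd] => // v;
  by have := pq v; rewrite lt_min => /andP[].
Qed.

Lemma coherent_open_bigcup S (I : Type) (f : I -> set (realization S)) :
  (forall i, coherent_open (f i)) -> coherent_open (\bigcup_i f i).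
Proof.
move=> hf s p Ss ps [i _ fip]; have [e e0 he] := hf i s p Ss ps fip.
by exists e => // q qs pq; exists i => //; exact: he.
Qed.

HB.instance Definition _ S := isOpenTopological.Build (realization S)
  (@coherent_openT S) (@coherent_openI S) (@coherent_open_bigcup S).

Lemma inclusion_subproof S T (ST : S `<=` T) (p : realization S) :
  `[< barycentric T (val p) >].
Proof. by have /asboolP[h1 h2 h3] := valP p; apply/asboolP; split=> //; exact: ST. Qed.

Definition inclusion S T (ST : S `<=` T) (p : realization S) : realization T :=
  exist _ (val p) (inclusion_subproof ST p).

Lemma inclusion_continuous S T (ST : S `<=` T) : continuous (inclusion ST).
Proof.
apply/continuousP => A; rewrite /open /= => oA s p Ss ps Ap.
have [e e0 he] := oA s (inclusion ST p) (ST _ Ss) ps Ap.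
by exists e => // q qs pq; exact: he.
Qed.

HB.instance Definition _ S T (ST : S `<=` T) :=
  isContinuous.Build _ _ (inclusion ST) (@inclusion_continuous S T ST).

End realization.

Section vietoris_rips.
Context {R : realType} (X : metricType R).

Definition vr_simplices (t : R) : set {fset X} :=
  [set s | s != fset0 /\
    forall x y, x \in s -> y \in s -> mdist x y <= t].

Definition vr_complex (t : R) : simplicial_complex X.
Proof.
refine (@SimplicialComplex _ (vr_simplices t) _ _) => [s []//|s u [_ st] u0 us].
by split=> // x y xu yu; apply: st; exact: (fsubsetP us).
Defined.

Lemma vr_subproof (a b : R) : a <= b ->
  vr_complex (Num.max a 0) `<=` vr_complex (Num.max b 0).
Proof.
move=> ab s [s0 st]; split=> // x y xs ys.
by rewrite (le_trans (st x y xs ys)) // ge_max !le_max ab lexx orbT.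
Qed.

(* [Num.max t 0] makes the filtration constant on negative parameters. *)
Definition VR : persistent_space R.
Proof.
refine (@PersistentSpace R (fun t => realization R (vr_complex (Num.max t 0)))
  (fun a b ab => inclusion (vr_subproof ab)) _ _).
- by move=> a aa x; exact: val_inj.
- by move=> a b c ab bc ac x; exact: val_inj.
Defined.

End vietoris_rips.

(* Main.v *)
From HB Require Import structures.
From mathcomp Require Import all_boot all_order all_algebra finmap.
From mathcomp Require Import generic_quotient ring_quotient.
From mathcomp Require Import all_classical all_reals all_analysis.
From mathcomp Require Import ring lra zify.
Require Import Defs.

(** The erosion distance equals [pi / 3] because the two functions vanish on all
    intervals that are thickened by [pi / 3], and differ on a small interval
    around [pi / 3] in a way that any smaller thickening still detects.

    Upper bound. Every point of a sphere is within [2 * (pi / 3)] of one of two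
    points at mutual distance [2 * (pi / 3)], so the sphere can be moved to a base
    point in two steps, and contiguity of the resulting vertex maps shows that
    the inclusion of the complex at scale [a >= 0] in the one at scale
    [a + 2 * (pi / 3)] is zero in positive degrees ([contraction_null]). Such
    motions combine over products and wedges, so they exist on both spaces. At
    scales [a <= 0] the complex is discrete ([inclusion_discrete]). Hence
    thickening by [pi / 3] on both sides makes both functions zero
    ([contractible_eroded]).

    Lower bound. Let [0 < d <= pi / 6] and consider scales [a = pi / 3 - d] and
    [b = pi / 3 + d]. On a sphere, cut the vertices into the hemisphere [A] of the
    base point and the opposite one. The points of either hemisphere can be tilted
    in small steps towards its pole without driving apart points within [a], and
    jump to it in the end; since [b >= pi / 3], scale [b] suffices for this
    ([sphere_hemi]). The construction passes to wedges ([wedge_hemi]). The sets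
    where some weight lies on [A], or on its complement, are open and cover the
    realization, and the inclusion kills the positive cohomology on each. As in the
    Lusternik-Schnirelmann estimate, products of two classes vanish
    ([cup_eq0_cover], [hemi_cup]), and the wedge has length at most 1 on this
    interval ([wedge_length_le1]).
    The torus has length at least 2 on every interval [[a, b]] with
    [0 < a <= b < 2 * (pi / 3)] ([torus_length_ge2]): below [2 * (pi / 3)] three
    points of a circle that are pairwise close do not surround the center, so that
    barycentric combinations of directions are non-zero ([vector_sum_gt0]) and
    winding numbers of the two coordinates define two classes. Their product is
    1 on a cycle of two triangles that wraps a square around the torus. If the
    functions are [e]-eroded with [e < pi / 3], then thickening by [e] the interval
    for [d = (pi / 3 - e) / 2] stays in this range, and the two estimates
    contradict each other ([eroded_ge]).

    Stability. If isometric copies of the two spaces are at Hausdorff distance less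
    than [r], then choosing nearby points gives maps in both directions, whose
    composites are contiguous to the inclusions after a shift of scale by [2 * r],
    so that the two functions are [2 * r]-eroded ([hausdorff_eroded]); hence
    [pi / 3 <= 2 * r].

    The topology behind these arguments is built from the definition of singular
    cochains. Barycentric subdivision gives the theorem of small simplices
    ([small_cocycle]), the source of the cover argument; the prism operator gives
    the invariance under contiguity ([contiguous_map_eq]); the finiteness of
    carriers of compact sets ([compact_supp]) makes the straight homotopies between
    contiguous maps continuous for the coherent topology. *)

Set Implicit Arguments.
Unset Strict Implicit.
Unset Printing Implicit Defensive.

Import Order.TTheory GRing.Theory Num.Theory.
Import numFieldNormedType.Exports numFieldTopology.Exports.

Local Open Scope classical_set_scope.
Local Open Scope ring_scope.

(** * Alternating sums over faces, and iterated coning *)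

Section subdivision_algebra.
Context {P : Type} {K : comNzRingType} (b : seq P -> P).
Implicit Types (Phi : seq P -> K) (p q : seq P).

(** The coboundary on functions of a list of points of unspecified length; [delE]
    is its usual form. This recursion on the list turns [del_del] into a short induction. *)
Fixpoint del Phi p : K :=
  if p is x :: q then Phi q - del (fun r => Phi (x :: r)) q else 0.

(** Dual to the barycentric subdivision of the simplex [p], when [b] is the
    barycenter and [n] the number of vertices: cone off from [b p] the subdivision
    of each face. Recursion on a separate counter [n] leaves the identities
    below free of hypotheses on the length of [p]. *)
Fixpoint sd n Phi p : K :=
  if n is n'.+1 then del (sd n' (fun q => Phi (b p :: q))) p else Phi p.

(** Dual to the chain homotopy from the identity to the subdivision; [sdT_del] is
    the homotopy formula. *)
Fixpoint sdT n Phi p : K :=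
  if n is n'.+1 then
    Phi (b p :: p) - del (sdT n' (fun q => Phi (b p :: q))) p
  else 0.

Lemma eq_del Phi Psi : Phi =1 Psi -> del Phi =1 del Psi.
Proof.
move=> h p; elim: p Phi Psi h => //= x p IH Phi Psi h.
by rewrite h (IH _ (fun r => Psi (x :: r))).
Qed.

Lemma delB Phi Psi p : del (fun q => Phi q - Psi q) p = del Phi p - del Psi p.
Proof.
elim: p Phi Psi => [|x p IH] Phi Psi /=; first by rewrite subrr.
by rewrite IH; ring.
Qed.

Lemma del_del Phi p : del (del Phi) p = 0.
Proof.
elim: p Phi => [|x p IH] Phi //=.
by rewrite delB IH subr0 subrr.
Qed.

Lemma sdB n Phi Psi p :
  sd n (fun q => Phi q - Psi q) p = sd n Phi p - sd n Psi p.
Proof.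
elim: n Phi Psi p => [|n IH] Phi Psi p //=.
by rewrite -delB; apply: eq_del => q; rewrite IH.
Qed.

Lemma sdTB n Phi Psi p :
  sdT n (fun q => Phi q - Psi q) p = sdT n Phi p - sdT n Psi p.
Proof.
elim: n Phi Psi p => [|n IH] Phi Psi p /=; first by rewrite subrr.
rewrite (eq_del (IH _ _)) delB; ring.
Qed.

Lemma del0 p : del (fun=> 0) p = 0.
Proof. by elim: p => //= x p ->; rewrite subrr. Qed.

(** Subdivision is a cochain map: coning off turns the coboundary into the
    identity minus the coboundary of the cone, and the second term dies because
    two successive coboundaries cancel. *)
Lemma sd_del n Phi p : sd n.+1 (del Phi) p = del (sd n Phi) p.
Proof.
elim: n Phi p => [|n IH] Phi p.
  by rewrite /= delB del_del subr0.
rewrite -[LHS]/(del (sd n.+1 (fun q => Phi q - del (fun r => Phi (b p :: r)) q)) p).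
rewrite (eq_del (sdB _ _ _)) delB.
by rewrite (eq_del (IH _)) del_del subr0.
Qed.

Lemma sdT_del n Phi p :
  sdT n.+1 (del Phi) p + del (sdT n Phi) p = Phi p - sd n.+1 Phi p.
Proof.
elim: n Phi p => [|n IH] Phi p.
  by rewrite /= !del0 subr0 addr0.
rewrite -[sdT n.+2 (del Phi) p]/(Phi p - del (fun r => Phi (b p :: r)) p
  - del (sdT n.+1 (fun q => Phi q - del (fun r => Phi (b p :: r)) q)) p).
rewrite (eq_del (sdTB _ _ _)) delB.
pose Psi := fun r => Phi (b p :: r).
have e q : sdT n.+1 (del Psi) q = (Psi q - sd n.+1 Psi q) - del (sdT n Psi) q.
  by rewrite -IH addrK.
rewrite (eq_del e) 2!delB del_del subr0.
rewrite -[sd n.+2 Phi p]/(del (sd n.+1 Psi) p) -/Psi.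
set u := del Psi p; set v := del (sdT _ _) p; set w := del (sd _ _) p.
ring.
Qed.

Definition rem_at i p := take i p ++ drop i.+1 p.

Lemma size_rem_at i p : (i < size p)%N -> size (rem_at i p) = (size p).-1.
Proof. by move=> ip; rewrite size_cat size_drop size_take ip; lia. Qed.

Lemma nth_rem_at x i k p : nth x (rem_at i p) k = nth x p (bump i k).
Proof.
rewrite /rem_at nth_cat size_take nth_drop /bump.
case: (ltnP i (size p)) => [pi|ip]; last first.
  case: ltnP => kp.
    by rewrite leqNgt (leq_trans kp ip) /= take_oversize.
  by rewrite !nth_default //; lia.
case: (ltnP k i) => ki; last by congr nth; lia.
by rewrite nth_take.
Qed.

Lemma delE Phi p : del Phi p = \sum_(i < size p) (-1) ^+ i * Phi (rem_at i p).
Proof.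
elim: p Phi => [|x p IH] Phi; first by rewrite big_ord0.
rewrite big_ord_recl expr0 mul1r /= /rem_at take0 drop1 /=; congr (_ + _).
rewrite IH -sumrN; apply: eq_bigr => i _.
by rewrite /bump /= add1n exprS mulN1r mulNr.
Qed.

Lemma del_vanish Phi p :
  (forall i, (i < size p)%N -> Phi (rem_at i p) = 0) -> del Phi p = 0.
Proof. by move=> h; rewrite delE big1 // => i _; rewrite h ?mulr0. Qed.

End subdivision_algebra.

(** * Points of the standard simplex *)

Section simplex_points.
Context {R : realType}.
Implicit Types (m n : nat).

Lemma continuous_sum (T : topologicalType) (I : Type) (r : seq I)
    (f : I -> T -> R) :
  (forall i, continuous (f i)) -> continuous (fun t => \sum_(i <- r) f i t).
Proof.
move=> cf t; apply: (@cvg_big R I +%R 0 xpredT) => [|i _]; last exact: cf.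
exact: add_continuous.
Qed.

Section real_functions.
Context {T : topologicalType}.
Implicit Types f g : T -> R.

Lemma continuous_add f g :
  continuous f -> continuous g -> continuous (fun t => f t + g t).
Proof. by move=> cf cg t; apply: cvgD; [exact: cf|exact: cg]. Qed.

Lemma continuous_opp f : continuous f -> continuous (fun t => - f t).
Proof. by move=> cf t; apply: cvgN; exact: cf. Qed.

Lemma continuous_mul f g :
  continuous f -> continuous g -> continuous (fun t => f t * g t).
Proof. by move=> cf cg t; apply: cvgM; [exact: cf|exact: cg]. Qed.

Lemma continuous_at_div f g t : continuous f -> continuous g -> g t != 0 ->
  f t' / g t' @[t' --> t] --> f t / g t.
Proof. by move=> cf cg gt; apply: cvgM; [exact: cf|apply: cvgV => //; exact: cg]. Qed.

Lemma continuous_div f g : (forall t, g t != 0) ->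
  continuous f -> continuous g -> continuous (fun t => f t / g t).
Proof. by move=> g0 cf cg t; apply: continuous_at_div. Qed.

Lemma continuous_maxr f g :
  continuous f -> continuous g -> continuous (fun t => Num.max (f t) (g t)).
Proof. by move=> cf cg t; apply: continuous_max; [exact: cf|exact: cg]. Qed.

Lemma continuous_minr f g :
  continuous f -> continuous g -> continuous (fun t => Num.min (f t) (g t)).
Proof. by move=> cf cg t; apply: continuous_min; [exact: cf|exact: cg]. Qed.

End real_functions.

Section coordinates.
Context {n : nat}.
Implicit Types (x y : stdsimplex R n).

Lemma coord_ge0 x i : 0 <= val x 0 i.
Proof. by have [h _] := set_mem (valP x); exact: h. Qed.

Lemma coord_sum x : \sum_i val x 0 i = 1.
Proof. by have [_ h] := set_mem (valP x). Qed.

Lemma coord_le1 x i : val x 0 i <= 1.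
Proof.
by rewrite -(coord_sum x) (bigD1 i) //= lerDl sumr_ge0 // => j _; exact: coord_ge0.
Qed.

Lemma coord_inj x y : (forall i, val x 0 i = val y 0 i) -> x = y.
Proof. by move=> h; apply/val_inj/rowP. Qed.

Lemma coord_cts i : continuous (fun x : stdsimplex R n => val x 0 i).
Proof.
move=> x; apply: (@continuous_comp _ _ _ set_val (fun v : 'rV[R]_n.+1 => v 0 i)).
  exact: initial_continuous.
exact: coord_continuous.
Qed.

Lemma simplex_cts (T : topologicalType) (f : T -> stdsimplex R n) :
  (forall i, continuous (fun t => val (f t) 0 i)) -> continuous f.
Proof.
move=> cf; apply: continuous_comp_initial => t.
apply/(@cvg_ballP R 'rV[R]_n.+1 _ _ (nbhs_filter t)) => e e0.
have h : \forall t' \near t, forall i, ball (val (f t) 0 i) e (val (f t') 0 i).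
  by apply: filter_forall => i; have /cvg_ballP := cf i t; exact.
by apply: filterS h => t' h; split => // i j; rewrite (ord1 i); exact: h.
Qed.

Definition simplex_point (v : 'rV[R]_n.+1) (v0 : forall i, 0 <= v 0 i)
    (v1 : \sum_i v 0 i = 1) : stdsimplex R n :=
  exist _ v (mem_set (conj v0 v1)).

Lemma vertex_subproof (i : 'I_n.+1) : \sum_j (delta_mx 0 i : 'rV[R]_n.+1) 0 j = 1.
Proof.
rewrite (bigD1 i) //= mxE !eqxx big1 ?addr0 // => j ji.
by rewrite mxE (negbTE ji) andbF.
Qed.

Definition vertex (i : 'I_n.+1) : stdsimplex R n.
Proof.
apply: (@simplex_point (delta_mx 0 i)); last exact: vertex_subproof.
by move=> j; rewrite mxE ler0n.
Defined.

Lemma vertexE i j : val (vertex i) 0 j = (j == i)%:R.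
Proof. by rewrite mxE eqxx. Qed.

End coordinates.

Lemma eq_wsum n (w : stdsimplex R n) c (f : 'I_n.+1 -> R) :
  (forall i, f i = c) -> \sum_i val w 0 i * f i = c.
Proof.
move=> h; under eq_bigr do rewrite h.
by rewrite -mulr_suml coord_sum mul1r.
Qed.

Lemma wsum_le n (w : stdsimplex R n) c (f : 'I_n.+1 -> R) :
  (forall i, f i <= c) -> \sum_i val w 0 i * f i <= c.
Proof.
move=> h; rewrite -[leRHS](@eq_wsum _ w _ (fun=> c)) //.
by apply: ler_sum => i _; rewrite ler_wpM2l // coord_ge0.
Qed.

Lemma wsum_ge n (w : stdsimplex R n) c (f : 'I_n.+1 -> R) :
  (forall i, c <= f i) -> c <= \sum_i val w 0 i * f i.
Proof.
move=> h; rewrite -[leLHS](@eq_wsum _ w _ (fun=> c)) //.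
by apply: ler_sum => i _; rewrite ler_wpM2l // coord_ge0.
Qed.

Section affine.
Context {m : nat}.
Implicit Types (p q : seq (stdsimplex R m)).

Definition affine_val n p (x : stdsimplex R n) : 'rV[R]_m.+1 :=
  \row_j \sum_(i < n.+1) val x 0 i * val (nth (vertex ord0) p i) 0 j.

Definition affine n p (x : stdsimplex R n) : stdsimplex R m.
Proof.
apply: (@simplex_point _ (affine_val p x)) => [j|].
  by rewrite mxE wsum_ge // => i; exact: coord_ge0.
under eq_bigr do rewrite mxE.
by rewrite exchange_big /=; under eq_bigr do rewrite -mulr_sumr coord_sum mulr1;
   rewrite coord_sum.
Defined.

Lemma affineE n p (x : stdsimplex R n) j :
  val (affine p x) 0 j =
  \sum_(i < n.+1) val x 0 i * val (nth (vertex ord0) p i) 0 j.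
Proof. by rewrite mxE. Qed.

Lemma affine_cts n p : continuous (affine p : stdsimplex R n -> _).
Proof.
apply: simplex_cts => j.
rewrite (_ : (fun t => _) = (fun t : stdsimplex R n =>
  \sum_(i < n.+1) val t 0 i * val (nth (vertex ord0) p i) 0 j)); last first.
  by apply/funext => t; rewrite affineE.
apply: continuous_sum => i.
by apply: continuous_mul; [exact: coord_cts|exact: cst_continuous].
Qed.

HB.instance Definition _ n p := isContinuous.Build _ _ (affine p : stdsimplex R n -> _)
  (@affine_cts n p).

(** The smallest box, in coordinates, around the points of [p]. *)
Definition box p (y : stdsimplex R m) :=
  forall i c, ((forall x, x \in p -> val x 0 i <= c) -> val y 0 i <= c) /\
              ((forall x, x \in p -> c <= val x 0 i) -> c <= val y 0 i).

Definition spread p (r : R) :=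
  forall x y i, x \in p -> y \in p -> val x 0 i - val y 0 i <= r.

Lemma box_affine n p (x : stdsimplex R n) : size p = n.+1 -> box p (affine p x).
Proof.
move=> sp j c; rewrite affineE; split=> h; [apply: wsum_le|apply: wsum_ge];
by move=> i; apply: h; rewrite mem_nth // sp.
Qed.

Lemma box_mem p x : x \in p -> box p x.
Proof. by move=> xp i c; split; exact. Qed.

Lemma box_sub p q y : {subset p <= q} -> box p y -> box q y.
Proof.
by move=> pq h i c; have [h1 h2] := h i c; split=> g; [apply: h1|apply: h2];
   move=> x /pq; exact: g.
Qed.

Lemma barycenter_subproof n : \sum_(i < n.+1) (const_mx n.+1%:R^-1 : 'rV[R]_n.+1) 0 i = 1.
Proof.
under eq_bigr do rewrite mxE.
by rewrite sumr_const card_ord -[LHS]mulr_natr mulVf // pnatr_eq0.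
Qed.

Definition center n : stdsimplex R n.
Proof.
apply: (@simplex_point _ (const_mx n.+1%:R^-1)); last exact: barycenter_subproof.
by move=> i; rewrite mxE invr_ge0 ler0n.
Defined.

Definition barycenter p : stdsimplex R m := affine p (center (size p).-1).

Lemma barycenterE p i : p != [::] ->
  val (barycenter p) 0 i = (size p)%:R^-1 * \sum_(x <- p) val x 0 i.
Proof.
case: p => // x p _; rewrite affineE (big_nth (vertex ord0)) big_mkord mulr_sumr.
by apply: eq_bigr => j _; rewrite mxE.
Qed.

Lemma box_barycenter p : p != [::] -> box p (barycenter p).
Proof. by case: p => // x p _; exact: box_affine. Qed.

(** A vertex contributes nothing to its own distance to the barycenter, which
    is therefore an average of [k + 1] numbers at most [r], one of them zero. *)
Lemma barycenter_spread p r k (y : stdsimplex R m) i :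
  0 <= r -> (0 < size p <= k.+1)%N -> spread p r -> box p y ->
  `|val (barycenter p) 0 i - val y 0 i| <= k%:R / k.+1%:R * r.
Proof.
move=> r0 /andP[p0 pk] pr py.
have [s ps] : exists s, size p = s.+1 by case: (size p) p0 => // s _; exists s.
have pN : p != [::] by rewrite -size_eq0 ps.
have sk : s%:R / s.+1%:R * r <= k%:R / k.+1%:R * r.
  rewrite ler_wpM2r // ler_pdivrMr ?ltr0n // mulrAC ler_pdivlMr ?ltr0n //.
  by rewrite -!natrM ler_nat; rewrite ps in pk; lia.
have s0 : 0 < s.+1%:R :> R by rewrite ltr0n.
suff h x : x \in p -> `|val (barycenter p) 0 i - val x 0 i| <= s%:R / s.+1%:R * r.
  apply: le_trans sk; set c := _ * r in h *; set b := fun_of_matrix (val (barycenter p)) 0 i in h *.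
  rewrite distrC ler_norml; have [h1 h2] := py i (b + c).
  have [h3 h4] := py i (b - c).
  by apply/andP; split; [rewrite lerBrDl; apply: h4|rewrite lerBlDl; apply: h1];
    move=> x /h; rewrite ler_norml => /andP[]; lra.
move=> xp.
have -> : val (barycenter p) 0 i - val x 0 i =
    s.+1%:R^-1 * \sum_(z <- p) (val z 0 i - val x 0 i).
  rewrite barycenterE // ps sumrB mulrBr; congr (_ - _).
  by rewrite big_const_seq count_predT iter_addr_0 ps -[X in _ * X]mulr_natl mulKf ?gt_eqF.
rewrite normrM (@ger0_norm _ s.+1%:R^-1) ?invr_ge0 ?ler0n // [leRHS]mulrAC [leLHS]mulrC.
apply: ler_wpM2r; first by rewrite invr_ge0 ltW.
(* The term for [x] itself is 0 and is left out of the sum. *)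
have -> : \sum_(z <- p) (val z 0 i - val x 0 i) =
    \sum_(z <- rem x p) (val z 0 i - val x 0 i).
  by rewrite (perm_big _ (perm_to_rem xp)) big_cons subrr; exact: add0r.
apply: (le_trans (ler_norm_sum _ _ _)).
have -> : s%:R * r = \sum_(z <- rem x p) r.
  by rewrite big_const_seq count_predT iter_addr_0 size_rem // ps mulr_natl.
rewrite big_seq [leRHS]big_seq; apply: ler_sum => z /mem_rem zp.
by rewrite ler_norml pr // andbT lerNl opprB pr.
Qed.

End affine.
End simplex_points.

(** * Mesh of the barycentric subdivision, and compactness *)

Section mesh.
Context {R : realType} {K : comNzRingType} {m : nat}.
Implicit Types (Phi Psi : seq (stdsimplex R m) -> K) (p q : seq (stdsimplex R m)).

Let b := @barycenter R m.

Lemma rem_at_sub i p : {subset rem_at i p <= p}.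
Proof. by move=> x; rewrite mem_cat => /orP[/mem_take|/mem_drop]. Qed.

Lemma spread_sub p q r : {subset p <= q} -> spread q r -> spread p r.
Proof. by move=> pq h x y i /pq xq /pq yq; exact: h. Qed.

Lemma spread1 p : spread p 1.
Proof.
move=> x y i _ _; rewrite lerBlDr (le_trans (coord_le1 x i)) //.
by rewrite lerDl coord_ge0.
Qed.

(** Every simplex of the subdivision has the barycenter as a vertex, and its
    other vertices come from the subdivision of a face, so that its spread
    shrinks by the factor of [barycenter_spread]. *)
Lemma sd_vanish k l Phi p r : 0 <= r -> size p = l -> (l <= k.+1)%N ->
  spread p r ->
  (forall q, size q = l -> (forall y, y \in q -> box p y) ->
     spread q (k%:R / k.+1%:R * r) -> Phi q = 0) ->
  sd b l Phi p = 0.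
Proof.
move=> r0 <-; have [n] := ubnP (size p); elim: n Phi p => // n IH Phi p pn pk pr h.
case sp: (size p) => [|s].
  by rewrite /=; apply: h => // y; rewrite (size0nil sp).
apply: del_vanish => i; rewrite sp => si.
have sq : size (rem_at i p) = s by rewrite size_rem_at ?sp.
rewrite -sq; apply: IH => [|||q qs qb qr]; rewrite ?sq; try by lia.
  exact: spread_sub (@rem_at_sub i p) pr.
have qp y : y \in q -> box p y by move=> /qb; exact: box_sub (@rem_at_sub i p).
have p0 : p != [::] by rewrite -size_eq0 sp.
have pb y j : box p y ->
    `|val (barycenter p) 0 j - val y 0 j| <= k%:R / k.+1%:R * r.
  by move=> py; apply: barycenter_spread => //; rewrite pk sp.
apply: h => [|y|x y j]; first by rewrite /= qs sq sp.
  by rewrite inE => /predU1P[->|/qp//]; exact: box_barycenter.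
rewrite !inE => /predU1P[->|xq] /predU1P[->|yq]; last exact: qr.
- by apply: le_trans (pb (b p) j _); [exact: ler_norm|exact: box_barycenter].
- by apply: le_trans (pb y j (qp _ yq)); exact: ler_norm.
- by apply: le_trans (pb x j (qp _ xq)); rewrite distrC; exact: ler_norm.
Qed.

(** All simplices that occur in the homotopy lie in the simplex [p]. *)
Lemma sdT_vanish l Phi p : size p = l ->
  (forall q, size q = l.+1 -> (forall y, y \in q -> box p y) -> Phi q = 0) ->
  sdT b l Phi p = 0.
Proof.
move=> <-; have [n] := ubnP (size p); elim: n Phi p => // n IH Phi p pn h.
case sp: (size p) => [|s] //=.
have p0 : p != [::] by rewrite -size_eq0 sp.
rewrite h ?sub0r ?del_vanish ?oppr0 //= => [i|y]; last first.
  by rewrite inE => /predU1P[->|/box_mem//]; exact: box_barycenter.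
rewrite sp => si; have sq : size (rem_at i p) = s by rewrite size_rem_at ?sp.
rewrite -sq; apply: IH => [|q qs qb]; rewrite ?sq; try by lia.
apply: h => [|y]; first by rewrite /= qs sq sp.
rewrite inE => /predU1P[->|/qb]; first exact: box_barycenter.
exact: box_sub (@rem_at_sub i p).
Qed.

(** Only lists of the length of [p] occur: apply [sd_vanish] to the difference. *)
Lemma eq_sd k Phi Psi p : size p = k ->
  (forall q, size q = k -> Phi q = Psi q) -> sd b k Phi p = sd b k Psi p.
Proof.
move=> <- h; apply/eqP; rewrite -subr_eq0 -sdB; apply/eqP.
apply: (@sd_vanish (size p) _ _ _ 1) => //; first exact: spread1.
by move=> q qs _ _; rewrite h ?subrr.
Qed.

Lemma eq_sdT k Phi Psi p : size p = k ->
  (forall q, size q = k.+1 -> Phi q = Psi q) -> sdT b k Phi p = sdT b k Psi p.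
Proof.
move=> <- h; apply/eqP; rewrite -subr_eq0 -sdTB; apply/eqP.
by apply: sdT_vanish => // q qs _; rewrite h ?subrr.
Qed.

End mesh.

Section affine_naturality.
Context {R : realType} {K : comNzRingType} {m l : nat}.
Context (r : seq (stdsimplex R l)).
Let f : stdsimplex R m -> stdsimplex R l := affine r.
Implicit Types (p : seq (stdsimplex R m)) (Phi : seq (stdsimplex R l) -> K).

Lemma affine_affine n p (x : stdsimplex R n) : size p = n.+1 ->
  f (affine p x) = affine (map f p) x.
Proof.
move=> sp; apply: coord_inj => j; rewrite !affineE.
under eq_bigr do rewrite affineE mulr_suml.
rewrite exchange_big /=; apply: eq_bigr => i _.
rewrite (nth_map (vertex ord0)) ?sp // affineE mulr_sumr.
by apply: eq_bigr => k _; rewrite mulrA.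
Qed.

Lemma barycenter_map p : p != [::] -> barycenter (map f p) = f (barycenter p).
Proof.
by case: p => // x p _; rewrite /barycenter affine_affine //= size_map.
Qed.

Lemma del_map Phi p : del (fun q => Phi (map f q)) p = del Phi (map f p).
Proof.
by elim: p Phi => //= x p IH Phi; rewrite -(IH (fun q => Phi (f x :: q))).
Qed.

Lemma eq_del_in (P : Type) (Phi1 Phi2 : seq P -> K) q :
  (forall i, (i < size q)%N -> Phi1 (rem_at i q) = Phi2 (rem_at i q)) ->
  del Phi1 q = del Phi2 q.
Proof. by move=> h; rewrite !delE; apply: eq_bigr => i _; rewrite h. Qed.

Lemma sd_map Phi p :
  sd (@barycenter R m) (size p) (fun q => Phi (map f q)) p =
  sd (@barycenter R l) (size p) Phi (map f p).
Proof.
have [n] := ubnP (size p); elim: n Phi p => // n IH Phi p pn.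
case sp: (size p) => [//|s] /=; rewrite -del_map.
apply: eq_del_in => i ip.
have sq : size (rem_at i p) = s by rewrite size_rem_at // sp.
have p0 : p != [::] by rewrite -size_eq0 sp.
by rewrite -sq -IH ?barycenter_map //; lia.
Qed.

Lemma sdT_map Phi p :
  sdT (@barycenter R m) (size p) (fun q => Phi (map f q)) p =
  sdT (@barycenter R l) (size p) Phi (map f p).
Proof.
have [n] := ubnP (size p); elim: n Phi p => // n IH Phi p pn.
case sp: (size p) => [//|s] /=; rewrite -del_map.
have p0 : p != [::] by rewrite -size_eq0 sp.
rewrite barycenter_map //; congr (_ - _).
apply: eq_del_in => i ip.
have sq : size (rem_at i p) = s by rewrite size_rem_at // sp.
by rewrite -sq -IH //; lia.
Qed.

End affine_naturality.

Section simplex_topology.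
Context {R : realType}.

(** Filters on the subtype are transferred to the closed bounded set of row
    vectors: a local bound at a point of the set is a bound on a ball around it. *)
Lemma simplex_compact n : compact [set: stdsimplex R n].
Proof.
have cS : compact (stdsimplex R n).
  apply: bounded_closed_compact.
    exists 1; split => // x x1 v [v0 v1]; apply: le_trans (ltW x1).
    rewrite [leLHS]mx_normrE; apply: bigmax_le => // -[i j] _ /=.
    rewrite (ord1 i) ger0_norm // -v1 (bigD1 j) //= lerDl.
    by apply: sumr_ge0 => k _.
  rewrite (_ : stdsimplex R n =
      (\bigcap_i (fun v : 'rV[R]_n.+1 => v 0 i) @^-1` [set x | 0 <= x]) `&`
      (fun v : 'rV[R]_n.+1 => \sum_i v 0 i) @^-1` [set x | x = 1]); last first.
    by apply/seteqP; split=> v [h1 h2]; split => // i; [move=> _|]; exact: h1.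
  apply: closedI.
    apply: closed_bigI => i _; apply: closed_comp => [x _|]; last exact: closed_ge.
    exact: coord_continuous.
  apply: closed_comp => [x _|]; last exact: closed_eq.
  by apply: continuous_sum => i; exact: coord_continuous.
apply/compact_near_coveringP => I F P FF cover.
have : \forall i \near F, forall v, stdsimplex R n v ->
    (fun i v => forall h : v \in stdsimplex R n, P i (exist _ v h)) i v.
  apply: (iffLR (compact_near_coveringP _) cS) => // v Sv.
  have [[U1 U2] [/= U1v U2F] U12] := cover (exist _ v (mem_set Sv)) Logic.I.
  move: U1v => /nbhs_ballP [e /= e0 be].
  exists (ball v e, U2); first by split=> //=; exact: nbhsx_ballx.
  move=> [w j] [/= vw U2j] h; apply: (U12 (exist _ w h, j)); split => //=.
  exact: be.
by apply: filterS => i h [v Sv] _; exact: h _ (set_mem Sv) Sv.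
Qed.

(** Lebesgue's number lemma, for a hereditary property of sets in place of
    containment in a member of a cover. *)
Lemma lebesgue_number n (Q : set (set (stdsimplex R n))) :
  (forall A B, A `<=` B -> Q B -> Q A) ->
  (forall x : stdsimplex R n, exists2 O, nbhs x O & Q O) ->
  exists2 d : R, 0 < d & forall x : stdsimplex R n,
    Q [set y : stdsimplex R n | forall i, `|val x 0 i - val y 0 i| < d].
Proof.
move=> Qsub Qloc.
have : \forall e \near (0:R)^'+, [set: stdsimplex R n] `<=` [set x | Q (ball x e)].
  apply: (iffLR (compact_near_coveringP _) (@simplex_compact n)) => x _.
  have [V /nbhs_ballP [d /= d0 bV] QV] := Qloc x.
  exists (ball x (d / 2), [set e | e < d / 2]).
    split => /=; first by apply: nbhsx_ballx; rewrite divr_gt0.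
    by apply: nbhs_right_lt; rewrite divr_gt0.
  move=> [y e] [/= xy ed]; apply: Qsub QV => z yz; apply: bV.
  by rewrite [d]splitr; apply: ball_triangle xy (le_ball (ltW ed) yz).
move=> /(filterI (@nbhs_right_gt R 0)) /filter_ex [e [/= e0 Qe]].
exists e => // x; apply: Qsub (Qe x Logic.I) => y xy.
by split => // i j; rewrite (ord1 i); exact: xy.
Qed.

(** Restrict to the segment from [x] to [y]. *)
Lemma simplex_ivt n (g : stdsimplex R n -> R) (x y : stdsimplex R n) c :
  continuous g -> g x <= c <= g y -> exists z, g z = c.
Proof.
move=> cg /andP[gx gy].
pose cl (t : R) : R := Num.max 0 (Num.min 1 t).
have cl0 t : 0 <= cl t by rewrite le_max lexx.
have cl1 t : cl t <= 1 by rewrite ge_max ler01 ge_min lexx.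
have ccl : continuous cl.
  apply: continuous_maxr; first exact: cst_continuous.
  by apply: continuous_minr; [exact: cst_continuous|move=> t; exact: cvg_id].
pose w t : 'rV[R]_n.+1 := \row_i ((1 - cl t) * val x 0 i + cl t * val y 0 i).
have w0 t i : 0 <= w t 0 i.
  by rewrite mxE addr_ge0 // mulr_ge0 ?subr_ge0 ?coord_ge0.
have w1 t : \sum_i w t 0 i = 1.
  under eq_bigr do rewrite mxE.
  by rewrite big_split -!mulr_sumr /= !coord_sum !mulr1 subrK.
pose s t := simplex_point (w0 t) (w1 t).
have cs : continuous s.
  apply: simplex_cts => i; rewrite (_ : (fun t => _) = (fun t =>
    (1 - cl t) * val x 0 i + cl t * val y 0 i)); last by apply/funext => t; rewrite mxE.
  apply: continuous_add; apply: continuous_mul => //; try exact: cst_continuous.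
  by apply: continuous_add; [exact: cst_continuous|exact: continuous_opp].
have s0 : s 0 = x.
  by apply: coord_inj => i; rewrite mxE /cl min_r ?ler01 // maxxx subr0 mul1r mul0r addr0.
have s1 : s 1 = y.
  by apply: coord_inj => i; rewrite mxE /cl minxx max_r ?ler01 // subrr mul1r mul0r add0r.
have [||t _ gt] := @IVT R (g \o s) 0 1 c ler01.
- by apply: continuous_subspaceT => t; apply: continuous_comp; [exact: cs|exact: cg].
- by rewrite /= s0 s1 ge_min le_max gx gy orbT.
by exists (s t).
Qed.

End simplex_topology.

(** * Singular subdivision and small simplices *)

Section singular_subdivision.
Context {R : realType} {K : fieldType} {X : topologicalType}.
Implicit Types (m n : nat).

Definition restrict m n (s : singular_simplex R m X) (q : seq (stdsimplex R m)) :
    singular_simplex R n X :=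
  s \o (affine q : stdsimplex R n -> _).
Arguments restrict {m} n s q.

Definition vertices n : seq (stdsimplex R n) := [seq vertex i | i <- enum 'I_n.+1].

Lemma size_vertices n : size (vertices n) = n.+1.
Proof. by rewrite size_map size_enum_ord. Qed.

Lemma nth_vertices n (i : 'I_n.+1) : nth (vertex ord0) (vertices n) i = vertex i.
Proof. by rewrite (nth_map ord0) ?size_enum_ord // nth_ord_enum. Qed.

Lemma affine_vertices n (x : stdsimplex R n) : affine (vertices n) x = x.
Proof.
apply: coord_inj => j; rewrite affineE (bigD1 j) //= nth_vertices vertexE eqxx mulr1.
rewrite big1 ?addr0 // => i ij.
by rewrite nth_vertices vertexE eq_sym (negbTE ij) mulr0.
Qed.

Lemma affine_vertex m n (p : seq (stdsimplex R m)) (i : 'I_n.+1) :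
  affine p (vertex i : stdsimplex R n) = nth (vertex ord0) p i.
Proof.
apply: coord_inj => j; rewrite affineE (bigD1 i) //= vertexE eqxx mul1r.
by rewrite big1 ?addr0 // => k ki; rewrite vertexE (negbTE ki) mul0r.
Qed.

Lemma map_affine_vertices m n (p : seq (stdsimplex R m)) : size p = n.+1 ->
  map (affine p) (vertices n) = p.
Proof.
move=> sp; apply: (@eq_from_nth _ (vertex ord0)); first by rewrite size_map size_vertices.
move=> i; rewrite size_map size_vertices => ip.
rewrite (nth_map (vertex ord0)) ?size_vertices //.
by rewrite (nth_vertices (Ordinal ip)) affine_vertex.
Qed.

Lemma restrict_vertices n (s : singular_simplex R n X) :
  restrict n s (vertices n) = s.
Proof. by apply/continuousEP => x; rewrite /restrict /= affine_vertices. Qed.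

Lemma restrict_restrict l m n (s : singular_simplex R l X) p q :
  size q = n.+1 ->
  restrict n (restrict m s p) q = restrict n s (map (affine p) q).
Proof.
by move=> sq; apply/continuousEP => x; rewrite /restrict /= affine_affine.
Qed.

Lemma vertex_mapE m n (g : 'I_m.+1 -> 'I_n.+1) (x : stdsimplex R m) j :
  val (vertex_map R g x) 0 j = \sum_(i | g i == j) val x 0 i.
Proof. by rewrite mxE. Qed.

Lemma affine_vertex_map m n l (q : seq (stdsimplex R m)) (g : 'I_n.+1 -> 'I_l.+1)
    (x : stdsimplex R n) j :
  val (affine q (vertex_map R g x)) 0 j =
  \sum_i val x 0 i * val (nth (vertex ord0) q (g i)) 0 j.
Proof.
rewrite affineE.
transitivity (\sum_(k < l.+1) \sum_(i | g i == k)
    val x 0 i * val (nth (vertex ord0) q k) 0 j).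
  by apply: eq_bigr => k _; rewrite vertex_mapE mulr_suml.
rewrite (exchange_big_dep xpredT) //=; apply: eq_bigr => i _.
by rewrite (big_pred1 (g i)) // => k; rewrite eq_sym.
Qed.

Lemma reindex_restrict m n (s : singular_simplex R m X) q (i : 'I_n.+2) :
  reindex (restrict n.+1 s q) (lift i) = restrict n s (rem_at i q).
Proof.
apply/continuousEP => x; rewrite /reindex /restrict /=; congr (s _).
apply: coord_inj => j; rewrite affine_vertex_map affineE.
by apply: eq_bigr => k _; rewrite nth_rem_at.
Qed.

(** This presents the values of a cochain on the affine simplices inside [s] as a
    function of lists of points, to which [del], [sd] and [sdT] apply. *)
Definition restricted n (phi : cochain R K n X) m (s : singular_simplex R m X)
  (q : seq (stdsimplex R m)) : K := phi (restrict n s q).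

Lemma coboundary_restrict n (phi : cochain R K n X) m (s : singular_simplex R m X) q :
  size q = n.+2 ->
  coboundary phi (restrict n.+1 s q) = del (restricted phi s) q.
Proof.
move=> sq; rewrite delE sq; apply: eq_bigr => i _.
by rewrite reindex_restrict.
Qed.

Lemma coboundary_coboundary n (phi : cochain R K n X) :
  coboundary (coboundary phi) = 0.
Proof.
apply/funext => s; rewrite -(restrict_vertices s) coboundary_restrict ?size_vertices //.
rewrite (@eq_del_in K _ _ (del (restricted phi s))) ?del_del // => i.
rewrite size_vertices => ip; rewrite /restricted coboundary_restrict //.
by rewrite size_rem_at ?size_vertices.
Qed.

Definition subdivide n (phi : cochain R K n X) : cochain R K n X :=
  fun s => sd (@barycenter R n) n.+1 (restricted phi s) (vertices n).

Definition subdivideT n (phi : cochain R K n.+1 X) : cochain R K n X :=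
  fun s => sdT (@barycenter R n) n.+1 (restricted phi s) (vertices n).

Lemma subdivide_restrict n (phi : cochain R K n X) m (s : singular_simplex R m X) p :
  size p = n.+1 ->
  subdivide phi (restrict n s p) = sd (@barycenter R m) n.+1 (restricted phi s) p.
Proof.
move=> sp; have e := sd_map p (restricted phi s) (vertices n).
rewrite map_affine_vertices // size_vertices in e; rewrite -e.
apply: eq_sd => [|q sq]; first exact: size_vertices.
by rewrite /restricted restrict_restrict.
Qed.

Lemma subdivideT_restrict n (phi : cochain R K n.+1 X) m (s : singular_simplex R m X) p :
  size p = n.+1 ->
  subdivideT phi (restrict n s p) = sdT (@barycenter R m) n.+1 (restricted phi s) p.
Proof.
move=> sp; have e := sdT_map p (restricted phi s) (vertices n).
rewrite map_affine_vertices // size_vertices in e; rewrite -e.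
apply: eq_sdT => [|q sq]; first exact: size_vertices.
by rewrite /restricted restrict_restrict.
Qed.

Lemma coboundary_subdivide n (phi : cochain R K n X) :
  coboundary (subdivide phi) = subdivide (coboundary phi).
Proof.
apply/funext => s; rewrite -{1}(restrict_vertices s).
rewrite coboundary_restrict ?size_vertices //.
rewrite (@eq_del_in K _ (restricted (subdivide phi) s)
   (sd (@barycenter R n.+1) n.+1 (restricted phi s))); last first.
  move=> i; rewrite size_vertices => ip; rewrite /restricted subdivide_restrict //.
  by rewrite size_rem_at ?size_vertices.
rewrite -sd_del; apply: eq_sd => [|q sq]; first exact: size_vertices.
by rewrite [RHS]/restricted coboundary_restrict.
Qed.

Lemma subdivideT_homotopy n (phi : cochain R K n.+1 X) s :
  subdivideT (coboundary phi) s + coboundary (subdivideT phi) s =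
  phi s - subdivide phi s.
Proof.
rewrite -[in coboundary _ s](restrict_vertices s) coboundary_restrict ?size_vertices //.
rewrite (@eq_del_in K _ (restricted (subdivideT phi) s)
   (sdT (@barycenter R n.+1) n.+1 (restricted phi s))); last first.
  move=> i; rewrite size_vertices => ip; rewrite /restricted subdivideT_restrict //.
  by rewrite size_rem_at ?size_vertices.
have e := sdT_del (@barycenter R n.+1) n.+1 (restricted phi s) (vertices n.+1).
rewrite [restricted phi s (vertices n.+1) in RHS]/restricted restrict_vertices in e.
rewrite -[RHS]e; congr (_ + _).
apply: eq_sdT => [|q sq]; first exact: size_vertices.
by rewrite [LHS]/restricted coboundary_restrict.
Qed.

Section small_simplices.
Context (Q : set (set X)).
Hypothesis Qsub : forall A B, A `<=` B -> Q B -> Q A.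
Hypothesis Qloc : forall x : X, exists2 V, nbhs x V & Q V.

Definition small_zero n (phi : cochain R K n X) :=
  forall s : singular_simplex R n X, Q (range s) -> phi s = 0.

Lemma range_restrict m n (s : singular_simplex R m X) q :
  range (restrict n s q) `<=` range s.
Proof. by move=> _ [x _ <-]; exists (affine q x). Qed.

Lemma small_zero_subdivide n (phi : cochain R K n X) :
  small_zero phi -> small_zero (subdivide phi).
Proof.
move=> phi0 s Qs; apply: (@sd_vanish R K n n _ _ _ 1) => //.
- exact: size_vertices.
- exact: spread1.
by move=> q _ _ _; apply: phi0; apply: Qsub Qs; exact: range_restrict.
Qed.

Lemma small_zero_subdivideT n (phi : cochain R K n.+1 X) :
  small_zero phi -> small_zero (subdivideT phi).
Proof.
move=> phi0 s Qs; apply: sdT_vanish => [|q _ _]; first exact: size_vertices.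
 apply: phi0; apply: Qsub Qs; exact: range_restrict.
Qed.

Definition spread_zero n (phi : cochain R K n X) (s : singular_simplex R n X) r :=
  forall q, size q = n.+1 -> spread q r -> phi (restrict n s q) = 0.

Lemma spread_zero_iter n (phi : cochain R K n X) s j r : 0 <= r ->
  spread_zero phi s ((n%:R / n.+1%:R) ^+ j * r) ->
  spread_zero (iter j (@subdivide n) phi) s r.
Proof.
elim: j r => [|j IH] r r0; first by rewrite expr0 mul1r.
rewrite exprSr -mulrA => /IH h q sq qr; rewrite iterS subdivide_restrict //.
apply: (@sd_vanish R K n n _ _ _ r) => // p sp _ pr; apply: h => //.
by rewrite mulr_ge0 ?divr_ge0 ?ler0n.
Qed.

(** The mesh shrinks geometrically, so that it falls below a Lebesgue number of the
    property [Q] pulled back along [s]. The bound [j] depends on [s] only, not on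
    the cochain: [small_cocycle] uses it for infinitely many cochains at once. *)
Lemma iter_subdivide_zero n (s : singular_simplex R n X) :
  exists j, forall i, (j <= i)%N -> forall phi : cochain R K n X,
    small_zero phi -> iter i (@subdivide n) phi s = 0.
Proof.
have [||d d0 Qd] := @lebesgue_number R n (fun A => Q (s @` A)).
- by move=> A B AB; apply: Qsub; exact: image_subset.
- move=> x; have [V xV QV] := Qloc (s x); exists (s @^-1` V).
    exact: (@cts_fun _ _ s).
  by apply: Qsub QV; exact: image_preimage_subset.
have t1 : `|n%:R / n.+1%:R : R| < 1.
  by rewrite ger0_norm ?divr_ge0 ?ler0n // ltr_pdivrMr ?ltr0n // mul1r ltr_nat.
have [j jd] : exists j, (n%:R / n.+1%:R) ^+ j < d.
  have /cvgr_lt/(_ _ d0) [j _ h] := cvg_expr t1.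
  by exists j; exact: h (leqnn j).
exists j => i ji phi phi0; rewrite -(subnKC ji) iterD -(restrict_vertices s).
apply: (@spread_zero_iter n _ s j 1) => //; rewrite ?size_vertices ?mulr1 //; last first.
  exact: spread1.
move=> q sq qr.
have : small_zero (iter (i - j) (@subdivide n) phi).
  by elim: (i - j)%N => //= k; exact: small_zero_subdivide.
apply; apply: Qsub (Qd (nth (vertex ord0) q 0)) => _ [x _ <-].
exists (affine q x) => // k.
have q0 : nth (vertex ord0) q 0 \in q by rewrite mem_nth // sq.
set c := fun_of_matrix (val (nth _ _ _)) 0 k; set t := _ ^+ j in qr jd.
have [h1 h2] := box_affine x sq k (c + t); have [h3 h4] := box_affine x sq k (c - t).
apply: le_lt_trans jd; rewrite ler_norml; apply/andP; split.
  by rewrite lerBrDl lerBlDr h1 // => y yq; have := qr _ _ k yq q0; rewrite lerBlDl.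
by rewrite lerBlDr -lerBlDl h4 // => y yq; have := qr _ _ k q0 yq; rewrite lerBlDr -lerBlDl.
Qed.

(** The theorem of small simplices. A cocycle [w] differs from its [j]-th subdivision
    by the coboundary of the sum of the first [j] terms [D i], and vanishes on [s]
    when subdivided often enough. How often depends on [s], hence the sum that
    defines [eta] has a length that depends on the simplex; as the further terms
    vanish, the faces of [s] can be given a common length. *)
Lemma small_cocycle n (w : cochain R K n.+1 X) :
  coboundary w = 0 -> small_zero w ->
  exists eta : cochain R K n X, w = coboundary eta.
Proof.
move=> dw w0.
have [N hN] := choice (@iter_subdivide_zero n).
pose D i := iter i (@subdivide n) (subdivideT w).
pose eta : cochain R K n X := fun s => \sum_(0 <= i < N s) D i s.
exists eta; apply/funext => s.
have [M0 hM0] := iter_subdivide_zero s.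
pose face (i : 'I_n.+2) : singular_simplex R n X := reindex s (lift i).
pose M := maxn M0 (\max_(i < n.+2) N (face i)).
have etaE i : eta (face i) = \sum_(0 <= j < M) D j (face i).
  have NM : (N (face i) <= M)%N.
    by rewrite leq_max; apply/orP; right; exact: (@leq_bigmax _ (fun i => N (face i))).
  rewrite (@big_cat_nat _ _ _ (N (face i))) //= [X in _ + X]big_nat_cond.
  rewrite [X in _ + X]big1 ?addr0 // => j /andP[/andP[Nj _] _].
  by apply: (hN _ j Nj); exact: small_zero_subdivideT.
have iterB j (f g : cochain R K n.+1 X) :
    iter j (@subdivide n.+1) (f - g) =
    iter j (@subdivide n.+1) f - iter j (@subdivide n.+1) g.
  by elim: j => //= j ->; apply/funext => t; exact: sdB.
have dT : coboundary (subdivideT w) = w - subdivide w.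
  apply/funext => t; have e := subdivideT_homotopy w t; rewrite dw in e.
  transitivity (w t - subdivide w t) => //; rewrite -e.
  have -> : subdivideT (0 : cochain R K n.+2 X) t = 0.
    by apply: (@sdT_vanish R K n.+1 n.+2) => //; exact: size_vertices.
  by rewrite add0r.
have coD j : coboundary (D j) s =
    iter j (@subdivide n.+1) w s - iter j.+1 (@subdivide n.+1) w s.
  have -> : coboundary (D j) = iter j (@subdivide n.+1) (coboundary (subdivideT w)).
    by rewrite /D; elim: j => //= j IH; rewrite coboundary_subdivide IH.
  by rewrite dT iterB iterSr.
transitivity (\sum_(0 <= j < M) coboundary (D j) s).
  rewrite (eq_bigr (fun j => - (iter j.+1 (@subdivide n.+1) w s -
      iter j (@subdivide n.+1) w s))); last by move=> j _; rewrite coD opprB.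
  rewrite sumrN telescope_sumr // opprB /= hM0 ?subr0 //.
  exact: leq_maxl.
rewrite /coboundary exchange_big /=; apply: eq_bigr => i _.
by rewrite -[reindex s (lift i)]/(face i) etaE mulr_sumr.
Qed.

End small_simplices.
End singular_subdivision.

(** * The cohomology ring *)

Section cohomology_ring.
Context {R : realType} {K : fieldType}.
Implicit Types (X Y Z : topologicalType).

(** Coboundaries, with the convention that only 0 is one in degree 0. *)
Definition exact n X (phi : cochain R K n X) : Prop :=
  match n return cochain R K n X -> Prop with
  | 0 => fun phi => phi = 0
  | m.+1 => fun phi => exists psi, phi = coboundary psi
  end phi.

Lemma is_coboundaryP n X (z : cocycle R K n X) : z \in @is_coboundary R K n X <-> exact z.
Proof.
case: n z => [|n] z /=; last by split=> [/asboolP|/asboolP].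
have v0 := raddf0 (val : cocycle R K 0 X -> cochain R K 0 X).
by rewrite inE v0.
Qed.

Lemma class_eqP n X (z w : cocycle R K n X) :
  cohomology_class z = cohomology_class w <->
  exact (fun s => cocycle_val z s - cocycle_val w s).
Proof.
have -> : (fun s => cocycle_val z s - cocycle_val w s) = cocycle_val (z - w).
  exact/esym/(raddfB (val : cocycle R K n X -> cochain R K n X)).
rewrite -is_coboundaryP (Quotient.idealrBE (@is_coboundary R K n X)).
by split=> [/eqP|/eqP].
Qed.

Lemma classK n X (x : cohomology R K n X) : cohomology_class (repr x) = x.
Proof. exact: reprK. Qed.

Lemma exact0 n X : exact (0 : cochain R K n X).
Proof.
case: n => [//|n]; exists 0; apply/funext => s.
by rewrite /coboundary big1 // => i _; rewrite mulr0.
Qed.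

Lemma repr_class n X (z : cocycle R K n X) :
  exact (fun s => cocycle_val (repr (cohomology_class z)) s - cocycle_val z s).
Proof. by apply/class_eqP; rewrite classK. Qed.

Lemma exactD n X (f g h : cochain R K n X) : (forall s, h s = f s + g s) ->
  exact f -> exact g -> exact h.
Proof.
move=> /funext ->; case: n f g h => [|n] f g h /=; first by move=> -> ->; exact: addr0.
move=> [a ->] [b ->]; exists (a + b); apply/funext => s.
rewrite /coboundary -big_split; apply: eq_bigr => i _ /=.
by rewrite -mulrDr.
Qed.

Lemma class_eq0 n X (z : cocycle R K n X) : cohomology_class z = 0 <-> exact z.
Proof.
have -> : 0 = cohomology_class (0 : cocycle R K n X).
  by rewrite /cohomology_class [RHS]raddf0.
rewrite class_eqP; suff -> : (fun s => cocycle_val z s - cocycle_val 0 s) = cocycle_val z by [].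
apply/funext => s; rewrite (_ : cocycle_val 0 s = 0) ?subr0 //.
Qed.

Lemma vertex_map_id n (x : stdsimplex R n) (g : 'I_n.+1 -> 'I_n.+1) :
  g =1 id -> vertex_map R g x = x.
Proof.
by move=> /funext ->; apply: coord_inj => j; rewrite vertex_mapE big_pred1_eq.
Qed.

Lemma reindex_id n X (s : singular_simplex R n X) (g : 'I_n.+1 -> 'I_n.+1) :
  g =1 id -> reindex s g = s.
Proof.
by move=> gid; apply/continuousEP => x; rewrite /reindex /= vertex_map_id.
Qed.

(** The degree of a cup product with a coboundary on the right is [p + q.+1],
    which is only provably a successor; the simplices are then compared through
    the order isomorphism of their vertices. *)
Lemma exact_cast n m (e : m.+1 = n) X (phi : cochain R K n X) (psi : cochain R K m X) :
  (forall s : singular_simplex R n X,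
     phi s = coboundary psi (reindex s (cast_ord (f_equal S e)))) ->
  exact phi.
Proof.
case: n / e phi => phi h; exists psi; apply/funext => s.
by rewrite h reindex_id // => i; apply: val_inj.
Qed.

Lemma leibniz p q X (phi : cochain R K p X) (psi : cochain R K q X)
    (s : singular_simplex R (p + q).+1 X) :
  coboundary (cup_cochain phi psi) s =
    coboundary phi (reindex s (fun i : 'I_p.+2 => inord i)) *
    psi (reindex s (fun i : 'I_q.+1 => inord (p.+1 + i))) +
    (-1) ^+ p * phi (reindex s (fun i : 'I_p.+1 => inord i)) *
    coboundary psi (reindex s (fun i : 'I_q.+2 => inord (p + i))).
Proof.
pose fp1 (i : 'I_p.+2) : 'I_(p + q).+2 := inord i.
pose bq1 (i : 'I_q.+2) : 'I_(p + q).+2 := inord (p + i).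
pose fp (i : 'I_p.+1) : 'I_(p + q).+2 := inord i.
pose bq (i : 'I_q.+1) : 'I_(p + q).+2 := inord (p.+1 + i).
pose A i := phi (reindex (reindex s fp1) (lift (inord i : 'I_p.+2))).
pose C j := psi (reindex (reindex s bq1) (lift (inord j : 'I_q.+2))).
have -> : coboundary phi (reindex s fp1) = \sum_(0 <= i < p.+2) (-1) ^+ i * A i.
  by rewrite big_mkord; apply: eq_bigr => i _; rewrite /A inord_val.
have -> : coboundary psi (reindex s bq1) = \sum_(0 <= j < q.+2) (-1) ^+ j * C j.
  by rewrite big_mkord; apply: eq_bigr => i _; rewrite /C inord_val.
have Alast : A p.+1 = phi (reindex s fp).
  congr phi; apply: reindex_reindex => i; apply: val_inj.
  have ip := ltn_ord i.
  by rewrite /fp /fp1 /= !inordK /= /bump ?inordK //; lia.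
have C0 : C 0%N = psi (reindex s bq).
  congr psi; apply: reindex_reindex => i; apply: val_inj.
  have ip := ltn_ord i.
  by rewrite /bq /bq1 /= !inordK /= /bump ?inordK //; lia.
pose G i := (-1) ^+ i *
  cup_cochain phi psi (reindex s (lift (inord i : 'I_(p + q).+2))).
transitivity (\sum_(0 <= i < (p + q).+2) G i).
  by rewrite big_mkord; apply: eq_bigr => i _; rewrite /G inord_val.
rewrite (@big_cat_nat _ _ _ p.+1) //=; last by lia.
have -> : \sum_(0 <= i < p.+1) G i =
    (\sum_(0 <= i < p.+1) (-1) ^+ i * A i) * psi (reindex s bq).
  rewrite mulr_suml; apply: eq_big_nat => i /andP[_ ip].
  rewrite -mulrA; congr (_ * _); rewrite /cup_cochain; congr (_ * _).
    congr phi; rewrite (@reindex_reindex _ _ _ _ _ _ _ _ (fp1 \o lift (inord i : 'I_p.+2))).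
      by rewrite (@reindex_reindex _ _ _ _ _ _ _ _ (fp1 \o lift (inord i : 'I_p.+2))).
    move=> j; apply: val_inj; have jp := ltn_ord j.
    by rewrite /fp1 /front /= !inordK /= /bump ?inordK //; lia.
  congr psi; apply: reindex_reindex => j; apply: val_inj; have jp := ltn_ord j.
  by rewrite /bq /back /= !inordK /= /bump ?inordK //; lia.
have -> : \sum_(p.+1 <= i < (p + q).+2) G i =
    (-1) ^+ p * phi (reindex s fp) * \sum_(1 <= j < q.+2) (-1) ^+ j * C j.
  have -> : \sum_(p.+1 <= i < (p + q).+2) G i = \sum_(1 <= j < q.+2) G (j + p)%N.
    have -> : (p + q).+2 = (q.+2 + p)%N by lia.
    by rewrite -{1}[p.+1]add1n big_addn addnK.
  rewrite mulr_sumr /G; apply: eq_big_nat => j /andP[j1 jq].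
  rewrite mulrACA -exprD [(p + j)%N]addnC; congr (_ * _).
  rewrite /cup_cochain; congr (_ * _).
    congr phi; apply: reindex_reindex => i; apply: val_inj; have ip := ltn_ord i.
    by rewrite /fp /front /= !inordK /= /bump ?inordK //; lia.
  congr psi; rewrite (@reindex_reindex _ _ _ _ _ _ _ _ (bq1 \o lift (inord j : 'I_q.+2))).
    by rewrite (@reindex_reindex _ _ _ _ _ _ _ _ (bq1 \o lift (inord j : 'I_q.+2))).
  move=> i; apply: val_inj; have iq := ltn_ord i.
  by rewrite /bq1 /back /= !inordK /= /bump ?inordK //; lia.
rewrite [X in _ = X * _ + _]big_nat_recr //= Alast.
rewrite [X in _ = _ + _ * X]big_ltn // C0 expr0 mul1r exprS; ring.
Qed.

Lemma exact_cupl p q X (phi : cochain R K p X) (psi : cochain R K q X) :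
  exact phi -> psi \in @is_cocycle R K q X -> exact (cup_cochain phi psi).
Proof.
case: p phi => [|p] phi.
  move=> -> _; rewrite (_ : cup_cochain _ _ = 0); first exact: exact0.
  by apply/funext => s; exact: mul0r.
move=> [eta ->] /asboolP dpsi; exists (cup_cochain eta psi); apply/funext => s.
by rewrite leibniz dpsi mulr0 addr0.
Qed.

Lemma exact_cupr p q X (phi : cochain R K p X) (psi : cochain R K q X) :
  phi \in @is_cocycle R K p X -> exact psi -> exact (cup_cochain phi psi).
Proof.
case: q psi => [|q] psi.
  move=> _ ->; rewrite (_ : cup_cochain _ _ = 0); first exact: exact0.
  by apply/funext => s; exact: mulr0.
move=> /asboolP dphi [eta ->].
pose c : K := (-1) ^+ p.
apply: (@exact_cast _ _ (esym (addnS p q)) _ _ (fun s => c * cup_cochain phi eta s)).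
move=> s; transitivity (c * coboundary (cup_cochain phi eta)
    (reindex s (cast_ord (f_equal S (esym (addnS p q)))))); last first.
  by rewrite mulr_sumr; apply: eq_bigr => i _; rewrite mulrCA.
rewrite leibniz dphi mul0r add0r !mulrA -expr2 -exprM mulnC exprM sqrrN !expr1n mul1r.
rewrite /cup_cochain; congr (phi _ * coboundary eta _); apply/esym.
  apply: reindex_reindex => i; apply: val_inj => /=; have ip := ltn_ord i.
  by rewrite /front !inordK //; lia.
apply: reindex_reindex => i; apply: val_inj => /=; have iq := ltn_ord i.
by rewrite /back !inordK //; lia.
Qed.

(** The product is computed on representatives that [repr] picks; by the Leibniz rule
    any others may be taken. *)
Lemma cup_class p q X (z : cocycle R K p X) (w : cocycle R K q X) :
  cup_product (cohomology_class z) (cohomology_class w) =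
  cohomology_class (Cocycle (cup_is_cocycle (cocycleP z) (cocycleP w))).
Proof.
apply/class_eqP => /=.
set z' := repr _; set w' := repr _.
apply: (@exactD _ _ (cup_cochain (fun s => cocycle_val z' s - cocycle_val z s) w')
  (cup_cochain z (fun s => cocycle_val w' s - cocycle_val w s))).
- by move=> s; rewrite /cup_cochain; ring.
- by apply: exact_cupl; [exact: repr_class|exact: cocycleP].
- by apply: exact_cupr; [exact: cocycleP|exact: repr_class].
Qed.

Lemma coboundary_pull X Y n (f : continuousType X Y) (phi : cochain R K n Y) :
  coboundary (pull_cochain f phi) = pull_cochain f (coboundary phi).
Proof.
apply/funext => s; apply: eq_bigr => i _; congr (_ * phi _).
exact/continuousEP.
Qed.

Lemma exact_pull X Y n (f : continuousType X Y) (phi : cochain R K n Y) :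
  exact phi -> exact (pull_cochain f phi).
Proof.
case: n phi => [|n] phi; first by move=> ->.
by move=> [eta ->]; exists (pull_cochain f eta); rewrite coboundary_pull.
Qed.

Lemma map_class X Y n (f : continuousType X Y) (z : cocycle R K n Y) :
  cohomology_map f (cohomology_class z) =
  cohomology_class (Cocycle (pull_is_cocycle f (cocycleP z))).
Proof. by apply/class_eqP; exact: exact_pull (repr_class z). Qed.

Lemma map_cup X Y p q (f : continuousType X Y) (x : cohomology R K p Y)
    (y : cohomology R K q Y) :
  cohomology_map f (cup_product x y) =
  cup_product (cohomology_map f x) (cohomology_map f y).
Proof.
rewrite -(classK x) -(classK y) cup_class !map_class cup_class.
congr cohomology_class; apply: val_inj; apply/funext => s /=.
by rewrite /pull_cochain /cup_cochain; congr (_ * _); congr (cocycle_val _ _);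
  exact/continuousEP.
Qed.

Lemma map_one X Y (f : continuousType X Y) :
  cohomology_map f (cohomology_one R K Y) = cohomology_one R K X.
Proof. by rewrite map_class; congr cohomology_class; exact: val_inj. Qed.

Lemma map_comp X Y Z n (f : continuousType X Y) (g : continuousType Y Z)
    (h : continuousType X Z) (x : cohomology R K n Z) : g \o f =1 h ->
  cohomology_map f (cohomology_map g x) = cohomology_map h x.
Proof.
move=> e; rewrite -(classK x) !map_class; congr cohomology_class; apply: val_inj.
apply/funext => s; rewrite /= /pull_cochain; congr (cocycle_val _ _).
by apply/continuousEP => t; rewrite /push /= -e.
Qed.

Lemma eq_map X Y n (f g : continuousType X Y) (x : cohomology R K n Y) :
  f =1 g -> cohomology_map f x = cohomology_map g x.
Proof. by move=> /continuousEP ->. Qed.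

Lemma map_eq0 X Y n (f : continuousType X Y) (x : cohomology R K n Y) :
  cohomology_map f x = 0 <-> exact (pull_cochain f (repr x)).
Proof. exact: class_eq0. Qed.

Lemma map0 X Y n (f : continuousType X Y) :
  cohomology_map f (0 : cohomology R K n Y) = 0.
Proof.
by apply/map_eq0/exact_pull; apply/class_eq0; rewrite classK.
Qed.

Lemma cup0l p q X (y : cohomology R K q X) : cup_product (0 : cohomology R K p X) y = 0.
Proof.
apply/class_eq0; apply: exact_cupl; last exact: cocycleP.
by apply/class_eq0; rewrite classK.
Qed.

Lemma cup_eq0 p q X (z : cocycle R K p X) (w : cocycle R K q X) :
  cup_product (cohomology_class z) (cohomology_class w) = 0 <->
  exact (cup_cochain z w).
Proof. by rewrite cup_class class_eq0. Qed.

Definition homogeneous_map X Y (f : continuousType X Y) (x : homogeneous R K Y) :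
    homogeneous R K X :=
  homogeneous_class (cohomology_map f (projT2 x)).

Lemma in_imageP X Y (f : continuousType X Y) (x : homogeneous R K X) :
  in_image f x <-> exists y, x = homogeneous_map f y.
Proof.
case: x => n x; split=> [[y _ /= <-]|[[m y] e]].
  by exists (homogeneous_class y).
by rewrite e; exists y.
Qed.

Lemma map_cup_prod X Y (f : continuousType X Y) (s : seq (homogeneous R K Y)) :
  cup_prod (map (homogeneous_map f) s) = homogeneous_map f (cup_prod s).
Proof.
elim: s => [|x s /= ->] /=; first by rewrite /homogeneous_map /= map_one.
by rewrite /homogeneous_map /= map_cup.
Qed.

End cohomology_ring.

(** * The topology of the realization *)

Lemma common_bound (R : realDomainType) (T : eqType) (P : T -> R -> Prop) (s : seq T) :
  (forall x e d, 0 < d -> d <= e -> P x e -> P x d) ->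
  (forall x, x \in s -> exists2 e, 0 < e & P x e) ->
  exists2 e, 0 < e & forall x, x \in s -> P x e.
Proof.
move=> Pd; elim: s => [|y s IH] h; first by exists 1 => // x; rewrite in_nil.
have [x xs|e e0 he] := IH; first by apply: h; rewrite inE xs orbT.
have [d d0 hd] := h y (mem_head _ _).
have m0 : 0 < Num.min e d by rewrite lt_min e0.
exists (Num.min e d) => // x; rewrite inE => /predU1P[->|/he].
  by apply: Pd hd => //; rewrite ge_min lexx orbT.
by apply: Pd => //; rewrite ge_min lexx.
Qed.

Section realization_points.
Context {R : realType} {V : choiceType} {L : simplicial_complex V}.
Implicit Types (p q : realization R L) (v : V).

Definition supp p : {fset V} := finsupp (val p).

Lemma weight_ge0 p v : 0 <= val p v.
Proof. by have /asboolP[h _ _] := valP p. Qed.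

Lemma weight_sum p : \sum_(v <- supp p) val p v = 1.
Proof. by have /asboolP[_ h _] := valP p. Qed.

Lemma supp_simplex p : simplices L (supp p).
Proof. by have /asboolP[_ _ h] := valP p. Qed.

Lemma in_supp p v : (v \in supp p) = (0 < val p v).
Proof. by rewrite mem_finsupp lt0r weight_ge0 andbT. Qed.

Lemma weight0 p v : v \notin supp p -> val p v = 0.
Proof. by move=> h; exact: fsfun_dflt. Qed.

Lemma realization_eq p q : (forall v, val p v = val q v) -> p = q.
Proof. by move=> h; apply/val_inj/fsfunP. Qed.

(** The piecewise linear extension to the realization of a function on the
    vertices. *)
Definition lin (g : V -> R) p := \sum_(v <- supp p) val p v * g v.

Lemma linE (F : {fset V}) g p : (supp p `<=` F)%fset ->
  lin g p = \sum_(v <- F) val p v * g v.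
Proof.
move=> pF; rewrite /lin (big_fset_incl _ pF) // => v _ vp.
by rewrite weight0 // mul0r.
Qed.

Lemma weight_lin v p : val p v = lin (fun u => (u == v)%:R) p.
Proof.
rewrite (@linE (v |` supp p)%fset) ?fsubsetUr // (big_fsetD1 v) /= ?fset1U1 //.
rewrite eqxx mulr1 big1_fset ?addr0 // => u.
by rewrite !inE => /andP[/negbTE -> _] _; rewrite mulr0.
Qed.

Lemma lin1 p : lin (fun=> 1) p = 1.
Proof. by rewrite /lin -[RHS](weight_sum p); apply: eq_bigr => v _; rewrite mulr1. Qed.

Lemma lin_ge0 g p : (forall v, 0 <= g v) -> 0 <= lin g p.
Proof. by move=> g0; apply: sumr_ge0 => v _; rewrite mulr_ge0 ?weight_ge0. Qed.

Lemma realization_openE (A : set (realization R L)) : open A = @coherent_open R V L A.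
Proof. by []. Qed.

(** On a closed simplex the sum has a fixed finite number of terms, each with a bounded
    coefficient. *)
Lemma lin_cts g : continuous (lin g).
Proof.
apply/continuousP => A oA; rewrite realization_openE => s p Ss ps Ap.
have /nbhs_ballP[e /= e0 eA] : nbhs (lin g p) A by exact: open_nbhs_nbhs.
pose M := 1 + \sum_(v <- s) `|g v|.
have M0 : 0 < M by rewrite ltr_pwDl // sumr_ge0.
exists (e / M); first by rewrite divr_gt0.
move=> q qs pq; apply: eA; rewrite /ball /= (linE _ ps) (linE _ qs) -sumrB.
apply: (le_lt_trans (ler_norm_sum _ _ _)).
apply: (@le_lt_trans _ _ (e / M * \sum_(v <- s) `|g v|)).
  rewrite mulr_sumr; apply: ler_sum => v _.
  by rewrite -mulrBl normrM ler_wpM2r // ltW.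
by rewrite mulrAC ltr_pdivrMr // ltr_pM2l // ltrDr.
Qed.

Lemma weight_cts v : continuous (fun p => val p v).
Proof.
have -> : (fun p => val p v) = lin (fun u => (u == v)%:R).
  by apply/funext => p; exact: weight_lin.
exact: lin_cts.
Qed.

Lemma simplex_realization_subproof (F : {fset V}) (w : V -> R) :
  (forall v, 0 <= w v) -> \sum_(v <- F) w v = 1 -> simplices L F ->
  `[< barycentric L [fsfun v in F => w v | 0] >].
Proof.
move=> w0 w1 LF; set f := (X in barycentric L X).
have fE v : f v = if v \in F then w v else 0 by rewrite fsfunE.
have fF : (finsupp f `<=` F)%fset.
  by apply/fsubsetP => v; rewrite mem_finsupp fE; case: ifP => // _; rewrite eqxx.
have f1 : \sum_(v <- finsupp f) f v = 1.
  rewrite -w1 (big_fset_incl _ fF) => [|v vF]; last first.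
    by rewrite mem_finsupp negbK => /eqP.
  by apply: eq_big_seq => v vF; rewrite fE vF.
apply/asboolP; split=> // [v|]; first by rewrite fE; case: ifP.
apply: simplices_down LF _ fF; apply: contra_eq_neq f1 => ->.
by rewrite big_seq_fset0 eq_sym oner_neq0.
Qed.

Definition simplex_realization (F : {fset V}) (w : V -> R)
    (w0 : forall v, 0 <= w v) (w1 : \sum_(v <- F) w v = 1) (LF : simplices L F) :
    realization R L :=
  exist _ [fsfun v in F => w v | 0] (simplex_realization_subproof w0 w1 LF).

Lemma simplex_realizationE F w w0 w1 LF v :
  val (@simplex_realization F w w0 w1 LF) v = if v \in F then w v else 0.
Proof. by rewrite /= fsfunE. Qed.

Lemma supp_simplex_realization F w w0 w1 LF :
  (supp (@simplex_realization F w w0 w1 LF) `<=` F)%fset.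
Proof.
apply/fsubsetP => v; rewrite in_supp simplex_realizationE.
by case: ifP => // _; rewrite ltxx.
Qed.

Lemma nbhs_realization p N : nbhs p N ->
  forall s, simplices L s -> (supp p `<=` s)%fset ->
  exists2 e : R, 0 < e & forall q, (supp q `<=` s)%fset ->
    (forall v, `|val p v - val q v| < e) -> N q.
Proof.
have nbhs_open (T : topologicalType) (x : T) A : nbhs x A ->
    exists U, [/\ open U, U x & U `<=` A].
  by rewrite nbhsE => -[U [oU Ux] UA]; exists U.
move=> /nbhs_open[U [oU Up UN]] s Ls ps; rewrite realization_openE in oU.
have [e e0 he] := oU s p Ls ps Up.
by exists e => // q qs pq; apply: UN; exact: he.
Qed.

(** A point near [p] with vertices in a fixed finite set has a carrier that
    contains the carrier of [p], because weights that are positive at [p] stay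
    positive; finitely many closed simplices are then to be inspected. *)
Lemma open_realization (A : set (realization R L)) p (F : {fset V}) :
  open A -> A p -> exists2 e : R, 0 < e & forall q, (supp q `<=` F)%fset ->
    (forall v, `|val p v - val q v| < e) -> A q.
Proof.
rewrite realization_openE => oA Ap.
have [e e0 he] : exists2 e : R, 0 < e & forall v, v \in supp p -> e <= val p v.
  apply: (common_bound (s := supp p)) => [v e d _ de|v]; first exact: le_trans.
  by rewrite in_supp => pv; exists (val p v).
have [d d0 hd] : exists2 d : R, 0 < d & forall s, s \in fpowerset F ->
    simplices L s -> (supp p `<=` s)%fset -> forall q, (supp q `<=` s)%fset ->
    (forall v, `|val p v - val q v| < d) -> A q.
  apply: (common_bound (s := fpowerset F)) => [s e' d _ de h Ls ps q qs pq|s _].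
    by apply: h => // v; exact: lt_le_trans (pq v) de.
  have [[Ls ps]|h] := pselect (simplices L s /\ (supp p `<=` s)%fset).
    by have [d d0 hd] := oA s p Ls ps Ap; exists d.
  by exists 1 => // Ls ps; case: h.
exists (Num.min e d); first by rewrite lt_min e0.
move=> q qF pq; apply: (hd (supp q)) => //.
- by rewrite fpowersetE.
- exact: supp_simplex.
- apply/fsubsetP => v vp; rewrite in_supp.
  have := pq v; rewrite lt_min => /andP[+ _]; have := he v vp.
  by rewrite ltr_norml => h1 /andP[]; lra.
by move=> v; have := pq v; rewrite lt_min => /andP[].
Qed.

Lemma near_seq (T : topologicalType) (z : T) (P : V -> set T) (s : seq V) :
  (forall v, \forall z' \near z, P v z') ->
  \forall z' \near z, forall v, v \in s -> P v z'.
Proof.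
move=> h; elim: s => [|u s IH]; first by apply: filterE.
apply: filterS2 (h u) IH => z' h1 h2 v; rewrite inE => /predU1P[->//|]; exact: h2.
Qed.

(** With vertices confined to a finite set, the coherent topology is tested on
    finitely many simplices, and continuity on coordinates. *)
Lemma realization_cts (Z : topologicalType) (h : Z -> realization R L) (F : {fset V}) :
  (forall z, (supp (h z) `<=` F)%fset) ->
  (forall v, continuous (fun z => val (h z) v)) -> continuous h.
Proof.
move=> hF ch; apply/continuousP => A oA; rewrite openE => z Ahz.
have [e e0 he] := open_realization F oA Ahz.
have : \forall z' \near z, forall v, v \in (F : seq V) -> `|val (h z) v - val (h z') v| < e.
  by apply: near_seq => v; have /cvgr_dist_lt := ch v z; exact.
apply: filterS => z' hz'; apply: he => // v.
have [vF|vF] := boolP (v \in F); first exact: hz'.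
by rewrite !weight0 ?subr0 ?normr0 //; apply: contra vF; exact: (fsubsetP (hF _)).
Qed.

(** A compact subset meets finitely many open cells only. For every vertex [v]
    that is used, choose a point with weight [eps v > 0] at [v]. The open sets
    [U F], where the weights outside of [F] are smaller than the chosen ones, are
    directed and cover the realization, hence a single one contains the image of
    [s]; but [U F] contains no point chosen for a vertex outside of [F]. *)
Lemma compact_supp n (s : singular_simplex R n (realization R L)) :
  exists F : {fset V}, forall x, (supp (s x) `<=` F)%fset.
Proof.
have [eps heps] : {eps : V -> R | forall v, (exists x, v \in supp (s x)) ->
    0 < eps v /\ exists x, val (s x) v = eps v}.
  have h v : {e : R | (exists x, v \in supp (s x)) -> 0 < e /\ exists x, val (s x) v = e}.
    have [/cid[x vx]|h] := pselect (exists x, v \in supp (s x)).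
      by exists (val (s x) v) => _; split; [rewrite -in_supp|exists x].
    by exists 0 => /h.
  by exists (fun v => sval (h v)) => v; exact: (svalP (h v)).
pose W v := exists x, v \in supp (s x).
pose U (F : {fset V}) : set (realization R L) :=
  [set q : realization R L | forall v, v \notin F -> W v -> val q v < eps v].
have oU F : open (U F).
  rewrite realization_openE => t p Lt pt Up.
  have [e e0 he] : exists2 e : R, 0 < e & forall v, v \in t -> v \notin F -> W v ->
      e <= eps v - val p v.
    apply: (common_bound (s := t)) => [v e d _ de h vF Wv|v _].
      exact: le_trans de (h vF Wv).
    have [[vF Wv]|h] := pselect (v \notin F /\ W v).
      by exists (eps v - val p v) => //; rewrite subr_gt0; exact: Up.
    by exists 1 => // vF Wv; case: h.
  exists e => // q qt pq v vF Wv.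
  have [vt|vt] := boolP (v \in t).
    have := he v vt vF Wv; have := pq v; rewrite ltr_norml => /andP[]; lra.
  rewrite weight0; first by have [] := heps v Wv.
  by apply: contra vt; exact: (fsubsetP qt).
pose large : set_system {fset V} :=
  filter_from setT (fun F => [set G | (F `<=` G)%fset]).
have flarge : Filter large.
  apply: filter_from_filter; first by exists fset0.
  by move=> F G _ _; exists (F `|` G)%fset => // H /=; rewrite fsubUset => /andP[].
have [F _ hF] : \forall F \near large, [set: stdsimplex R n] `<=` [set x | U F (s x)].
  apply: (iffLR (compact_near_coveringP _) (@simplex_compact R n)) => x _.
  exists (s @^-1` U (supp (s x)), [set G | (supp (s x) `<=` G)%fset]).
    split; last by exists (supp (s x)).
    apply: (@cts_fun _ _ s x); apply: open_nbhs_nbhs; split; first exact: oU.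
    by move=> v vs Wv; rewrite weight0 //; have [] := heps v Wv.
  move=> [y G] [/= Uy xG] v vG Wv; apply: Uy => //.
  by apply: contra vG; exact: (fsubsetP xG).
exists F => x; apply/fsubsetP => v vx.
have Wv : W v by exists x.
have [_ [y vy]] := heps v Wv.
have [vF|vF] := boolP (v \in F) => //.
by have := hF F (fsubset_refl F) y Logic.I v vF Wv; rewrite vy ltxx.
Qed.

End realization_points.

(** * Contiguous maps *)

(** The cancellation behind the prism operator, with all geometry removed:
    [X i j] is the face [j] of the [i]-th simplex of a subdivided prism, and
    [Y i j] is the [i]-th simplex of the prism over the face [j]. The inner faces
    [B i] cancel in pairs. *)
Lemma prism_sum (K : comNzRingType) (M : nat) (X Y : nat -> nat -> K) (B : nat -> K) :
  (forall i, (i <= M)%N -> X i i = B i) ->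
  (forall i, (i <= M)%N -> X i i.+1 = B i.+1) ->
  (forall i j, (i < M)%N -> (j <= i)%N -> X i.+1 j = Y i j) ->
  (forall i j, (i < M)%N -> (i < j <= M)%N -> X i j.+1 = Y i j) ->
  \sum_(0 <= i < M.+1) (-1) ^+ i * (\sum_(0 <= j < M.+2) (-1) ^+ j * X i j) +
  \sum_(0 <= j < M.+1) (-1) ^+ j * (\sum_(0 <= i < M) (-1) ^+ i * Y i j) =
  B 0%N - B M.+1.
Proof.
move=> Xd Xd' Xl Xr.
pose Lo i := \sum_(0 <= j < i) (-1) ^+ j * X i j.
pose Hi i := \sum_(i.+1 <= j < M.+1) (-1) ^+ j * X i j.+1.
have sq i : (-1) ^+ i * (-1) ^+ i = 1 :> K by rewrite -expr2 -exprM mulnC exprM sqrrN !expr1n.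
have inner i : (i < M.+1)%N -> \sum_(0 <= j < M.+2) (-1) ^+ j * X i j =
    Lo i + (-1) ^+ i * (B i - B i.+1) - Hi i.
  move=> iM; rewrite (@big_cat_nat _ _ _ i) //=; last by lia.
  have iM2 : (i < M.+2)%N by lia.
  have iM3 : (i.+1 < M.+2)%N by lia.
  rewrite (big_ltn iM2) (big_ltn iM3).
  rewrite Xd // Xd' // [\sum_(i.+2 <= _ < _) _]big_add1 /=.
  have -> : \sum_(i.+1 <= j < M.+1) (-1) ^+ j.+1 * X i j.+1 = - Hi i.
    by rewrite -sumrN; apply: eq_bigr => j _; rewrite exprS; ring.
  by rewrite /Lo exprS; ring.
rewrite (eq_big_nat _ _ (F2 := fun i => (-1) ^+ i * Lo i - (-1) ^+ i * Hi i +
    (B i - B i.+1))); last first.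
  move=> i /andP[_ iM]; rewrite inner //.
  transitivity ((-1) ^+ i * Lo i - (-1) ^+ i * Hi i +
    ((-1) ^+ i * (-1) ^+ i) * (B i - B i.+1)); first by ring.
  by rewrite sq mul1r.
rewrite !big_split /= sumrN.
have -> : \sum_(0 <= i < M.+1) B i + \sum_(0 <= i < M.+1) - B i.+1 = B 0%N - B M.+1.
  rewrite -big_split /= (eq_bigr (fun i => - (B i.+1 - B i))); last by move=> i _; rewrite opprB.
  by rewrite sumrN telescope_sumr // opprB.
have Lo0 : Lo 0%N = 0 by rewrite /Lo big_geq.
have HiM : Hi M = 0 by rewrite /Hi big_geq.
rewrite [\sum_(0 <= i < M.+1) _ * Lo i]big_nat_recl // Lo0 mulr0 add0r.
rewrite [\sum_(0 <= i < M.+1) _ * Hi i]big_nat_recr //= HiM mulr0 addr0.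
under [X in _ + X = _]eq_bigr do rewrite mulr_sumr.
rewrite [X in _ + X = _]exchange_big_nat /=.
have -> : \sum_(0 <= i < M) \sum_(0 <= j < M.+1) (-1) ^+ j * ((-1) ^+ i * Y i j) =
    \sum_(0 <= i < M) ((-1) ^+ i * Hi i - (-1) ^+ i.+1 * Lo i.+1).
  apply: eq_big_nat => i /andP[_ iM].
  rewrite (@big_cat_nat _ _ _ i.+1) //=; last by lia.
  rewrite addrC; congr (_ + _).
    rewrite /Hi mulr_sumr; apply: eq_big_nat => j ij.
    by rewrite mulrCA Xr //; lia.
  rewrite /Lo exprS mulN1r mulNr opprK mulr_sumr; apply: eq_big_nat => j ji.
  by rewrite mulrCA Xl //; lia.
rewrite sumrB; ring.
Qed.

Section contiguous_maps.
Context {R : realType} {K : fieldType} {V : choiceType} {L : simplicial_complex V}.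
Context {Z : topologicalType}.

Definition contiguous (h h' : Z -> realization R L) :=
  forall z, simplices L (supp (h z) `|` supp (h' z))%fset.

Section prism.
Context (h h' : continuousType Z (realization R L)).
Hypothesis hh' : contiguous h h'.

(** The height over the base of the prism, on a simplex whose vertices [k] with
    [e k] lie on the top and whose other vertices lie on the bottom. *)
Definition upper_weight m (e : pred nat) (x : stdsimplex R m) : R :=
  \sum_(k < m.+1 | e k) val x 0 k.

Lemma upper_weight_itv m e (x : stdsimplex R m) : 0 <= upper_weight e x <= 1.
Proof.
apply/andP; split; first by apply: sumr_ge0 => i _; exact: coord_ge0.
rewrite -(coord_sum x) [leRHS](bigID (fun i : 'I_m.+1 => e i)) /= lerDl.
by apply: sumr_ge0 => i _; exact: coord_ge0.
Qed.

Lemma upper_weight_cts m e : continuous (@upper_weight m e).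
Proof.
have -> : @upper_weight m e = fun x => \sum_(k < m.+1) val x 0 k * (e k)%:R.
  apply/funext => x; rewrite /upper_weight big_mkcond; apply: eq_bigr => i _.
  by case: (e i); rewrite ?mulr1 ?mulr0.
apply: continuous_sum => i.
by apply: continuous_mul; [exact: coord_cts|exact: cst_continuous].
Qed.

Lemma upper_weight_map l m (f : 'I_l.+1 -> 'I_m.+1) (e e' : pred nat) (x : stdsimplex R l) :
  (forall k : 'I_l.+1, e' k = e (f k)) ->
  upper_weight e (vertex_map R f x) = upper_weight e' x.
Proof.
move=> ee'; rewrite /upper_weight [RHS](partition_big f (fun k : 'I_m.+1 => e k)) //=.
  apply: eq_bigr => k ek; rewrite vertex_mapE; apply: eq_bigl => i.
  by rewrite ee'; case: eqP => [->|]; rewrite ?ek // andbF.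
by move=> i; rewrite ee'.
Qed.

Lemma mix_subproof z : let F := (supp (h z) `|` supp (h' z))%fset in
  forall t : R, 0 <= t <= 1 ->
  (forall v, 0 <= (1 - t) * val (h z) v + t * val (h' z) v) /\
  \sum_(v <- F) ((1 - t) * val (h z) v + t * val (h' z) v) = 1.
Proof.
move=> F t /andP[t0 t1]; split=> [v|].
  by rewrite addr_ge0 // mulr_ge0 ?weight_ge0 // subr_ge0.
rewrite big_split -!mulr_sumr /=.
have e q : (supp q `<=` F)%fset -> \sum_(v <- F) val q v = 1 :> R.
  move=> qF; rewrite -(lin1 q) (linE _ qF); apply: eq_bigr => v _.
  by rewrite mulr1.
by rewrite !e ?fsubsetUl ?fsubsetUr // !mulr1 subrK.
Qed.

Definition mix z (t : R) (t01 : 0 <= t <= 1) : realization R L :=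
  simplex_realization (mix_subproof z t01).1 (mix_subproof z t01).2 (hh' z).

Lemma mixE z t t01 v :
  val (@mix z t t01) v = (1 - t) * val (h z) v + t * val (h' z) v.
Proof.
rewrite simplex_realizationE in_fsetU; case: ifP => // /norP[h1 h2].
by rewrite !weight0 // !mulr0 addr0.
Qed.

Context {n : nat} (s : singular_simplex R n Z).

(** A simplex in the prism over [s], given by the projection [g] of its vertices to the
    base and by the set [e] of its vertices on the top, mapped by the straight
    homotopy from [h] to [h']. *)
Definition prism_fun m (g : 'I_m.+1 -> 'I_n.+1) (e : pred nat) (x : stdsimplex R m) :
    realization R L :=
  mix (s (vertex_map R g x)) (upper_weight_itv e x).

(** The images of [s] under [h] and [h'] have vertices in a finite set, so that the
    coordinates decide. *)
Lemma prism_fun_cts m g e : continuous (@prism_fun m g e).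
Proof.
have [F hF] := compact_supp (push h s); have [F' hF'] := compact_supp (push h' s).
apply: (@realization_cts _ _ _ _ _ (F `|` F')%fset) => [x|v].
  apply: fsubset_trans (supp_simplex_realization _ _ _) _.
  by apply: fsetUSS; [exact: hF|exact: hF'].
have cs : continuous (fun x => s (vertex_map R g x)).
  by move=> x; apply: continuous_comp; [exact: vertex_map_continuous|exact: cts_fun].
have ch (f : continuousType Z (realization R L)) :
    continuous (fun x => val (f (s (vertex_map R g x))) v).
  move=> x; apply: (@continuous_comp _ _ _ (fun x => f (s (vertex_map R g x)))
     (fun p : realization R L => val p v)); last exact: weight_cts.
  by apply: (@continuous_comp _ _ _ (fun x => s (vertex_map R g x)) f);
    [exact: cs|exact: cts_fun].
rewrite (_ : (fun z => _) = fun x => (1 - upper_weight e x) *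
   val (h (s (vertex_map R g x))) v + upper_weight e x *
   val (h' (s (vertex_map R g x))) v); last by apply/funext => x; rewrite mixE.
apply: continuous_add; apply: continuous_mul; try exact: ch.
  apply: continuous_add; first exact: cst_continuous.
  by apply: continuous_opp; exact: upper_weight_cts.
exact: upper_weight_cts.
Qed.

HB.instance Definition _ m g e :=
  isContinuous.Build _ _ (@prism_fun m g e) (@prism_fun_cts m g e).

Definition prism m (g : 'I_m.+1 -> 'I_n.+1) (e : pred nat) :
    singular_simplex R m (realization R L) :=
  prism_fun g e.

End prism.

Section prism_theory.
Context (h h' : continuousType Z (realization R L)).
Hypothesis hh' : contiguous h h'.
Implicit Types (m n : nat).

Lemma prismE m n (s : singular_simplex R n Z) (g : 'I_m.+1 -> 'I_n.+1) e x v :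
  val (prism hh' s g e x) v = (1 - upper_weight e x) * val (h (s (vertex_map R g x))) v +
    upper_weight e x * val (h' (s (vertex_map R g x))) v.
Proof. exact: mixE. Qed.

Lemma eq_prism m n (s : singular_simplex R n Z) (g g' : 'I_m.+1 -> 'I_n.+1) (e e' : pred nat) :
  g =1 g' -> (forall k, (k < m.+1)%N -> e k = e' k) ->
  prism hh' s g e = prism hh' s g' e'.
Proof.
move=> /funext -> ee'; apply/continuousEP => x; apply: realization_eq => v.
rewrite !prismE (_ : upper_weight e x = upper_weight e' x) //.
by apply: eq_bigl => k; exact: ee'.
Qed.

Lemma reindex_prism l m n (s : singular_simplex R n Z) (g : 'I_m.+1 -> 'I_n.+1) (e : pred nat)
    (f : 'I_l.+1 -> 'I_m.+1) (e' : pred nat) : (forall k : 'I_l.+1, e' k = e (f k)) ->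
  reindex (prism hh' s g e) f = prism hh' s (g \o f) e'.
Proof.
move=> ee'; apply/continuousEP => x; apply: realization_eq => v.
rewrite -[LHS]/(val (prism hh' s g e (vertex_map R f x)) v) !prismE vertex_map_comp.
by rewrite (upper_weight_map _ ee').
Qed.

Lemma prism_reindex l m n (s : singular_simplex R n Z) (f : 'I_l.+1 -> 'I_n.+1)
   (g : 'I_m.+1 -> 'I_l.+1) e :
  prism hh' (reindex s f) g e = prism hh' s (f \o g) e.
Proof.
apply/continuousEP => x; apply: realization_eq => v.
by rewrite !prismE /reindex /= vertex_map_comp.
Qed.

Lemma prism0 n (s : singular_simplex R n Z) g (e : pred nat) : g =1 id ->
  (forall k : 'I_n.+1, e k = false) -> prism hh' s g e = push h s.
Proof.
move=> gid e0; apply/continuousEP => x; apply: realization_eq => v.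
rewrite prismE vertex_map_id // /upper_weight big1 ?subr0 ?mul1r ?mul0r ?addr0 //.
by move=> k; rewrite e0.
Qed.

Lemma prism1 n (s : singular_simplex R n Z) g (e : pred nat) : g =1 id ->
  (forall k : 'I_n.+1, e k) -> prism hh' s g e = push h' s.
Proof.
move=> gid e1; apply/continuousEP => x; apply: realization_eq => v.
rewrite prismE vertex_map_id // /upper_weight.
rewrite (eq_bigl xpredT); last by move=> k; rewrite e1.
by rewrite coord_sum subrr mul0r mul1r add0r.
Qed.

(** In the [i]-th simplex of the prism, the vertex [i] of the base occurs twice, first
    on the bottom and then on the top: [unbump i] sends both [i] and [i.+1] to
    [i]. *)
Definition prism_cochain n (phi : cochain R K n.+1 (realization R L)) : cochain R K n Z :=
  fun s => \sum_(0 <= i < n.+1) (-1) ^+ i *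
    phi (prism hh' s (fun k : 'I_n.+2 => inord (unbump i k)) (fun k => i < k)%N).

Lemma prism_homotopy n (phi : cochain R K n.+1 (realization R L)) s :
  prism_cochain (coboundary phi) s + coboundary (prism_cochain phi) s =
  phi (push h' s) - phi (push h s).
Proof.
pose PR (u : nat -> nat) e := phi (prism hh' s (fun k : 'I_n.+2 => inord (u k)) e).
pose X i j := PR (unbump i \o bump j) (fun k => i < bump j k)%N.
pose Y i j := PR (bump j \o unbump i) (fun k => i < k)%N.
pose B i := PR id (fun k => i <= k)%N.
have eqPR u u' e e' : (forall k, (k < n.+2)%N -> u k = u' k) ->
    (forall k, (k < n.+2)%N -> e k = e' k) -> PR u e = PR u' e'.
  by move=> hu he; congr phi; apply: eq_prism => // k; rewrite hu.
have := @prism_sum K n.+1 X Y B.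
have -> : B 0%N = phi (push h' s).
  by congr phi; apply: prism1 => // k; apply: val_inj; rewrite /= inordK.
have -> : B n.+2 = phi (push h s).
  congr phi; apply: prism0 => // k; last by rewrite leqNgt ltn_ord.
  by apply: val_inj; rewrite /= inordK.
move=> <-.
- congr (_ + _).
    apply: eq_big_nat => i /andP[_ iM]; congr (_ * _).
    rewrite big_mkord; apply: eq_bigr => j _; congr (_ * phi _).
    rewrite (@reindex_prism _ _ _ _ _ _ _ (fun k => i < bump j k)%N) //.
  rewrite big_mkord; apply: eq_bigr => j _; congr (_ * _).
  apply: eq_big_nat => i /andP[_ iM]; congr (_ * phi _).
  rewrite prism_reindex; apply: eq_prism => // k; apply: val_inj.
  have kn := ltn_ord k; have jn := ltn_ord j.
  by rewrite /= /bump /unbump !inordK //; lia.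
- by move=> i iM; apply: eqPR => k kn; rewrite /= /bump /unbump; lia.
- by move=> i iM; apply: eqPR => k kn; rewrite /= /bump /unbump; lia.
- by move=> i j iM ji; apply: eqPR => k kn; rewrite /= /bump /unbump; lia.
- by move=> i j iM ji; apply: eqPR => k kn; rewrite /= /bump /unbump; lia.
Qed.

(** The straight homotopy stays inside the simplices that [contiguous] provides. *)
Lemma contiguous_map_eq n (x : cohomology R K n.+1 (realization R L)) :
  cohomology_map h x = cohomology_map h' x.
Proof.
apply/esym; rewrite -(classK x) !map_class; apply/class_eqP => /=.
set z := repr x; have /asboolP dz := cocycleP z.
exists (prism_cochain z); apply/funext => s; rewrite /pull_cochain -prism_homotopy dz.
by rewrite /prism_cochain big1 ?add0r // => i _; exact: mulr0.
Qed.

End prism_theory.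

Definition vertex_valued (h : Z -> realization R L) :=
  forall z, exists v, supp (h z) = [fset v]%fset.

(** The weights of [h] are 0 or 1 everywhere, and continuous on a connected
    simplex. *)
Lemma vertex_valued_const (h : continuousType Z (realization R L)) n
    (s : singular_simplex R n Z) x y : vertex_valued h -> h (s x) = h (s y).
Proof.
move=> hv.
have w01 z v : val (h z) v = (v \in supp (h z))%:R.
  have [u hu] := hv z; rewrite hu inE.
  have [->|vu] := eqVneq v u; last by rewrite weight0 // hu inE.
  have := weight_sum (h z); rewrite hu big_seq_fset1 => ->; by [].
apply: realization_eq => v; apply: contrapT => xy.
pose g x := val (h (s x)) v.
have cg : continuous g.
  move=> t; apply: (@continuous_comp _ _ _ (fun x => h (s x))
     (fun p : realization R L => val p v)); last exact: weight_cts.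
  by apply: (@continuous_comp _ _ _ s h); exact: cts_fun.
have no t : g t <> 2^-1.
  rewrite /g w01; case: (_ \in _) => /= e; lra.
have hxy : g x = 0 /\ g y = 1 \/ g y = 0 /\ g x = 1.
  move: xy; rewrite /g !w01; do 2 case: (_ \in _) => //; by [right|left].
by case: hxy => -[e0 e1]; [have [|z] := @simplex_ivt R n g x y 2^-1 cg
  |have [|z] := @simplex_ivt R n g y x 2^-1 cg]; rewrite ?e0 ?e1; by [lra|move/no].
Qed.

Lemma sum_sign n : odd n -> \sum_(i < n) (-1) ^+ i = 1 :> K.
Proof.
move=> on; rewrite -[n]odd_double_half on /=.
elim: n./2 => [|k IH]; first by rewrite big_ord1 expr0.
rewrite doubleS !addnS 2!big_ord_recr /= IH [(-1) ^+ _.+1]exprS; ring.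
Qed.

(** On constant simplices the coboundary is multiplication by 0 or by 1,
    according to the parity of the degree. *)
Lemma vertex_valued_eq0 (h : continuousType Z (realization R L)) n
    (x : cohomology R K n.+1 (realization R L)) :
  vertex_valued h -> cohomology_map h x = 0.
Proof.
move=> hv; apply/map_eq0; set z := cocycle_val (repr x); have /asboolP dz := cocycleP (repr x).
case: (boolP (odd n)) => [on|en].
  exists (fun t => z (reindex (push h t) (fun=> ord0))); apply/funext => s.
  rewrite /coboundary (eq_bigr (fun i : 'I_n.+2 => (-1) ^+ i * z (push h s))).
    by rewrite -mulr_suml sum_sign ?mul1r //= on.
  move=> i _; congr (_ * z _); apply/continuousEP => y.
  rewrite /reindex /push /=; exact: vertex_valued_const.
rewrite (_ : pull_cochain h z = 0); first exact: exact0.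
apply/funext => s; rewrite /pull_cochain.
have /(congr1 (fun f => f (reindex (push h s) (fun _ : 'I_n.+3 => ord0)))) := dz.
rewrite /coboundary (eq_bigr (fun i : 'I_n.+3 => (-1) ^+ i * z (push h s))).
  by rewrite -mulr_suml sum_sign ?mul1r //= negbK.
move=> i _; congr (_ * z _); apply/continuousEP => y.
rewrite /reindex /push /=; exact: vertex_valued_const.
Qed.

End contiguous_maps.

(** * Cup products and open covers *)

Section covers.
Context {R : realType} {K : fieldType} {X : topologicalType}.

Definition include (U : set X) (x : U) : X := set_val x.

Lemma include_cts (U : set X) : continuous (@include U).
Proof. exact: initial_continuous. Qed.

HB.instance Definition _ (U : set X) := isContinuous.Build _ _ (@include U) (@include_cts U).

Section corestriction.
Context {U : set X} {n : nat} (s : singular_simplex R n X).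
Hypothesis sU : range s `<=` U.

Definition corestrict_fun (x : stdsimplex R n) : U :=
  exist _ (s x) (mem_set (sU (imageT s x))).

Lemma corestrict_cts : continuous corestrict_fun.
Proof. by apply: continuous_comp_initial; exact: (@cts_fun _ _ s). Qed.

HB.instance Definition _ := isContinuous.Build _ _ corestrict_fun corestrict_cts.

Definition corestrict : singular_simplex R n U := corestrict_fun.

End corestriction.

(** Extend the cochain that cobounds on [U] by zero to the simplices outside [U]. *)
Lemma extend_cobounding (U : set X) n (phi : cochain R K n.+1 X) :
  exact (pull_cochain (@include U) phi) ->
  exists eta : cochain R K n X, forall s : singular_simplex R n.+1 X,
    range s `<=` U -> phi s = coboundary eta s.
Proof.
move=> [eta eE].
exists (fun s : singular_simplex R n X =>
  if pselect (range s `<=` U) is left h then eta (corestrict h) else 0).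
move=> s sU; have -> : phi s = coboundary eta (corestrict sU).
  by rewrite -eE /pull_cochain; congr phi; exact/continuousEP.
apply: eq_bigr => i _; congr (_ * _); case: pselect => [h|[]].
  by congr eta; apply/continuousEP => x; exact: val_inj.
by move=> _ [x _ <-]; apply: sU; exact: imageT.
Qed.

(** The relative cup product argument: cocycles representing the two factors can
    be chosen to vanish on the simplices in [U] and in [V], respectively, so that
    their product vanishes on the simplices in either. *)
Lemma cup_eq0_cover (Y : topologicalType) (f : continuousType X Y) (U V : set X) p q
    (x : cohomology R K p.+1 Y) (y : cohomology R K q.+1 Y) :
  open U -> open V -> U `|` V = setT ->
  cohomology_map (f \o @include U) x = 0 ->
  cohomology_map (f \o @include V) y = 0 ->
  cup_product (cohomology_map f x) (cohomology_map f y) = 0.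
Proof.
move=> oU oV UV /map_eq0 Ux /map_eq0 Vy.
set z := pull_cochain f (repr x) in Ux *; set w := pull_cochain f (repr y) in Vy *.
apply/cup_eq0 => /=.
have [eta heta] : exists eta : cochain R K p X, forall s : singular_simplex R p.+1 X,
    range s `<=` U -> pull_cochain f (repr x) s = coboundary eta s.
  apply: extend_cobounding; case: Ux => psi e; exists psi; rewrite -e.
  by apply/funext => s; congr (cocycle_val _ _); exact/continuousEP.
have [theta htheta] : exists theta : cochain R K q X, forall s : singular_simplex R q.+1 X,
    range s `<=` V -> pull_cochain f (repr y) s = coboundary theta s.
  apply: extend_cobounding; case: Vy => psi e; exists psi; rewrite -e.
  by apply/funext => s; congr (cocycle_val _ _); exact/continuousEP.
have zc := pull_is_cocycle f (cocycleP (repr x)).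
have wc := pull_is_cocycle f (cocycleP (repr y)).
pose z1 : cochain R K p.+1 X := z - coboundary eta.
pose w1 : cochain R K q.+1 X := w - coboundary theta.
have z1c : z1 \in @is_cocycle R K p.+1 X.
  by rewrite rpredB //; apply/asboolP; exact: coboundary_coboundary.
have w1c : w1 \in @is_cocycle R K q.+1 X.
  by rewrite rpredB //; apply/asboolP; exact: coboundary_coboundary.
apply: (@exactD _ _ _ _ (cup_cochain z1 w1) (fun s => cup_cochain (coboundary eta) w s +
   cup_cochain z1 (coboundary theta) s)).
- have e (a b c d : K) : a * b = (a - c) * (b - d) + (c * b + (a - c) * d) by ring.
  by move=> s; exact: e.
- have /asboolP zw := cup_is_cocycle z1c w1c.
  apply: (@small_cocycle R K X (fun A => A `<=` U \/ A `<=` V)) zw _.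
  + by move=> A B AB [BU|BV]; [left|right]; exact: subset_trans AB _.
  + move=> t; have : (U `|` V) t by rewrite UV.
    by case=> h; [exists U; [exact: open_nbhs_nbhs|left]|
                  exists V; [exact: open_nbhs_nbhs|right]].
  + move=> s sUV; rewrite /cup_cochain.
    have h A m n (g : 'I_m.+1 -> 'I_n.+1) (t : singular_simplex R n X) :
        range t `<=` A -> range (reindex t g) `<=` A.
      by move=> tA _ [u _ <-]; apply: tA; exact: imageT.
    case: sUV => sA.
      by rewrite -[z1 _]/(z _ - coboundary eta _) /z heta ?subrr ?mul0r //; exact: h.
    by rewrite -[w1 _]/(w _ - coboundary theta _) /w htheta ?subrr ?mulr0 //; exact: h.
apply: exactD => //.
- by apply: exact_cupl => //; exists eta.
- by apply: exact_cupr => //; exists theta.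
Qed.

End covers.

(** * Simplicial maps defined on a part of the vertices *)

Section simplicial_maps.
Context {R : realType} {V V' : choiceType}.
Context {L : simplicial_complex V} {L' : simplicial_complex V'}.
Context (A : pred V) (g : V -> V').
Implicit Types (p q : realization R L).

Definition mass p : R := lin (fun v => (A v)%:R) p.

Definition image_in (s : {fset V}) : {fset V'} := (g @` [fset v in s | A v])%fset.

Lemma image_inP s v' :
  reflect (exists v, [/\ v \in s, A v & v' = g v]) (v' \in image_in s).
Proof.
rewrite /image_in; apply: (iffP (imfsetP _ _ _ _)) => [[v /=]|[v [vs Av ->]]].
  by rewrite !inE => /andP[vs Av] ->; exists v.
by exists v => //=; rewrite !inE vs.
Qed.

Definition simplicial_on :=
  forall s, simplices L s -> image_in s != fset0 -> simplices L' (image_in s).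

Hypothesis gS : simplicial_on.

Lemma mass_gt0 p : 0 < mass p -> image_in (supp p) != fset0.
Proof.
apply: contraTneq => e; rewrite -leNgt /mass /lin big1_seq // => v /andP[_ vp].
case Av : (A v); rewrite ?mulr0 //.
have : g v \in image_in (supp p) by apply/image_inP; exists v.
by rewrite e inE.
Qed.

(** The weights on [A] are rescaled to total mass 1 before they are pushed along
    [g]; this is the radial projection away from the vertices outside of [A]. *)
Definition push_weight p v' : R := lin (fun u => (A u && (g u == v'))%:R) p / mass p.

Lemma push_weight_ge0 p v' : 0 <= push_weight p v'.
Proof. by rewrite divr_ge0 // lin_ge0 // => v; rewrite ler0n. Qed.

Lemma push_weight_sum p : 0 < mass p ->
  \sum_(v' <- image_in (supp p)) push_weight p v' = 1.
Proof.
move=> m0; rewrite -mulr_suml; apply: (canLR (mulfK _)); first by rewrite gt_eqF.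
rewrite mul1r exchange_big /= /mass /lin; apply: eq_big_seq => u up.
rewrite -mulr_sumr; congr (_ * _); case Au : (A u); last by rewrite big1.
have gu : g u \in image_in (supp p) by apply/image_inP; exists u.
rewrite (big_fsetD1 _ gu) /= eqxx big1_fset ?addr0 // => v'.
by rewrite !inE eq_sym => /andP[/negbTE ->].
Qed.

Definition push_point p (m0 : 0 < mass p) : realization R L' :=
  simplex_realization (push_weight_ge0 p) (push_weight_sum m0)
    (gS (supp_simplex p) (mass_gt0 m0)).

Lemma push_pointE p m0 v' : val (@push_point p m0) v' = push_weight p v'.
Proof.
rewrite simplex_realizationE; case: ifPn => // v'N.
rewrite /push_weight /lin big1_seq ?mul0r // => u /andP[_ up].
case: (boolP (A u && (g u == v'))) => [/andP[Au /eqP e]|_]; last by rewrite mulr0.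
by case/negP: v'N; apply/image_inP; exists u.
Qed.

Lemma supp_push_point p m0 : (supp (@push_point p m0) `<=` image_in (supp p))%fset.
Proof. exact: supp_simplex_realization. Qed.

Lemma image_in_sub s t : (s `<=` t)%fset -> (image_in s `<=` image_in t)%fset.
Proof.
move=> /fsubsetP st; apply/fsubsetP => v' /image_inP[v [vs Av ->]].
by apply/image_inP; exists v; split => //; exact: st.
Qed.

Section push_map.
Context {Z : topologicalType} (iota : continuousType Z (realization R L)).
Hypothesis mass0 : forall z, 0 < mass (iota z).

Definition push_fun z : realization R L' := push_point (mass0 z).

(** Source points near a given one may use any vertices, so continuity is checked on
    one closed simplex of [L] at a time; the vertices of the images are then
    confined to a finite set, where [open_realization] applies. *)
Lemma push_fun_cts : continuous push_fun.
Proof.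
apply/continuousP => B oB.
pose C : set (realization R L) := [set p | exists m0 : 0 < mass p, B (push_point m0)].
have -> : push_fun @^-1` B = iota @^-1` C.
  apply/seteqP; split=> z /= => [Bz|[m0]]; first by exists (mass0 z).
  by rewrite (bool_irrelevance m0 (mass0 z)).
apply: open_comp => [z _|]; first exact: cts_fun.
rewrite realization_openE => t p Lt pt [m0 Bp].
have [e e0 he] := open_realization (image_in t) oB Bp.
have : \forall q \near p, 0 < mass q /\
    forall v', v' \in (image_in t : seq V') -> `|push_weight p v' - push_weight q v'| < e.
  have mp : \forall q \near p, 0 < mass q.
    by have /cvgr_gt := @lin_cts R V L (fun v => (A v)%:R) p; exact.
  have wp : \forall q \near p, forall v', v' \in (image_in t : seq V') ->
      `|push_weight p v' - push_weight q v'| < e.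
    apply: (@near_seq V' _ p (fun v' => [set q | `|push_weight p v' - push_weight q v'| < e])).
    move=> v'; have /cvgr_dist_lt : push_weight q v' @[q --> p] --> push_weight p v'.
      by apply: continuous_at_div; [exact: lin_cts|exact: lin_cts|rewrite gt_eqF].
    exact.
  by apply: filterS2 mp wp.
move=> /nbhs_realization /(_ t Lt pt) [d d0 hd].
exists d => // q qt pq; have [mq hq] := hd q qt pq.
exists mq; apply: he => [|v'].
  by apply: fsubset_trans (supp_push_point _) (image_in_sub qt).
rewrite !push_pointE.
have [v't|v'N] := boolP (v' \in image_in t); first exact: hq.
have z0 r (mr : 0 < mass r) : (supp r `<=` t)%fset -> push_weight r v' = 0.
  move=> rt; rewrite -(push_pointE mr) weight0 //; apply: contra v'N.
  by apply: fsubsetP; exact: fsubset_trans (supp_push_point _) (image_in_sub rt).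
by rewrite !z0 // subrr normr0.
Qed.

HB.instance Definition _ := isContinuous.Build _ _ push_fun push_fun_cts.

Definition push_map : continuousType Z (realization R L') := push_fun.

Lemma supp_push_map z : (supp (push_map z) `<=` image_in (supp (iota z)))%fset.
Proof. exact: supp_push_point. Qed.

End push_map.

Lemma mass_open : open [set p | 0 < mass p].
Proof.
apply: (@open_comp _ _ mass [set x : R | 0 < x]); last exact: open_gt.
by move=> p _; exact: (@lin_cts R V L (fun v => (A v)%:R) p).
Qed.

End simplicial_maps.

Lemma mass_predT (R : realType) (V : choiceType) (L : simplicial_complex V)
  (p : realization R L) : 0 < mass predT p.
Proof. by rewrite /mass lin1. Qed.

Section simplicial_map.
Context {R : realType} {V V' : choiceType}.
Context {L : simplicial_complex V} {L' : simplicial_complex V'}.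
Context (g : V -> V') (gS : @simplicial_on V V' L L' predT g).

Definition simplicial_map : continuousType (realization R L) (realization R L') :=
  push_map gS (iota := idfun) (@mass_predT R V L).

Lemma supp_simplicial_map p v' : v' \in supp (simplicial_map p) ->
  exists2 v, v \in supp p & v' = g v.
Proof. by move=> /(fsubsetP (supp_push_map _ _ _))/image_inP[v [vp _ ->]]; exists v. Qed.

End simplicial_map.

Section null_maps.
Context {R : realType} {K : fieldType} {X : metricType R}.

Lemma vr_simplicial_on (Y : metricType R) (a b : R) (A : pred X) (g : X -> Y) :
  (forall x y, A x -> A y -> mdist x y <= a -> mdist (g x) (g y) <= b) ->
  simplicial_on (L := vr_complex X a) (L' := vr_complex Y b) A g.
Proof.
move=> h s [s0 sa] i0; split=> // u v /image_inP[x [xs Ax ->]] /image_inP[y [ys Ay ->]].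
by apply: h => //; exact: sa.
Qed.

(** A sequence of vertex maps from the identity to a map that is constant on every
    simplex, in which consecutive maps are contiguous, kills the cohomology of
    the part of the realization that has some weight on [A]: the weight outside
    of [A] is moved to [A] first, within each simplex. *)
Lemma inclusion_null (a b : R) (ab : vr_complex X a `<=` vr_complex X b)
    (A : pred X) (M : nat -> X -> X) (m : nat) (Z : topologicalType)
    (iota : continuousType Z (realization R (vr_complex X a))) n
    (x : cohomology R K n.+1 (realization R (vr_complex X b))) :
  (forall z, 0 < mass A (iota z)) ->
  M 0%N = id ->
  (forall k x y, (k <= m)%N -> A x -> A y -> mdist x y <= a ->
     mdist (M k x) (M k y) <= b) ->
  (forall k x y, (k < m)%N -> A x -> A y -> mdist x y <= a ->
     mdist (M k x) (M k.+1 y) <= b) ->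
  (forall x y, A x -> A y -> mdist x y <= a -> M m x = M m y) ->
  cohomology_map (inclusion ab \o iota) x = 0.
Proof.
move=> mA M0 Mk Mk1 Mm.
have MS k (km : (k <= m)%N) := vr_simplicial_on (fun x y => Mk k x y km).
pose h k (km : (k <= m)%N) := push_map (MS k km) mA.
have joint (f f' : continuousType Z (realization R (vr_complex X b))) :
    (forall z u v, u \in supp (f z) -> v \in supp (f' z) -> mdist u v <= b) ->
    contiguous f f'.
  move=> ff' z; have [fz0 fz] := supp_simplex (f z); have [_ f'z] := supp_simplex (f' z).
  split=> [|u v]; first by apply: contra fz0; rewrite fsetU_eq0 => /andP[].
  rewrite !inE => /orP[uf|uf'] /orP[vf|vf']; [exact: fz|exact: (ff' z)| |exact: f'z].
  by rewrite metric_structure.metric_sym; exact: (ff' z).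
have hsupp k km z u : u \in supp (h k km z) ->
    exists v, [/\ v \in supp (iota z), A v & u = M k v].
  by move=> /(fsubsetP (supp_push_map _ _ _)) /image_inP.
have close z u v : u \in supp (iota z) -> v \in supp (iota z) -> mdist u v <= a.
  by have [_] := supp_simplex (iota z); exact.
have -> : cohomology_map (inclusion ab \o iota) x = cohomology_map (h 0%N (leq0n m)) x.
  apply: contiguous_map_eq; apply: joint => z u v uz /hsupp[w [wz Aw ->]]; rewrite M0.
  by have [_ hb] := ab _ (supp_simplex (iota z)); exact: hb.
have step k km : cohomology_map (h k km) x = cohomology_map (h 0%N (leq0n m)) x.
  elim: k km => [|k IH] km; first by rewrite (bool_irrelevance km (leq0n m)).
  rewrite -(IH (ltnW km)); apply/esym/contiguous_map_eq; apply: joint => z u v.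
  move=> /hsupp[u' [u'z Au' ->]] /hsupp[v' [v'z Av' ->]].
  by apply: Mk1 => //; exact: (close z).
rewrite -(step m (leqnn m)); apply: vertex_valued_eq0 => z.
have [/fset0Pn[u uz] _] := supp_simplex (h m (leqnn m) z).
exists u; apply/eqP; rewrite eqEfsubset fsub1set uz andbT; apply/fsubsetP => v vz.
have [u' [u'z Au' ue]] := hsupp _ _ _ _ uz; have [v' [v'z Av' ve]] := hsupp _ _ _ _ vz.
by rewrite inE ue ve; apply/eqP/Mm => //; exact: (close z).
Qed.

End null_maps.

(** * Bounds on the length of an image, and coarse contractions *)

Section image_length_bounds.
Context {R : realType} {K : fieldType}.

Lemma image_length_ge0 (X Y : topologicalType) (f : continuousType X Y) :
  (0 <= image_length R K f)%E.
Proof. by apply: ereal_sup_ubound; exists 0%N => //; left. Qed.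

Lemma image_length_eq0 (X Y : topologicalType) (f : continuousType X Y) :
  (forall n (y : cohomology R K n.+1 Y), cohomology_map f y = 0) ->
  image_length R K f = 0%E.
Proof.
move=> f0; apply/eqP; rewrite eq_le image_length_ge0 andbT.
apply: ge_ereal_sup => _ [l [->|[s [sl sf sN]]] <-] //.
case: s sl sf sN => [<- //|x s] _ sf []; have [] := sf x (mem_head _ _).
move=> x0 /in_imageP[[[|n] y] xe]; first by rewrite xe in x0.
rewrite /= xe /homogeneous_map /= f0.
exact: cup0l.
Qed.

(** Products of elements of the first image are [u^*] of products of elements of the
    second. *)
Lemma image_length_le (X Y X' Y' : topologicalType) (f : continuousType X Y)
    (g : continuousType X' Y') (u : continuousType X X') (v : continuousType Y' Y) :
  (forall n (y : cohomology R K n.+1 Y),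
    cohomology_map f y = cohomology_map u (cohomology_map g (cohomology_map v y))) ->
  (image_length R K f <= image_length R K g)%E.
Proof.
move=> fE; apply: le_ereal_sup => _ [l [->|[s [sl sf sN]]] <-].
  by exists 0%N => //; left.
exists l => //; right.
have [s' [se s'P]] : exists s', s = map (homogeneous_map u) s' /\
    forall z, z \in s' -> (0 < projT1 z)%N /\ in_image g z.
  elim: s {sl sN} sf => [|x s IH] sf; first by exists [::].
  have [|s' [-> s'P]] := IH.
    by move=> z zs; apply: sf; rewrite inE zs orbT.
  have [x0 /in_imageP[[[|n] y] xe]] := sf x (mem_head _ _).
    by rewrite xe in x0.
  pose z := homogeneous_map g (homogeneous_map v (homogeneous_class y)).
  exists (z :: s'); split.
    by rewrite /= xe /homogeneous_map /= fE.
  move=> w; rewrite inE => /predU1P[->|]; last exact: s'P.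
  by split=> //; apply/in_imageP; eexists.
exists s'; split=> //; first by rewrite -sl se size_map.
move=> s'0; apply: sN; rewrite se map_cup_prod /homogeneous_map /= s'0.
exact: map0.
Qed.

(** A product of two or more factors is the product of the first one with an element
    of positive degree of the image, formed from all the others. *)
Lemma image_length_le1 (X Y : topologicalType) (f : continuousType X Y) :
  (forall p q (x : cohomology R K p.+1 Y) (y : cohomology R K q.+1 Y),
    cup_product (cohomology_map f x) (cohomology_map f y) = 0) ->
  (image_length R K f <= 1%:E)%E.
Proof.
move=> f0; apply: ge_ereal_sup => _ [l [->|[s [sl sf sN]]] <-]; first by rewrite lee_fin.
rewrite lee_fin -[1]/(1%:R) ler_nat -sl leqNgt; apply/negP.
case: s {sl} sf sN => [//|x [//|y s]] sf sN _; apply: sN.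
have [w [wn ew]] : exists w, (0 < projT1 w)%N /\ cup_prod (y :: s) = homogeneous_map f w.
  have {sf} : forall z, z \in y :: s -> (0 < projT1 z)%N /\ in_image f z.
    by move=> z zs; apply: sf; rewrite inE zs orbT.
  elim: s y => [|z s IH] y sf.
    have [y0 /in_imageP[y' ye]] := sf y (mem_head _ _).
    exists (cup_prod [:: y']); split; last by rewrite ye -map_cup_prod.
    by rewrite /= ltn_addr // -[projT1 y']/(projT1 (homogeneous_map f y')) -ye.
  have [|w [w0 we]] := IH z; first by move=> t ts; apply: sf; rewrite inE ts orbT.
  have [y0 /in_imageP[y' ye]] := sf y (mem_head _ _).
  exists (homogeneous_class (cup_product (projT2 y') (projT2 w))).
  split; first by rewrite /= addn_gt0 w0 orbT.
  rewrite -[LHS]/(homogeneous_class (cup_product (projT2 y) (projT2 (cup_prod (z :: s))))).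
  by rewrite we ye /homogeneous_map /= map_cup.
have [x0 /in_imageP[[[|p] x'] xe]] := sf x (mem_head _ _); first by rewrite xe in x0.
have -> : cup_prod [:: x, y & s] = homogeneous_class (cup_product
    (projT2 (homogeneous_map f (homogeneous_class x'))) (projT2 (homogeneous_map f w))).
  by rewrite -ew -[homogeneous_map f (homogeneous_class x')]xe.
by case: w wn {ew} => -[//|q] w _; exact: f0.
Qed.

End image_length_bounds.

Section contraction.
Context {R : realType} {K : fieldType}.
Import metric_structure.

(** A map [f] through which the space can be moved to the point [p], in the two
    steps from the identity to [f] and from [f] to [p], at the cost of raising
    the scale by [c]. The field [contraction_shrink] makes the notion pass to wedges
    at [p]. *)
Record coarse_contraction (c : R) (X : metricType R) (p : X) (f : X -> X) : Prop := {
  contraction_near : forall x, mdist x (f x) <= c;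
  contraction_center : forall x, mdist (f x) p <= c;
  contraction_shrink : forall x, mdist (f x) p <= mdist x p;
  contraction_lip : forall x y, mdist (f x) (f y) <= c + mdist x y
}.

(** The identity, [f] and the constant map [p] are consecutively contiguous at scale
    [a + c]. *)
Lemma contraction_null (X : metricType R) c p f (a b : R) n
    (ab : vr_complex X a `<=` vr_complex X b)
    (x : cohomology R K n.+1 (realization R (vr_complex X b))) :
  @coarse_contraction c X p f -> 0 <= a -> a + c <= b ->
  cohomology_map (inclusion ab) x = 0.
Proof.
move=> [near center _ lip] a0 acb.
have c0 : 0 <= c by exact: le_trans (mdist_ge0 _ _) (center p).
pose M k := if k is k'.+1 then (if k' is 0 then f else fun=> p) else id.
have -> : cohomology_map (inclusion ab) x = cohomology_map (inclusion ab \o idfun) x.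
  exact: eq_map.
apply: (@inclusion_null R K X a b ab predT M 2) => // [z|[|[|[|k]]] u v|[|[|k]] u v] //.
- exact: mass_predT.
- by move=> _ _ _ uv /=; lra.
- move=> _ _ _ uv /=; apply: (le_trans (lip u v)); apply: le_trans acb.
  by rewrite addrC lerD2r.
- by move=> _ _ _ uv /=; rewrite mdistxx; apply: le_trans acb; exact: addr_ge0.
- move=> _ _ _ uv /=; apply: (le_trans (metric_triangle _ v _)).
  by apply: le_trans acb; exact: lerD uv (near v).
- move=> _ _ _ uv /=; apply: (le_trans (center u)); apply: le_trans acb.
  by rewrite lerDr.
Qed.

End contraction.

(** * Stability under the Hausdorff distance *)

Section stability.
Context {R : realType} {K : fieldType}.
Import metric_structure.

(** At scale [a <= 0] distinct points are not joined, so the realization consists of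
    vertices only. *)
Lemma inclusion_discrete (X : metricType R) (a b : R) n
    (ab : vr_complex X a `<=` vr_complex X b)
    (x : cohomology R K n.+1 (realization R (vr_complex X b))) :
  a <= 0 -> cohomology_map (inclusion ab) x = 0.
Proof.
move=> a0; have -> : cohomology_map (inclusion ab) x = cohomology_map (inclusion ab \o idfun) x.
  exact: eq_map.
have uv0 (u v : X) : mdist u v <= a -> u = v.
  move=> uv; apply: mdist_positivity; apply/eqP.
  by rewrite eq_le mdist_ge0 andbT (le_trans uv).
have ab' (u v : X) : mdist u v <= a -> mdist u v <= b.
  move=> uv; have s : simplices (vr_complex X a) [fset u; v]%fset.
    split; first by apply/fset0Pn; exists u; rewrite !inE eqxx.
    by move=> y z; rewrite -(uv0 _ _ uv) !inE !orbb => /eqP-> /eqP->; rewrite {2}(uv0 _ _ uv).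
  by have [_ h] := ab _ s; apply: h; rewrite !inE eqxx ?orbT.
apply: (@inclusion_null R K X a b ab predT (fun=> id) 0) => // [z|k u v _ _ _|u v _ _].
- exact: mass_predT.
- exact: ab'.
- exact: uv0.
Qed.

(** On each simplex the composite [psi \o phi] and the identity have values at mutual
    distance at most [b], so the inclusion is contiguous to the composite of [phi],
    the other inclusion and [psi]. *)
Lemma inclusion_factor (X Y : metricType R) (a b a' b' : R)
    (ab : vr_complex X a `<=` vr_complex X b)
    (ab' : vr_complex Y a' `<=` vr_complex Y b') (phi : X -> Y) (psi : Y -> X) :
  (forall x x', mdist x x' <= a -> mdist (phi x) (phi x') <= a') ->
  (forall y y', mdist y y' <= b' -> mdist (psi y) (psi y') <= b) ->
  (forall x x', mdist x x' <= a -> mdist x (psi (phi x')) <= b) ->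
  (image_length R K (@inclusion R _ _ _ ab) <= image_length R K (@inclusion R _ _ _ ab'))%E.
Proof.
move=> hphi hpsi hx.
have phiS := vr_simplicial_on (A := predT) (fun x y _ _ => hphi x y).
have psiS := vr_simplicial_on (A := predT) (fun x y _ _ => hpsi x y).
apply: (@image_length_le _ _ _ _ _ _ _ _ (simplicial_map (R := R) phiS)
  (simplicial_map (R := R) psiS)) => n y.
pose h : continuousType (realization R (vr_complex X a)) (realization R (vr_complex X b)) :=
  simplicial_map (R := R) psiS \o (@inclusion R _ _ _ ab' \o simplicial_map (R := R) phiS).
transitivity (cohomology_map h y); last first.
  rewrite (@map_comp _ _ _ _ _ _ (simplicial_map (R := R) phiS) _
    (@inclusion R _ _ _ ab' \o simplicial_map (R := R) phiS)) //.
  by rewrite (@map_comp _ _ _ _ _ _ _ _ h).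
apply: contiguous_map_eq => p.
have hp v : v \in supp (h p) -> exists2 u, u \in supp p & v = psi (phi u).
  move=> /supp_simplicial_map[w wp ->].
  have /supp_simplicial_map[u up ->] : w \in supp (simplicial_map phiS p) := wp.
  by exists u.
have [pN pa] := supp_simplex p; have [hN hb] := supp_simplex (h p).
have [_ pb] := ab _ (supp_simplex p).
split=> [|u v]; first by apply: contra pN; rewrite fsetU_eq0 => /andP[].
rewrite !inE => /orP[up|uh] /orP[vp|vh]; [exact: pb| | |exact: hb].
  by have [w wp ->] := hp _ vh; apply: hx; exact: pa.
by have [w wp ->] := hp _ uh; rewrite metric_sym; apply: hx; exact: pa.
Qed.

(** When the left end of the thickened interval is not positive, the complex there is
    discrete and the left hand side vanishes; otherwise the cut-off at 0 has no
    effect and [inclusion_factor] applies. *)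
Lemma cup_length_le (X Y : metricType R) (e : {nonneg R}) (phi : X -> Y) (psi : Y -> X)
    (I : @closed_interval R) :
  (forall x x', mdist (phi x) (phi x') <= mdist x x' + e%:num) ->
  (forall y y', mdist (psi y) (psi y') <= mdist y y' + e%:num) ->
  (forall x, mdist x (psi (phi x)) <= e%:num) ->
  (cup_length K (VR X) (thicken I e) <= cup_length K (VR Y) I)%E.
Proof.
move=> hphi hpsi hx; case: I => a b ab; rewrite /cup_length /VR /=.
have e0 : 0 <= e%:num by [].
case: (boolP (a - e%:num <= 0)) => [ae|]; last rewrite -ltNge => ae.
  rewrite image_length_eq0 ?image_length_ge0 // => n y.
  by apply: inclusion_discrete; rewrite ge_max ae lexx.
have a0 : 0 < a by rewrite subr_gt0 in ae; exact: le_lt_trans ae.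
have b0 : 0 < b by exact: lt_le_trans ab.
have be0 : 0 < b + e%:num by rewrite ltr_wpDr.
have maxp (t : R) : 0 < t -> Num.max t 0 = t by move=> /ltW; exact: max_l.
apply: (@inclusion_factor X Y _ _ _ _ _ _ phi psi) => x x';
  rewrite ?(maxp _ ae) ?(maxp _ a0) ?(maxp _ b0) ?(maxp _ be0) => xx'.
- by apply: (le_trans (hphi _ _)); rewrite -lerBrDr.
- by apply: (le_trans (hpsi _ _)); rewrite lerD2r.
apply: (le_trans (metric_triangle _ x' _)); apply: lerD (hx x').
by apply: (le_trans xx'); rewrite lerBlDr (le_trans ab) // lerDl.
Qed.

Lemma hausdorff_maps (X Y Z : metricType R) (f : X -> Z) (g : Y -> Z) (r : R) :
  isometric_embedding f -> (hausdorff_dist (range f) (range g) < r%:E)%E ->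
  exists phi : X -> Y, forall x, mdist (f x) (g (phi x)) < r.
Proof.
move=> hf; rewrite /hausdorff_dist gt_max => /andP[hr _].
have h x : exists y, mdist (f x) (g y) < r.
  have : (ereal_inf [set (mdist (f x) b)%:E | b in range g] < r%:E)%E.
    apply: le_lt_trans hr; apply: ereal_sup_ubound.
    by exists (f x) => //; exists x.
  by move=> /ereal_inf_lt [_ [_ [y _ <-] <-]]; rewrite lte_fin; exists y.
by have [phi hphi] := choice h; exists phi.
Qed.

Lemma hausdorff_sym (Z : metricType R) (A B : set Z) :
  hausdorff_dist A B = hausdorff_dist B A.
Proof.
rewrite /hausdorff_dist maxC; congr maxe; congr ereal_sup;
by apply/seteqP; split=> _ [x hx <-]; exists x => //; congr ereal_inf;
   apply/seteqP; split=> _ [y hy <-]; exists y => //; rewrite metric_sym.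
Qed.

(** The maps that choose nearby points distort distances by less than [2 * r], and
    their composites displace points by less than [2 * r]. *)
Lemma hausdorff_eroded (X Y Z : metricType R) (f : X -> Z) (g : Y -> Z) (r : {nonneg R}) :
  isometric_embedding f -> isometric_embedding g ->
  (hausdorff_dist (range f) (range g) < (r%:num)%:E)%E ->
  eroded (cup_length K (VR X)) (cup_length K (VR Y)) (r%:num + r%:num)%:nng.
Proof.
move=> hf hg hr.
have [phi hphi] := hausdorff_maps hf hr.
rewrite hausdorff_sym in hr; have [psi hpsi] := hausdorff_maps hg hr.
have t1 x x' : mdist (phi x) (phi x') <= mdist x x' + (r%:num + r%:num).
  rewrite -hg -(hf x x'); apply: (le_trans (metric_triangle _ (f x) _)).
  rewrite (metric_sym (g (phi x))) addrCA; apply: lerD (ltW (hphi x)) _.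
  by apply: (le_trans (metric_triangle _ (f x') _)); apply: lerD (ltW (hphi x')).
have t2 y y' : mdist (psi y) (psi y') <= mdist y y' + (r%:num + r%:num).
  rewrite -hf -(hg y y'); apply: (le_trans (metric_triangle _ (g y) _)).
  rewrite (metric_sym (f (psi y))) addrCA; apply: lerD (ltW (hpsi y)) _.
  by apply: (le_trans (metric_triangle _ (g y') _)); apply: lerD (ltW (hpsi y')).
move=> I; split.
  apply: (@cup_length_le Y X (r%:num + r%:num)%:nng psi phi I t2 t1) => y; rewrite -hg.
  apply: (le_trans (metric_triangle _ (f (psi y)) _)).
  exact: lerD (ltW (hpsi y)) (ltW (hphi _)).
apply: (@cup_length_le X Y (r%:num + r%:num)%:nng phi psi I t1 t2) => x; rewrite -hf.
apply: (le_trans (metric_triangle _ (g (phi x)) _)).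
exact: lerD (ltW (hphi x)) (ltW (hpsi _)).
Qed.

End stability.

(** * Contracting spheres, products and wedges *)

Section spheres.
Context {R : realType}.
Import metric_structure.

Lemma sphere_le n (x y : sphere R n) (t : R) : 0 <= t <= pi ->
  (mdist x y <= t) = (cos t <= dot (val x) (val y)).
Proof.
move=> t0pi; have d1 := sphere_dot_itv x y.
rewrite -[mdist x y]/(acos (dot (val x) (val y))).
rewrite leNgt -[in RHS](acosK (x := dot _ _)) ?in_itv //= leNgt ltr_cos //.
by rewrite in_itv /= acos_ge0 ?acos_lepi.
Qed.

Lemma cos_pi3 : cos (pi / 3) = 2^-1 :> R.
Proof.
have p0 := @pi_gt0 R; set c := cos _.
have c0 : 0 < c by apply: cos_gt0_pihalf; apply/andP; split; lra.
have : cos (pi / 3 *+ 2 + pi / 3) = -1 :> R.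
  by rewrite (_ : _ + _ = pi) ?cospi // mulr2n; lra.
rewrite cosD cos_mulr2n sin_mulr2n -/c.
have s2 : sin (pi / 3) ^+ 2 = 1 - c ^+ 2 :> R by rewrite sin2cos2.
set s := sin _ in s2 * => h.
(* The triple angle formula at [pi], as an equation for [c]. *)
have : (c + 1) * (2 * c - 1) ^+ 2 = 0.
  have : (c ^+ 2 *+ 2 - 1) * c - c * s *+ 2 * s + 1 = 0 by rewrite h addNr.
  have -> : (c ^+ 2 *+ 2 - 1) * c - c * s *+ 2 * s + 1 =
    (c ^+ 2 *+ 2 - 1) * c - c * s ^+ 2 *+ 2 + 1 by ring.
  by rewrite s2 => <-; ring.
move/eqP; rewrite mulf_eq0 gt_eqF ?addr_gt0 //= sqrf_eq0 subr_eq0 => /eqP e.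
by apply: (@mulfI _ 2) => //; rewrite e mulfV.
Qed.

Lemma cos_2pi3 : cos (2 * (pi / 3)) = - 2^-1 :> R.
Proof. by rewrite mulr_natl cos_mulr2n cos_pi3; lra. Qed.

(** Rotate the first two coordinates of [p] by a right angle, and normalize. *)
Lemma exists_orthogonal n (p : 'rV[R]_n.+2) :
  exists u : 'rV[R]_n.+2, dot u u = 1 /\ dot p u = 0.
Proof.
pose i0 : 'I_n.+2 := ord0; pose i1 : 'I_n.+2 := lift ord0 ord0.
pose w (a b : R) : 'rV[R]_n.+2 := \row_i (if i == i0 then a else if i == i1 then b else 0).
have dw v a b : dot v (w a b) = v 0 i0 * a + v 0 i1 * b.
  rewrite /dot !big_ord_recl !mxE /= addrA big1 ?addr0 // => i _.
  by rewrite mxE /= mulr0.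
have w0 a b : w a b 0 i0 = a by rewrite mxE.
have w1 a b : w a b 0 i1 = b by rewrite mxE.
set a := p 0 i0; set b := p 0 i1.
have [ab|ab] := eqVneq (a ^+ 2 + b ^+ 2) 0.
  have a0 : a = 0 by apply/eqP; rewrite -sqrf_eq0; nra.
  by exists (w 1 0); rewrite !dw w0 w1 -/a a0; split; ring.
have ab0 : 0 < a ^+ 2 + b ^+ 2 by rewrite lt0r ab addr_ge0 ?sqr_ge0.
set r := Num.sqrt (a ^+ 2 + b ^+ 2).
have r2 : r ^+ 2 = a ^+ 2 + b ^+ 2 by rewrite sqr_sqrtr // ltW.
have r0 : r != 0 by rewrite gt_eqF // sqrtr_gt0.
exists (w (- b / r) (a / r)); rewrite !dw w0 w1 -/a -/b; split; last by ring.
transitivity ((a ^+ 2 + b ^+ 2) / r ^+ 2); first by field.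
by rewrite r2 divff // gt_eqF.
Qed.

Lemma dot_linr n (a b : R) (u v w : 'rV[R]_n) :
  dot w (a *: u + b *: v) = a * dot w u + b * dot w v.
Proof. by rewrite dotC dot_lin (dotC u) (dotC v). Qed.

(** A point [q] at distance 2 pi / 3 from [p]: then every point of the sphere is
    within 2 pi / 3 of [p] or of [q], since the points far from [p] lie within
    pi / 3 of the antipode of [p], and so does [q]. *)
Lemma sphere_two_centers n (p : sphere R n.+1) : exists q : sphere R n.+1,
  mdist q p <= 2 * (pi / 3) /\
  forall x, 2 * (pi / 3) < mdist x p -> mdist x q <= 2 * (pi / 3).
Proof.
have p0 := @pi_gt0 R.
have t0 : 0 <= 2 * (pi / 3 : R) <= pi by apply/andP; split; lra.
have [u [uu pu]] := exists_orthogonal (val p); have pp := sphere_dot p.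
(* The sine of [2 * (pi / 3)]. *)
set s3 := Num.sqrt (3 / 4) : R.
have s32 : s3 ^+ 2 = 3 / 4 by rewrite sqr_sqrtr //; lra.
have s30 : 0 <= s3 by exact: sqrtr_ge0.
have qq : dot (- 2^-1 *: val p + s3 *: u) (- 2^-1 *: val p + s3 *: u) == 1.
  rewrite dot_lin !dot_linr pp uu (dotC u) pu; apply/eqP.
  transitivity (4^-1 + s3 ^+ 2); first by field.
  by rewrite s32; field.
pose q : sphere R n.+1 := exist _ (- 2^-1 *: val p + s3 *: u) qq.
exists q; split.
  by rewrite sphere_le // cos_2pi3 /= dot_lin pp (dotC u) pu; lra.
move=> x; rewrite ltNge !sphere_le // cos_2pi3 -ltNge /= dot_linr => h.
set a := dot (val x) (val p) in h *; set b := dot (val x) u.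
have ab : a ^+ 2 + b ^+ 2 <= 1.
  have := dot_ge0 (1 *: (1 *: val x + (- a) *: val p) + (- b) *: u).
  rewrite !(dot_lin, dot_linr) sphere_dot pp uu pu !(dotC u) pu.
  by rewrite (dotC (val p) (val x)) -/a -/b; nra.
have b2 : b ^+ 2 <= 3 / 4 by nra.
have sb : (s3 * b) ^+ 2 <= (3 / 4) ^+ 2.
  by rewrite exprMn s32 [(3 / 4) ^+ 2]expr2 ler_wpM2l //; lra.
have : `|s3 * b| <= 3 / 4.
  by rewrite -(ler_pXn2r (n:=2)) ?nnegrE ?normr_ge0 // ?real_normK ?num_real //; lra.
by rewrite ler_norml => /andP[sb1 _]; lra.
Qed.

(** The map takes the two values [p] and [q] of [sphere_two_centers], which are at
    distance at most [2 * (pi / 3)] themselves. *)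
Lemma sphere_contraction n (p : sphere R n.+1) :
  exists f, coarse_contraction (2 * (pi / 3)) p f.
Proof.
have p0 := @pi_gt0 R.
have [q [qp xq]] := sphere_two_centers p.
exists (fun x => if mdist x p <= 2 * (pi / 3) then p else q); split=> [x|x|x|x y].
- by case: ifPn => //; rewrite -ltNge => /xq.
- by case: ifP => // _; rewrite mdistxx; lra.
- case: ifPn => [_|]; first by rewrite mdistxx mdist_ge0.
  by rewrite -ltNge => /ltW; exact: le_trans.
rewrite ler_wpDr ?mdist_ge0 //; do 2 case: ifP => _; rewrite ?mdistxx //; try by lra.
by rewrite metric_sym.
Qed.

Lemma prod_contraction (c : R) (X Y : metricType R) (p : X) (q : Y) f g :
  coarse_contraction c p f -> coarse_contraction c q g ->
  exists h, @coarse_contraction R c (X * Y)%type (p, q) h.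
Proof.
move=> [n1 c1 s1 l1] [n2 c2 s2 l2].
have mE (x y : X * Y) : mdist x y = Num.max (mdist x.1 y.1) (mdist x.2 y.2) by [].
exists (fun x => (f x.1, g x.2)); split=> [x|x|x|x y]; rewrite !mE /=.
- by rewrite ge_max n1 n2.
- by rewrite ge_max c1 c2.
- by rewrite ge_max !le_max s1 s2 orbT.
rewrite ge_max; apply/andP; split.
  by apply: (le_trans (l1 _ _)); rewrite lerD2l le_max lexx.
by apply: (le_trans (l2 _ _)); rewrite lerD2l le_max lexx orbT.
Qed.

Section wedge_maps.
Context {X Y : metricType R} (x0 : X) (y0 : Y).

Lemma wedge_dist0 (v : metric_wedge x0 y0) :
  mdist v (wedge_point x0 y0) = mdist (val v).1 x0 + mdist (val v).2 y0.
Proof. by []. Qed.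

Lemma wedge_distE (v w : metric_wedge x0 y0) :
  mdist v w = mdist (val v).1 (val w).1 + mdist (val v).2 (val w).2.
Proof. by []. Qed.

Lemma wedge_caseP (v : metric_wedge x0 y0) : (val v).1 = x0 \/ (val v).2 = y0.
Proof. by case: v => v /= /orP[]/eqP; [left|right]. Qed.

Context (f : X -> X) (g : Y -> Y) (fx0 : f x0 = x0) (gy0 : g y0 = y0).

Lemma wedge_map_subproof (v : metric_wedge x0 y0) :
  (f (val v).1 == x0) || (g (val v).2 == y0).
Proof. by case: (wedge_caseP v) => ->; rewrite ?fx0 ?gy0 eqxx ?orbT. Qed.

Definition wedge_map (v : metric_wedge x0 y0) : metric_wedge x0 y0 :=
  exist _ (f (val v).1, g (val v).2) (wedge_map_subproof v).

End wedge_maps.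

Lemma contraction_fix (c : R) (X : metricType R) (p : X) f :
  coarse_contraction c p f -> f p = p.
Proof.
move=> [_ _ s _]; apply: mdist_positivity; apply/eqP.
by rewrite eq_le mdist_ge0 andbT (le_trans (s p)) // mdistxx.
Qed.

(** Points in different summands are compared through the base point, from which
    [f] and [g] do not move them away. *)
Lemma wedge_contraction (c : R) (X Y : metricType R) (x0 : X) (y0 : Y) f g :
  coarse_contraction c x0 f -> coarse_contraction c y0 g ->
  exists h, coarse_contraction c (wedge_point x0 y0) h.
Proof.
move=> hf hg; have fx := contraction_fix hf; have gy := contraction_fix hg.
move: hf hg => [n1 c1 s1 l1] [n2 c2 s2 l2].
have c0 : 0 <= c by exact: le_trans (mdist_ge0 _ _) (c1 x0).
exists (wedge_map fx gy); split=> [v|v|v|v w]; rewrite ?wedge_dist0 ?wedge_distE /=.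
- by case: (wedge_caseP v) => ->; rewrite ?fx ?gy mdistxx ?add0r ?addr0.
- by case: (wedge_caseP v) => ->; rewrite ?fx ?gy mdistxx ?add0r ?addr0.
- by rewrite lerD.
case: (wedge_caseP v) => ->; case: (wedge_caseP w) => ->;
  rewrite ?fx ?gy ?mdistxx ?add0r ?addr0 //; apply: ler_wpDl => //.
  by rewrite (metric_sym x0) (metric_sym x0); exact: lerD.
by rewrite (metric_sym y0) (metric_sym y0); exact: lerD.
Qed.

End spheres.

(** * Cutting spheres and wedges along hemispheres *)

Section hemispheres.
Context {R : realType}.
Import metric_structure.

Definition adjacent (m k k' : nat) := [&& k <= k', k' <= k.+1 & k' <= m]%N.

(** A partition of [X] into [A] and its complement, and a discrete motion [M] that
    contracts every [a]-connected part of either to a point, all within scale [b].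
    In a wedge the sets [A] merge at the base point, while [hemi_far] keeps the
    complements of different summands apart. *)
Record hemi_contraction (a b : R) (m : nat) (X : metricType R) (p : X) (A : pred X)
    (M : nat -> X -> X) : Prop := {
  hemi_base : A p;
  hemi_start : M 0%N = id;
  hemi_shrink : forall k x, A x -> mdist (M k x) p <= mdist x p;
  hemi_far : forall x, ~~ A x -> a < mdist x p;
  hemi_step : forall k k' x y, adjacent m k k' -> A x = A y -> mdist x y <= a ->
    mdist (M k x) (M k' y) <= b;
  hemi_end : forall x y, A x = A y -> mdist x y <= a -> M m x = M m y
}.

(** The open sets where the weight on [A], respectively on its complement, is positive
    cover the realization, and the inclusion is null on each of them. *)
Lemma hemi_cup (K : fieldType) (a b : R) m (X : metricType R) p A M
    (ab : vr_complex X a `<=` vr_complex X b) i j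
    (x : cohomology R K i.+1 (realization R (vr_complex X b)))
    (y : cohomology R K j.+1 (realization R (vr_complex X b))) :
  @hemi_contraction a b m X p A M ->
  cup_product (cohomology_map (inclusion ab) x) (cohomology_map (inclusion ab) y) = 0.
Proof.
move=> [_ M0 _ _ Mstep Mend].
pose U (B : pred X) : set (realization R (vr_complex X a)) := [set q | 0 < mass B q].
have null (B : pred X) n (z : cohomology R K n.+1 (realization R (vr_complex X b))) :
    (forall u v, B u -> B v -> A u = A v) ->
    cohomology_map (inclusion ab \o @include _ (U B)) z = 0.
  move=> BA; apply: (@inclusion_null R K X a b ab B M m) => //.
  - by move=> q; exact: set_valP q.
  - by move=> k u v km Bu Bv; apply: Mstep; [rewrite /adjacent leqnn leqnSn|exact: BA].
  - by move=> k u v km Bu Bv; apply: Mstep; [rewrite /adjacent leqnn leqnSn|exact: BA].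
  - by move=> u v Bu Bv; apply: Mend; exact: BA.
apply: (@cup_eq0_cover R K _ _ (inclusion ab) (U A) (U (predC A))).
- exact: mass_open.
- exact: mass_open.
- apply/seteqP; split=> // q _; rewrite /U /=.
  have [q0|q0] := ltP 0 (mass A q); [by left|right].
  have : mass A q + mass (predC A) q = 1.
    rewrite -(lin1 q) /mass /lin -big_split; apply: eq_bigr => v _ /=.
    by rewrite -mulrDr; congr (_ * _); case: (A v); rewrite ?addr0 ?add0r.
  by move=> h; lra.
- by apply: null => u v -> ->.
- by apply: null => u v /negbTE -> /negbTE ->.
Qed.

(** Take the union of the sets [A] and [B]. If two points in different summands are
    on the same side and within [a], the base point is between them, so that both
    are within [a] of it and hence in [A] and [B]; then the motions do not take them
    further apart. *)
Lemma wedge_hemi (a b : R) m (X Y : metricType R) (x0 : X) (y0 : Y) A B M N :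
  a <= b -> hemi_contraction a b m x0 A M -> hemi_contraction a b m y0 B N ->
  exists C S, hemi_contraction a b m (wedge_point x0 y0) C S.
Proof.
move=> ab [A0 M0 Ms Mf Mst Me] [B0 N0 Ns Nf Nst Ne].
have Mx k : M k x0 = x0.
  apply: mdist_positivity; apply/eqP; rewrite eq_le mdist_ge0 andbT.
  by rewrite (le_trans (Ms k _ A0)) // mdistxx.
have Ny k : N k y0 = y0.
  apply: mdist_positivity; apply/eqP; rewrite eq_le mdist_ge0 andbT.
  by rewrite (le_trans (Ns k _ B0)) // mdistxx.
exists (fun v => A (val v).1 && B (val v).2), (fun k => wedge_map (Mx k) (Ny k)).
have cross x y : A x = B y -> mdist x x0 + mdist y y0 <= a -> A x /\ B y.
  move=> e; have d1 := mdist_ge0 x x0; have d2 := mdist_ge0 y y0.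
  case Ax : (A x) => h; first by rewrite -e Ax.
  by have h' := Mf x (negbT Ax); exfalso; lra.
split=> [||k v|v|k k' v w kk'|v w].
- by rewrite /= A0 B0.
- by apply/funext => v; apply: val_inj; rewrite /= M0 N0; case: (val v).
- by move=> /andP[Av Bv]; rewrite !wedge_dist0 /=; exact: lerD (Ms _ _ Av) (Ns _ _ Bv).
- rewrite wedge_dist0 negb_and => /orP[/Mf|/Nf] h.
    by rewrite ltr_wpDr ?mdist_ge0.
  by rewrite ltr_wpDl ?mdist_ge0.
- rewrite !wedge_distE /=.
  case: (wedge_caseP v) => ->; case: (wedge_caseP w) => ->;
    rewrite ?Mx ?Ny ?mdistxx ?add0r ?addr0 ?A0 ?B0 ?andbT /=.
  + exact: Nst.
  + move=> e vw; rewrite (metric_sym x0) in vw; have [Aw Bv] := cross _ _ (esym e) vw.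
    rewrite (metric_sym x0); apply: le_trans (le_trans vw ab).
    exact: lerD (Ms _ _ Aw) (Ns _ _ Bv).
  + move=> e vw; rewrite (metric_sym y0) in vw; have [Av Bw] := cross _ _ e vw.
    rewrite (metric_sym y0); apply: le_trans (le_trans vw ab).
    exact: lerD (Ms _ _ Av) (Ns _ _ Bw).
  + exact: Mst.
move=> e; rewrite wedge_distE => vw; apply: val_inj => /=; move: e vw.
case: (wedge_caseP v) => ->; case: (wedge_caseP w) => ->;
  rewrite ?Mx ?Ny ?mdistxx ?add0r ?addr0 ?A0 ?B0 ?andbT /=.
- by move=> e vw; rewrite (Ne _ _ e vw).
- move=> e vw; rewrite (metric_sym x0) in vw; have [Aw Bv] := cross _ _ (esym e) vw.
  have d1 := mdist_ge0 (val w).1 x0; have d2 := mdist_ge0 (val v).2 y0.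
  rewrite (Me (val w).1 x0) ?Aw ?A0 ?Mx //; last by lra.
  by rewrite (Ne (val v).2 y0) ?Bv ?B0 ?Ny //; lra.
- move=> e vw; rewrite (metric_sym y0) in vw; have [Av Bw] := cross _ _ e vw.
  have d1 := mdist_ge0 (val v).1 x0; have d2 := mdist_ge0 (val w).2 y0.
  rewrite (Me (val v).1 x0) ?Av ?A0 ?Mx //; last by lra.
  by rewrite (Ne (val w).2 y0) ?Bw ?B0 ?Ny //; lra.
- by move=> e vw; rewrite (Me _ _ e vw).
Qed.

Lemma sphere_mono n (x y z w : sphere R n) :
  dot (val z) (val w) <= dot (val x) (val y) -> mdist x y <= mdist z w.
Proof.
have zw := sphere_dot_itv z w.
rewrite sphere_le; last by rewrite mdist_ge0; exact: acos_lepi.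
by rewrite -[mdist z w]/(acos (dot (val z) (val w))) acosK // in_itv.
Qed.

Lemma dotZl n (a : R) (u v : 'rV[R]_n) : dot (a *: u) v = a * dot u v.
Proof. by rewrite /dot mulr_sumr; apply: eq_bigr => i _; rewrite mxE mulrA. Qed.

Section tilt.
Context {n : nat} (p : sphere R n).

Definition side (x : sphere R n) : R := if 0 <= dot (val x) (val p) then 1 else -1.

Definition height x := side x * dot (val x) (val p).

Lemma side_sqr x : side x * side x = 1.
Proof. by rewrite /side; case: ifP => _; ring. Qed.

Lemma height_ge0 x : 0 <= height x.
Proof.
by rewrite /height /side; case: ifPn; rewrite ?mul1r // -ltNge => /ltW; rewrite mulN1r oppr_ge0.
Qed.

Lemma height_le1 x : height x <= 1.
Proof.
have /andP[h1 h2] := sphere_dot_itv x p.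
by rewrite /height /side; case: ifP => _; lra.
Qed.

Definition tilt_vec t (x : sphere R n) : 'rV[R]_n.+1 := 1 *: val x + (t * side x) *: val p.

Definition tilt_norm t x : R := Num.sqrt (dot (tilt_vec t x) (tilt_vec t x)).

Lemma tilt_dot t t' x y : side x = side y ->
  dot (tilt_vec t x) (tilt_vec t' y) =
  dot (val x) (val y) + t' * height x + t * height y + t * t'.
Proof.
move=> xy; rewrite /tilt_vec dot_lin !dot_linr sphere_dot (dotC (val p) (val y)).
rewrite /height xy; have := side_sqr y; set s := side y => ss.
have -> : t * t' = t * t' * (s * s) by rewrite ss mulr1.
ring.
Qed.

Lemma tilt_norm_sqr t x : 0 <= t -> tilt_norm t x ^+ 2 = 1 + 2 * t * height x + t ^+ 2.
Proof.
move=> t0; rewrite sqr_sqrtr ?dot_ge0 // tilt_dot // sphere_dot; ring.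
Qed.

Lemma tilt_norm_ge1 t x : 0 <= t -> 1 <= tilt_norm t x.
Proof.
move=> t0; rewrite -(ler_pXn2r (n:=2)) ?nnegrE ?sqrtr_ge0 // tilt_norm_sqr //.
by rewrite expr1n; have := height_ge0 x; nra.
Qed.

Lemma tilt_subproof t x : 0 <= t ->
  dot ((tilt_norm t x)^-1 *: tilt_vec t x) ((tilt_norm t x)^-1 *: tilt_vec t x) == 1.
Proof.
move=> t0; have r1 := tilt_norm_ge1 x t0; set r := tilt_norm t x in r1 *.
rewrite dotZl dotC dotZl.
have -> : dot (tilt_vec t x) (tilt_vec t x) = r ^+ 2 by rewrite sqr_sqrtr ?dot_ge0.
by apply/eqP; field; lra.
Qed.

(** The point [x] is moved along a great circle towards the nearer pole, reached in the
    limit of large [t]. *)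
Definition tilt t (t0 : 0 <= t) x : sphere R n :=
  exist _ ((tilt_norm t x)^-1 *: tilt_vec t x) (tilt_subproof x t0).

Lemma dot_tiltl t t0 x (w : 'rV[R]_n.+1) :
  dot (val (@tilt t t0 x)) w = dot (tilt_vec t x) w / tilt_norm t x.
Proof. by rewrite /= dotZl mulrC. Qed.

(** Adding the same vector to [x] and [y], at a non-negative inner product with both,
    raises the inner product after normalization, as long as the points are at
    most a right angle apart. *)
Lemma tilt_lip t t0 x y : side x = side y -> 0 <= dot (val x) (val y) ->
  mdist (@tilt t t0 x) (@tilt t t0 y) <= mdist x y.
Proof.
move=> xy d0; apply: sphere_mono.
rewrite dot_tiltl [dot (tilt_vec _ _) _]dotC dot_tiltl [dot (tilt_vec _ _) _]dotC.
have /andP[_ d1] := sphere_dot_itv x y.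
have rx := tilt_norm_ge1 x t0; have ry := tilt_norm_ge1 y t0.
have rx2 := tilt_norm_sqr x t0; have ry2 := tilt_norm_sqr y t0.
rewrite tilt_dot //.
set d := dot _ _ in d0 d1 *; set r := tilt_norm t x in rx rx2 *.
set r' := tilt_norm t y in ry ry2 *.
have hx := height_ge0 x; have hy := height_ge0 y.
rewrite ler_pdivlMr; last by lra.
rewrite ler_pdivlMr; last by lra.
have rr : r' * r <= (r ^+ 2 + r' ^+ 2) / 2 by have := sqr_ge0 (r - r'); nra.
have e : (r ^+ 2 + r' ^+ 2) / 2 = 1 + t * (height x + height y) + t ^+ 2.
  by rewrite rx2 ry2; field.
rewrite e in rr; set w := t * (height x + height y) + t ^+ 2.
have w0 : 0 <= w by rewrite addr_ge0 ?sqr_ge0 // mulr_ge0 // addr_ge0.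
rewrite -mulrA; apply: (@le_trans _ _ (d * (1 + w))).
  by apply: ler_wpM2l => //; rewrite /w; lra.
rewrite mulrDr mulr1; have : d * w <= 1 * w by rewrite ler_wpM2r.
by rewrite /w expr2; lra.
Qed.

(** The sine of the angle between the two tilted vectors is the area that they span
    divided by the product of their lengths. The area is at most the difference
    of [t] and [t'], and the lengths are at least 1. *)
Lemma tilt_step t t0 t' t0' x (e : R) : 0 <= e <= pi / 2 -> (t - t') ^+ 2 <= sin e ^+ 2 ->
  mdist (@tilt t t0 x) (@tilt t' t0' x) <= e.
Proof.
move=> /andP[e0 e1] te; have pi0 := @pi_gt0 R.
rewrite sphere_le; last by apply/andP; split; lra.
rewrite dot_tiltl [dot (tilt_vec _ _) _]dotC dot_tiltl [dot (tilt_vec _ _) _]dotC.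
rewrite tilt_dot // sphere_dot.
have rx := tilt_norm_ge1 x t0; have ry := tilt_norm_ge1 x t0'.
have rx2 := tilt_norm_sqr x t0; have ry2 := tilt_norm_sqr x t0'.
set r := tilt_norm t x in rx rx2 *; set r' := tilt_norm t' x in ry ry2 *.
have h0 := height_ge0 x; have h1 := height_le1 x; set h := height x in h0 h1 rx2 ry2 *.
have c0 : 0 <= cos e by apply: cos_ge0_pihalf; apply/andP; split; lra.
rewrite ler_pdivlMr; last by lra.
rewrite ler_pdivlMr; last by lra.
have m1 := mulr_ge0 t0' h0; have m2 := mulr_ge0 t0 h0; have m3 := mulr_ge0 t0 t0'.
have N0 : 0 <= 1 + t' * h + t * h + t * t' by lra.
rewrite -(ler_pXn2r (n:=2)) ?nnegrE ?mulr_ge0 //; try by lra.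
rewrite !exprMn rx2 ry2.
have c2 : cos e ^+ 2 <= 1 - (t - t') ^+ 2 by rewrite cos2sin2; lra.
set P := 1 + 2 * t * h + t ^+ 2; set Q := 1 + 2 * t' * h + t' ^+ 2.
have P1 : 1 <= P by rewrite /P; have s2 := sqr_ge0 t; lra.
have Q1 : 1 <= Q by rewrite /Q; have s2 := sqr_ge0 t'; lra.
have PQ : 1 <= Q * P by rewrite -[1]mulr1 ler_pM.
rewrite -mulrA; apply: (@le_trans _ _ ((1 - (t - t') ^+ 2) * (Q * P))).
  by rewrite [P * Q]mulrC; apply: ler_wpM2r => //; lra.
have -> : (1 + t' * h + t * h + t * t') ^+ 2 = Q * P - (t - t') ^+ 2 * (1 - h ^+ 2).
  by rewrite /P /Q; ring.
rewrite mulrBl mul1r lerD2l lerN2 ler_wpM2l ?sqr_ge0 //.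
by have := sqr_ge0 h; lra.
Qed.

Lemma pole_subproof (x : sphere R n) :
  dot (side x *: val p) (side x *: val p) == 1.
Proof. by rewrite dotZl dotC dotZl sphere_dot mulr1 side_sqr. Qed.

Definition pole x : sphere R n := exist _ (side x *: val p) (pole_subproof x).

(** At [t = 1] the vector bisects the angle from [x] to its pole, which is at most
    [pi / 2]. *)
Lemma tilt_pole (t0 : 0 <= 1 :> R) x y : side x = side y ->
  mdist (tilt t0 x) (pole y) <= pi / 3.
Proof.
move=> xy; have pi0 := @pi_gt0 R.
rewrite sphere_le; last by apply/andP; split; lra.
rewrite cos_pi3 dot_tiltl.
have -> : dot (tilt_vec 1 x) (val (pole y)) = height x + 1.
  rewrite /= dotC dotZl dotC /tilt_vec dot_lin sphere_dot /height -xy.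
  by rewrite mulrDr !mul1r mulr1 side_sqr.
have r1 := tilt_norm_ge1 x t0; have r2 := tilt_norm_sqr x t0; have h0 := height_ge0 x.
set r := tilt_norm 1 x in r1 r2 *; set h := height x in r2 h0 *.
rewrite ler_pdivlMr; last by lra.
rewrite -(ler_pXn2r (n:=2)) ?nnegrE ?mulr_ge0 ?invr_ge0 //; try by lra.
by rewrite exprMn r2; nra.
Qed.

Lemma tilt0 t (t0 : 0 <= t) x : t = 0 -> tilt t0 x = x.
Proof.
move=> e; move: t0; rewrite e => t0.
apply: mdist_positivity; apply/eqP; rewrite eq_le mdist_ge0 andbT.
rewrite -[leRHS](mdistxx x); apply: sphere_mono; rewrite dot_tiltl /tilt_norm /tilt_vec.
by rewrite mul0r scale0r addr0 scale1r sphere_dot sqrtr1 divr1.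
Qed.

Lemma tilt_shrink t t0 (x : sphere R n) : 0 <= dot (val x) (val p) ->
  mdist (@tilt t t0 x) p <= mdist x p.
Proof.
move=> h0; apply: sphere_mono; rewrite dot_tiltl.
have sx : side x = 1 by rewrite /side h0.
have -> : dot (tilt_vec t x) (val p) = height x + t.
  by rewrite /tilt_vec dot_lin sphere_dot /height sx !mul1r !mulr1.
have r1 := tilt_norm_ge1 x t0; have r2 := tilt_norm_sqr x t0.
have h1 := height_le1 x.
have -> : dot (val x) (val p) = height x by rewrite /height sx mul1r.
have {}h0 := height_ge0 x; set r := tilt_norm t x in r1 r2 *; set h := height x in h0 h1 r2 *.
rewrite ler_pdivlMr; last by lra.
have rt : r <= 1 + t.
  rewrite -(ler_pXn2r (n:=2)) // ?nnegrE; try by lra.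
  by rewrite r2; nra.
by apply: (le_trans (ler_wpM2l h0 rt)); nra.
Qed.

End tilt.

(** Tilt towards the poles in [m] small steps until [t = 1], and then jump to the
    poles. Points on the same side within [a < pi / 2] are not driven apart by a
    common tilt, a single step costs at most [b - a] more, and the final jump at
    most [pi / 3 <= b]. *)
Lemma sphere_hemi (a b : R) : a < pi / 2 -> 0 < b - a <= pi / 2 -> pi / 3 <= b ->
  exists m, forall n (p : sphere R n), exists A M, hemi_contraction a b m p A M.
Proof.
move=> a2 /andP[ba0 ba1] b3; have pi0 := @pi_gt0 R.
have s0 : 0 < sin (b - a) by apply: sin_gt0_pi; apply/andP; split; lra.
(* Steps of length [1 / m] in [t] have to be shorter than [sin (b - a)]. *)
have [k /andP[_ hk]] : exists k : nat, k%:R <= (sin (b - a))^-1 < k.+1%:R.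
  exists (Num.truncn (sin (b - a))^-1); apply: Num.Theory.truncn_itv.
  by rewrite invr_ge0 ltW.
set m := k.+1 in hk *.
have m0 : 0 < m%:R :> R by rewrite ltr0n.
have hm : (m%:R^-1) ^+ 2 <= sin (b - a) ^+ 2.
  rewrite ler_pXn2r // ?nnegrE ?invr_ge0 ?ler0n //; last exact: ltW.
  by rewrite -[leRHS]invrK lef_pV2 ?posrE ?invr_gt0 // ltW.
have t0 j : 0 <= j%:R / m%:R :> R by rewrite divr_ge0.
exists m.+1 => n p; exists (fun x => 0 <= dot (val x) (val p)).
exists (fun j x => if (j <= m)%N then tilt p (t0 j) x else pole p x).
have sideE x y : (0 <= dot (val x) (val p)) = (0 <= dot (val y) (val p)) ->
    side p x = side p y by rewrite /side => ->.
have poleE x y : side p x = side p y -> pole p x = pole p y.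
  by move=> e; apply: val_inj; rewrite /= e.
split=> [||j x h|x|i j x y ij|x y].
- by rewrite sphere_dot.
- by apply/funext => x /=; apply: tilt0; rewrite mul0r.
- case: ifP => _; first exact: tilt_shrink.
  rewrite (_ : pole p x = p) ?mdistxx ?mdist_ge0 //.
  by apply: val_inj; rewrite /= /side h scale1r.
- rewrite -ltNge => h; rewrite ltNge; apply/negP.
  have [a0|a0] := ltP a 0; first by move=> /(le_trans (mdist_ge0 _ _)); lra.
  rewrite sphere_le; last by apply/andP; split; lra.
  by apply/negP; rewrite -ltNge (lt_trans h) //; apply: cos_gt0_pihalf; apply/andP; split; lra.
- move=> /sideE xy xya.
  have a0 : 0 <= a by exact: le_trans (mdist_ge0 _ _) xya.
  have d0 : 0 <= dot (val x) (val y).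
    move: xya; rewrite sphere_le; last by apply/andP; split; lra.
    by apply: le_trans; apply: cos_ge0_pihalf; apply/andP; split; lra.
  have lip l := le_trans (tilt_lip (t0 l) xy d0) xya.
  case/and3P: ij => ij ji jm.
  have [im|mi] := leqP i m; last first.
    have -> : (j <= m)%N = false by rewrite leqNgt (leq_trans mi ij).
    by rewrite (poleE x y) // mdistxx; lra.
  have [jm'|mj] := leqP j m; last first.
    have im' : i = m by apply/eqP; rewrite eqn_leq im -ltnS (leq_trans mj ji).
    have e1 : i%:R / m%:R = 1 :> R by rewrite im' divff // gt_eqF.
    apply: le_trans b3; move: (t0 i); rewrite e1 => t01; exact: tilt_pole.
  have [eij|ltij] := eqVneq i j.
    by rewrite -eij; apply: (le_trans (lip i)); lra.
  apply: (le_trans (metric_triangle _ (tilt p (t0 i) y) _)).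
  have : mdist (tilt p (t0 i) y) (tilt p (t0 j) y) <= b - a.
    apply: tilt_step; first by apply/andP; split; lra.
    have -> : j = i.+1 by apply/eqP; rewrite eqn_leq ji ltn_neqAle ltij ij.
    rewrite -mulrBl -natr1 opprD addNKr mulN1r sqrrN. exact: hm.
  by have := lip i => h1 h2; apply: (le_trans (lerD h1 h2)); lra.
by move=> /sideE /poleE e _; rewrite ltnn.
Qed.

End hemispheres.

(** * The winding cocycle *)

Section lifts.
Context {R : realType}.

Lemma cosD2piz (x : R) (k : int) : cos (x + 2 * pi * k%:~R) = cos x.
Proof.
have pos (n : nat) y : cos (y + 2 * pi * n%:R) = cos y :> R.
  elim: n => [|n IH]; first by rewrite mulr0 addr0.
  rewrite -[RHS]IH -[RHS]cosD2pi; congr cos.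
  by rewrite -natr1 mulr2n; ring.
case: k => n; first exact: pos.
rewrite NegzE mulrNz mulrN.
by have := pos n.+1 (x - 2 * pi * n.+1%:R); rewrite subrK => <-.
Qed.

Lemma cos_lt1 (d : R) : 0 < d < 2 * pi -> cos d < 1.
Proof.
move=> /andP[d0 d2]; have e : d = d / 2 *+ 2 by rewrite mulr2n; lra.
rewrite e cos_mulr2n cos2sin2 mulr2n.
have s0 : 0 < sin (d / 2) by apply: sin_gt0_pi; apply/andP; split; lra.
have : 0 < sin (d / 2) ^+ 2 by rewrite exprn_gt0.
by set s := sin _ ^+ 2; lra.
Qed.

Lemma cos_eq1_int (d : R) : cos d = 1 -> exists k : int, d = 2 * pi * k%:~R.
Proof.
move=> d1; have p0 := @pi_gt0 R.
have /andP[f1 f2] := floor_itv (d / (2 * pi)).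
exists (Num.floor (d / (2 * pi))); set k := Num.floor _ in f1 f2 *.
rewrite ler_pdivlMr ?mulr_gt0 // in f1; rewrite ltr_pdivrMr ?mulr_gt0 // in f2.
rewrite intrD mulrDl mul1r in f2.
have c1 : cos (d - 2 * pi * k%:~R) = 1.
  by rewrite -[LHS](cosD2piz _ k) subrK.
apply/eqP; rewrite -subr_eq0; apply/negPn/negP => dk.
have /cos_lt1 : 0 < d - 2 * pi * k%:~R < 2 * pi.
  by rewrite lt0r dk /=; apply/andP; split; lra.
by rewrite c1 ltxx.
Qed.

(** Between two values of [g] that differ by a non-zero multiple of [2 * pi] there is
    one that differs from the first by [pi], where the cosine has the other sign. *)
Lemma cos_band n (g : stdsimplex R n -> R) x y : continuous g ->
  (forall z, 0 < cos (g z)) -> cos (g y - g x) = 1 -> g x = g y.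
Proof.
move=> cg gpos; have p0 := @pi_gt0 R.
wlog : x y / g x < g y.
  move=> h e; case: (ltgtP (g x) (g y)) => // xy; first exact: h.
  by apply/esym/h => //; rewrite -cosN opprB.
move=> xy e; have d2 : 2 * pi <= g y - g x.
  rewrite leNgt; apply/negP => d2; have /cos_lt1 : 0 < g y - g x < 2 * pi by lra.
  by rewrite e ltxx.
have [|z gz] := @simplex_ivt R n g x y (g x + pi) cg.
  by apply/andP; split; lra.
by have := gpos z; rewrite gz cosDpi oppr_gt0 => h; have := gpos x; lra.
Qed.

Lemma polar (a b : R) : 0 < a ^+ 2 + b ^+ 2 ->
  exists r t, [/\ 0 < r, a = r * cos t & b = r * sin t].
Proof.
move=> ab; set r := Num.sqrt (a ^+ 2 + b ^+ 2).
have r0 : 0 < r by rewrite sqrtr_gt0.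
have r2 : r ^+ 2 = a ^+ 2 + b ^+ 2 by rewrite sqr_sqrtr // ltW.
have ar : -1 <= a / r <= 1.
  by rewrite ler_pdivlMr // ler_pdivrMr //; apply/andP; split; nra.
have s2 : (r * sin (acos (a / r))) ^+ 2 = b ^+ 2.
  rewrite exprMn sin2cos2 acosK ?in_itv // mulrBr mulr1 -exprMn mulrC divfK ?gt_eqF //.
  by rewrite r2; ring.
have a1 : a = r * cos (acos (a / r)) by rewrite acosK ?in_itv // mulrC divfK ?gt_eqF.
have s0 : 0 <= r * sin (acos (a / r)).
  by rewrite mulr_ge0 ?(ltW r0) // sin_acos // sqrtr_ge0.
have [b0|b0] := leP 0 b.
  by exists r, (acos (a / r)); split=> //; nra.
by exists r, (- acos (a / r)); rewrite cosN sinN mulrN; split=> //; nra.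
Qed.

Lemma rotate (u0 u1 v0 v1 r l : R) : 0 < r -> u0 = r * cos l -> u1 = r * sin l ->
  0 < u0 * v0 + u1 * v1 ->
  let t := atan ((u0 * v1 - u1 * v0) / (u0 * v0 + u1 * v1)) in
  exists r', [/\ 0 < r', v0 = r' * cos (l + t) & v1 = r' * sin (l + t)].
Proof.
move=> r0 e0 e1; set D := u0 * v0 + u1 * v1; set C := u0 * v1 - u1 * v0 => D0 t.
have c0 : 0 < cos t.
  by apply: cos_gt0_pihalf; rewrite atan_gtNpi2 atan_ltpi2.
have st : sin t = C / D * cos t.
  by have := atanK (C / D); rewrite /tan -/t => <-; rewrite divfK // gt_eqF.
have cs := cos2Dsin2 l.
exists (D / (r * cos t)); split; first by rewrite divr_gt0 // mulr_gt0.
- rewrite cosD st.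
  transitivity (D / r * (cos l - sin l * (C / D))); last by field; lra.
  transitivity ((D * cos l - C * sin l) / r); last by field; lra.
  rewrite /D /C e0 e1; transitivity (v0 * (cos l ^+ 2 + sin l ^+ 2)); last by field; lra.
  by rewrite cs mulr1.
rewrite sinD st.
transitivity ((D * sin l + C * cos l) / r); last by field; lra.
rewrite /D /C e0 e1; transitivity (v1 * (cos l ^+ 2 + sin l ^+ 2)); last by field; lra.
by rewrite cs mulr1.
Qed.

Lemma near_acute (T : topologicalType) (f0 f1 : T -> R) (x : T) :
  continuous f0 -> continuous f1 -> 0 < f0 x ^+ 2 + f1 x ^+ 2 ->
  exists2 V, nbhs x V & forall y z, V y -> V z -> 0 < f0 y * f0 z + f1 y * f1 z.
Proof.
move=> c0 c1 fx.
pose h (p : T * T) := f0 p.1 * f0 p.2 + f1 p.1 * f1 p.2.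
have cfst (f : T -> R) : continuous f -> continuous (fun p : T * T => f p.1).
  by move=> cf p; apply: (@continuous_comp _ _ _ fst f); [exact: cvg_fst|exact: cf].
have csnd (f : T -> R) : continuous f -> continuous (fun p : T * T => f p.2).
  by move=> cf p; apply: (@continuous_comp _ _ _ snd f); [exact: cvg_snd|exact: cf].
have ch : continuous h.
  by apply: continuous_add; apply: continuous_mul; auto.
have : \forall p \near (x, x), 0 < h p.
  by have /cvgr_gt := ch (x, x); apply; rewrite /h /= -!expr2.
move=> [[V W] [/= xV xW] VW]; exists (V `&` W); first exact: filterI.
by move=> y z [Vy _] [_ Wz]; exact: (VW (y, z)).
Qed.

Section slide.
Context {n : nat} (c : stdsimplex R n) (t : R).
Hypothesis t01 : 0 <= t <= 1.

Lemma slide_subproof (x : stdsimplex R n) :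
  let v : 'rV[R]_n.+1 := \row_i ((1 - t) * val c 0 i + t * val x 0 i) in
  (forall i, 0 <= v 0 i) /\ \sum_i v 0 i = 1.
Proof.
move: t01 => /andP[t0 t1] v; split=> [i|].
  by rewrite mxE addr_ge0 // mulr_ge0 ?subr_ge0 ?coord_ge0.
under eq_bigr do rewrite mxE.
by rewrite big_split -!mulr_sumr /= !coord_sum !mulr1 subrK.
Qed.

(** The contraction of the simplex to the point [c], as [t] runs from 1 down to 0. *)
Definition slide (x : stdsimplex R n) : stdsimplex R n :=
  simplex_point (slide_subproof x).1 (slide_subproof x).2.

Lemma slideE x i : val (slide x) 0 i = (1 - t) * val c 0 i + t * val x 0 i.
Proof. by rewrite mxE. Qed.

Lemma slide_cts : continuous slide.
Proof.
apply: simplex_cts => i; rewrite (_ : (fun x => _) =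
  fun x : stdsimplex R n => (1 - t) * val c 0 i + t * val x 0 i); last first.
  by apply/funext => x; rewrite slideE.
apply: continuous_add; first exact: cst_continuous.
by apply: continuous_mul; [exact: cst_continuous|exact: coord_cts].
Qed.

End slide.

Definition is_lift (T : topologicalType) (f0 f1 l : T -> R) :=
  continuous l /\ forall x, exists r, [/\ 0 < r, f0 x = r * cos (l x) & f1 x = r * sin (l x)].

(** The simplex is contracted to a vertex in small steps; the angle between two
    consecutive steps is less than [pi / 2], hence given by an arc tangent. *)
Lemma exists_lift n (f0 f1 : stdsimplex R n -> R) :
  continuous f0 -> continuous f1 -> (forall x, 0 < f0 x ^+ 2 + f1 x ^+ 2) ->
  exists l, is_lift f0 f1 l.
Proof.
move=> c0 c1 f2.
have [||d d0 hd] := @lebesgue_number R n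
  (fun A => forall y z, A y -> A z -> 0 < f0 y * f0 z + f1 y * f1 z).
- by move=> A B AB h y z /AB By /AB Bz; exact: h.
- by move=> x; exact: near_acute.
pose c : stdsimplex R n := vertex ord0.
(* [N] steps, each shorter than the Lebesgue number [d] in every coordinate. *)
pose N := (Num.truncn d^-1).+1.
have N0 : 0 < N%:R :> R by rewrite ltr0n.
have Nd : N%:R^-1 < d.
  rewrite -[d]invrK ltf_pV2 ?posrE ?invr_gt0 //.
  by have /andP[] := Num.Theory.truncn_itv (ltW (eq_ind_r _ d0 (invr_gt0 d))).
have k01 k : 0 <= Num.min 1 (k%:R / N%:R : R) <= 1.
  by rewrite le_min ler01 divr_ge0 //= ge_min lexx.
pose h k := slide c (k01 k).
have ch k (f : stdsimplex R n -> R) : continuous f -> continuous (f \o h k).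
  by move=> cf x; apply: continuous_comp; [exact: slide_cts|exact: cf].
suff [l [cl hl]] : exists l, is_lift (f0 \o h N) (f1 \o h N) l.
  exists l; split=> // x; have := hl x; rewrite /= (_ : h N x = x) //.
  by apply: coord_inj => i; rewrite slideE divff ?gt_eqF // minxx; ring.
elim: {1 2}N => [|k [l [cl hl]]].
  have [r [t [r0 e0 e1]]] := polar (f2 c).
  exists (fun=> t); split=> [|x]; first exact: cst_continuous.
  exists r; rewrite /= (_ : h 0%N x = c) //.
  by apply: coord_inj => i; rewrite slideE mul0r min_r ?ler01 //; ring.
pose D x := f0 (h k x) * f0 (h k.+1 x) + f1 (h k x) * f1 (h k.+1 x).
pose C x := f0 (h k x) * f1 (h k.+1 x) - f1 (h k x) * f0 (h k.+1 x).
have D0 x : 0 < D x.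
  apply: (hd (h k x)) => i; first by rewrite subrr normr0.
  rewrite !slideE; apply: le_lt_trans Nd.
  set a := Num.min _ _; set a' := Num.min _ _; set u := fun_of_matrix _ _ _.
  set v := fun_of_matrix _ _ _.
  have aa : `|a - a'| <= N%:R^-1.
    have e0 : 0 < N%:R^-1 :> R by rewrite invr_gt0.
    rewrite /a /a' -natr1 mulrDl mul1r; set q := k%:R / N%:R; set e := N%:R^-1 in e0 *.
    by rewrite ler_norml !minEle; case: (leP 1 q) => h1; case: (leP 1 (q + e)) => h2;
      apply/andP; split; lra.
  have -> : (1 - a) * u + a * v - ((1 - a') * u + a' * v) = (a - a') * (v - u) by ring.
  rewrite normrM -[leRHS]mulr1; apply: ler_pM => //.
  have u0 : 0 <= u by exact: coord_ge0.
  have u1 : u <= 1 by exact: coord_le1.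
  have v0 : 0 <= v by exact: coord_ge0.
  have v1 : v <= 1 by exact: coord_le1.
  by rewrite ler_norml; apply/andP; split; lra.
exists (fun x => l x + atan (C x / D x)); split.
  apply: continuous_add => // x.
  apply: (@continuous_comp _ _ _ (fun x => C x / D x) atan); last exact: continuous_atan.
  apply: continuous_at_div; last by rewrite gt_eqF.
    apply: continuous_add; last apply: continuous_opp; apply: continuous_mul; exact: ch.
  by apply: continuous_add; apply: continuous_mul; exact: ch.
move=> x; have [r [r0 e0 e1]] := hl x.
exact: rotate r0 e0 e1 (D0 x).
Qed.

Lemma same_angle (r r' t t' : R) : 0 < r -> 0 < r' ->
  r * cos t = r' * cos t' -> r * sin t = r' * sin t' -> cos (t - t') = 1.
Proof.
move=> r0 r'0; have cs := cos2Dsin2 t; have cs' := cos2Dsin2 t'.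
rewrite cosB; set c := cos t in cs *; set s := sin t in cs *.
set c' := cos t' in cs' *; set s' := sin t' in cs' * => rc rs.
have rr : r = r'.
  apply/eqP; rewrite -(eqrXn2 (n := 2)) ?(ltW r0) ?(ltW r'0) //; apply/eqP.
  transitivity ((r * c) ^+ 2 + (r * s) ^+ 2).
    by rewrite !exprMn -mulrDr cs mulr1.
  by rewrite rc rs !exprMn -mulrDr cs' mulr1.
rewrite -rr in rc rs.
have ec : c = c' by apply: (mulfI _ rc); rewrite gt_eqF.
have es : s = s' by apply: (mulfI _ rs); rewrite gt_eqF.
by rewrite -ec -es -!expr2.
Qed.

Lemma lift_unique (T : topologicalType) (f0 f1 l l' : T -> R) x :
  is_lift f0 f1 l -> is_lift f0 f1 l' -> exists k : int, l x = l' x + 2 * pi * k%:~R.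
Proof.
move=> [_ /(_ x)[r [r0 e0 e1]]] [_ /(_ x)[r' [r'0 e0' e1']]].
have [|k kE] := @cos_eq1_int (l x - l' x).
  by apply: same_angle r0 r'0 _ _; rewrite -?e0 -?e1.
by exists k; rewrite -kE addrC subrK.
Qed.

(** The difference of two lifts is a continuous function with values in the multiples
    of [2 * pi]. *)
Lemma lift_diff n (f0 f1 l l' : stdsimplex R n -> R) x y :
  is_lift f0 f1 l -> is_lift f0 f1 l' -> l x - l' x = l y - l' y.
Proof.
move=> hl hl'; have same z : cos (l z - l' z) = 1.
  have [k ->] := lift_unique z hl hl'.
  by rewrite addrAC subrr add0r -[2 * pi * _]add0r cosD2piz cos0.
have cg : continuous (fun z => l z - l' z).
  by apply: continuous_add; [exact: hl.1|apply: continuous_opp; exact: hl'.1].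
apply: (cos_band cg) => [z|]; first by rewrite same.
have s0 z : sin (l z - l' z) = 0.
  by apply/eqP; rewrite -sqrf_eq0 sin2cos2 same expr1n subrr.
by rewrite cosB !same !s0 mulr1 mulr0 addr0.
Qed.

End lifts.

Section winding.
Context {R : realType} {K : fieldType} {Z : topologicalType} (F0 F1 : Z -> R).
Hypothesis cF0 : continuous F0.
Hypothesis cF1 : continuous F1.
Hypothesis F_gt0 : forall z, 0 < F0 z ^+ 2 + F1 z ^+ 2.

Lemma singular_lift n (s : singular_simplex R n Z) : exists l, is_lift (F0 \o s) (F1 \o s) l.
Proof.
apply: exists_lift => [x|x|x]; last exact: F_gt0.
  by apply: continuous_comp; [exact: cts_fun|exact: cF0].
by apply: continuous_comp; [exact: cts_fun|exact: cF1].
Qed.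

Definition turns (t : R) : K := (Num.floor (t / (2 * pi)))%:~R.

Lemma turnsD t (k : int) : turns (t + 2 * pi * k%:~R) = turns t + k%:~R.
Proof.
have p0 := @pi_gt0 R; rewrite /turns -intrD; congr (_%:~R).
have -> : (t + 2 * pi * k%:~R) / (2 * pi) = t / (2 * pi) + k%:~R by field; lra.
by rewrite floorDrz ?intr_int // intrKfloor.
Qed.

(** The winding cocycle of the map [(F0, F1)] to the punctured plane: the number of
    full turns that the angle makes along a path. Rounding down to full turns makes
    it integral, while it does not depend on the choice of the angle. *)
Definition winding : cochain R K 1 Z := fun s =>
  let l := sval (cid (singular_lift s)) in
  turns (l (vertex ord_max)) - turns (l (vertex ord0)).

Lemma lift_turns n (s : singular_simplex R n Z) l l' x y :
  is_lift (F0 \o s) (F1 \o s) l -> is_lift (F0 \o s) (F1 \o s) l' ->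
  turns (l y) - turns (l x) = turns (l' y) - turns (l' x).
Proof.
move=> hl hl'; have e := lift_diff x y hl hl'.
have [k kE] := lift_unique x hl hl'.
have -> : l y = l' y + 2 * pi * k%:~R by move: e; rewrite kE; lra.
by rewrite kE !turnsD opprD addrACA subrr addr0.
Qed.

Lemma windingE (s : singular_simplex R 1 Z) l : is_lift (F0 \o s) (F1 \o s) l ->
  winding s = turns (l (vertex ord_max)) - turns (l (vertex ord0)).
Proof. by move=> hl; rewrite /winding; case: cid => l' hl' /=; exact: lift_turns hl' hl. Qed.

Lemma vertex_map_vertex m n (g : 'I_m.+1 -> 'I_n.+1) i :
  vertex_map R g (vertex i) = vertex (g i).
Proof.
apply: coord_inj => j; rewrite vertex_mapE vertexE.
have [->|jg] := eqVneq j (g i).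
  rewrite (bigD1 i) //= vertexE eqxx big1 ?addr0 // => k /andP[_ ki].
  by rewrite vertexE (negbTE ki).
rewrite big1 // => k /eqP gk; rewrite vertexE; case: eqP => // ki.
by case/eqP: jg; rewrite -gk ki.
Qed.

Lemma winding_cocycle : winding \in @is_cocycle R K 1 Z.
Proof.
apply/asboolP/funext => s; have [l hl] := singular_lift s.
have face (i : 'I_3) : is_lift (F0 \o reindex s (lift i)) (F1 \o reindex s (lift i))
    (fun x => l (vertex_map R (lift i) x)).
  move: hl => [cl hl]; split=> [x|x]; last exact: hl.
  by apply: continuous_comp; [exact: vertex_map_continuous|exact: cl].
rewrite /coboundary !big_ord_recl big_ord0 !(windingE (face _)) !vertex_map_vertex.
pose t (k : nat) := turns (l (vertex (inord k))).
have tE (i : 'I_3) : turns (l (vertex i)) = t i by rewrite /t inord_val.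
rewrite !tE /= /bump /= expr0 expr1 expr2.
rewrite -[RHS]/(0 : K); ring.
Qed.

(** The angle between the loop and the path stays below [pi / 2], so that the
    difference of their angular coordinates cannot change by a full turn. *)
Lemma winding_loop (s : singular_simplex R 1 Z) (w : stdsimplex R 1 -> R) (k : int) :
  continuous w ->
  (forall x, 0 < F0 (s x) * cos (w x) + F1 (s x) * sin (w x)) ->
  s (vertex ord0) = s (vertex ord_max) ->
  w (vertex ord_max) = w (vertex ord0) + 2 * pi * k%:~R ->
  winding s = k%:~R.
Proof.
move=> cw sw loop wk; have [l hl] := singular_lift s.
rewrite (windingE hl); set v0 := vertex ord0 in loop wk *; set v1 := vertex _ in loop wk *.
move: hl => [cl hl].
have e : l v0 - w v0 = l v1 - w v1.
  apply: (@cos_band R 1 (fun z => l z - w z)) => [|z|].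
  - by apply: continuous_add => //; exact: continuous_opp.
  - have [r [r0 e0 e1]] := hl z; have := sw z; rewrite cosB.
    rewrite -[F0 _]/((F0 \o s) z) -[F1 _]/((F1 \o s) z) e0 e1 -!mulrA -mulrDr.
    by rewrite pmulr_rgt0.
  have -> : l v1 - w v1 - (l v0 - w v0) = (l v1 - l v0) + 2 * pi * (- k)%:~R.
    by rewrite wk mulrNz; ring.
  rewrite cosD2piz.
  have [r [r0 e0 e1]] := hl v0; have [r' [r'0 e0' e1']] := hl v1.
  apply: same_angle r'0 r0 _ _; rewrite -?e0 -?e1 -?e0' -?e1' /=.
    by congr F0.
  by congr F1.
have -> : l v1 = l v0 + 2 * pi * k%:~R by move: e; rewrite wk; lra.
by rewrite turnsD addrAC subrr add0r.
Qed.

End winding.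

(** * Winding around the circle of directions *)

Section planar.
Context {R : realType}.
Import metric_structure.

Lemma dot2E (u v : 'rV[R]_2) : dot u v = u 0 ord0 * v 0 ord0 + u 0 ord_max * v 0 ord_max.
Proof.
rewrite /dot !big_ord_recl big_ord0 addr0; congr (_ + u 0 _ * v 0 _); exact: val_inj.
Qed.

(** Three directions in the plane are dependent, so that their Gram determinant
    vanishes; it would be positive if all three inner products were in the interval
    from -1/2 to 1/2. *)
Lemma no_three_directions (u v w : sphere R 1) :
  - 2^-1 < dot (val u) (val v) < 0 -> - 2^-1 < dot (val w) (val u) ->
  - 2^-1 < dot (val w) (val v) -> 0 <= dot (val w) (val u) + dot (val w) (val v).
Proof.
move=> /andP[a1 a0] b1 c1; rewrite leNgt; apply/negP => bc.
have := sphere_dot u; have := sphere_dot v; have := sphere_dot w.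
move: a1 a0 b1 c1 bc; rewrite !dot2E.
set u0 := fun_of_matrix (val u) 0 ord0; set u1 := fun_of_matrix (val u) 0 ord_max.
set v0 := fun_of_matrix (val v) 0 ord0; set v1 := fun_of_matrix (val v) 0 ord_max.
set w0 := fun_of_matrix (val w) 0 ord0; set w1 := fun_of_matrix (val w) 0 ord_max.
set a := u0 * v0 + u1 * v1; set b := w0 * u0 + w1 * u1; set c := w0 * v0 + w1 * v1.
move=> a1 a0 b1 c1 bc ww vv uu.
have gram : (u0 * u0 + u1 * u1) * (v0 * v0 + v1 * v1) * (w0 * w0 + w1 * w1) +
   2 * a * b * c - (u0 * u0 + u1 * u1) * c ^+ 2 - (v0 * v0 + v1 * v1) * b ^+ 2 -
   (w0 * w0 + w1 * w1) * a ^+ 2 = 0 by rewrite /a /b /c; ring.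
rewrite uu vv ww !mul1r in gram.
have sq x : - 2^-1 < x -> x < 2^-1 -> x ^+ 2 < 4^-1 :> R by move=> ? ?; nra.
have a2 := sq a a1 (lt_trans a0 _); have b2 := sq b b1; have c2 := sq c c1.
have {}b2 : b ^+ 2 < 4^-1 by apply: b2; lra.
have {}c2 : c ^+ 2 < 4^-1 by apply: c2; lra.
have {}a2 : a ^+ 2 < 4^-1 by apply: a2; lra.
have bc2 : `|b * c| <= 4^-1.
  by rewrite ler_norml; apply/andP; split; have := sqr_ge0 (b - c); have := sqr_ge0 (b + c); nra.
have : - 4^-1 <= 2 * a * b * c.
  move: bc2; rewrite ler_norml => /andP[bc3 bc4]; rewrite -!mulrA [_ * (b * c)]mulrC.
  by set z := b * c in bc3 bc4 *; nra.
by lra.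
Qed.

Lemma lin_neg (V : choiceType) (L : simplicial_complex V) (g : V -> R)
    (p : realization R L) u :
  lin g p = 0 -> u \in supp p -> 0 < g u -> exists2 v, v \in supp p & g v < 0.
Proof.
move=> g0 up gu; apply: contrapT => h.
have gge v : v \in supp p -> 0 <= g v.
  by move=> vp; rewrite leNgt; apply/negP => gv; apply: h; exists v.
have : 0 < lin g p; last by rewrite g0 ltxx.
rewrite /lin (big_fsetD1 u) //= ltr_pwDl //.
  by rewrite mulr_gt0 // -in_supp.
rewrite big_seq; apply: sumr_ge0 => v; rewrite !inE => /andP[_ vp].
by rewrite mulr_ge0 ?weight_ge0 ?gge.
Qed.

Lemma lin_gt0 (V : choiceType) (L : simplicial_complex V) (g : V -> R)
    (p : realization R L) :
  (forall v, v \in supp p -> 0 < g v) -> 0 < lin g p.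
Proof.
move=> g0; have /fset0Pn[u up] := simplices_nonempty (supp_simplex p).
rewrite /lin (big_fsetD1 u) //= ltr_pwDl //.
  by rewrite mulr_gt0 ?g0 // -in_supp.
rewrite big_seq; apply: sumr_ge0 => v; rewrite !inE => /andP[_ vp].
by rewrite mulr_ge0 ?weight_ge0 // ltW ?g0.
Qed.

Lemma lin_comb (V : choiceType) (L : simplicial_complex V) (g h : V -> R) (a b : R)
    (p : realization R L) :
  lin (fun v => g v * a + h v * b) p = lin g p * a + lin h p * b.
Proof.
rewrite /lin !mulr_suml -big_split; apply: eq_bigr => v _ /=; ring.
Qed.

Section vector_sum.
Context {X : metricType R} (b : R) (f : X -> sphere R 1).
Hypothesis f_lip : forall x y, mdist (f x) (f y) <= mdist x y.
Hypothesis b_lt : b < 2 * (pi / 3).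

Definition vector_sum i (p : realization R (vr_complex X b)) : R :=
  lin (fun v => val (f v) 0 i) p.

Lemma vector_sum_dot (p : realization R (vr_complex X b)) (u : 'rV[R]_2) :
  lin (fun v => dot (val (f v)) u) p =
  vector_sum ord0 p * u 0 ord0 + vector_sum ord_max p * u 0 ord_max.
Proof. by rewrite -lin_comb; congr lin; apply/funext => v; rewrite dot2E. Qed.

(** Below scale [2 * (pi / 3)] the directions [f v] of the vertices of a simplex have
    inner products greater than [- 2^-1]. If a positive combination of them were 0,
    there would be [v] with [f v] at an obtuse angle to a given [f u], and then [w]
    with a negative inner product with [f u + f v], against
    [no_three_directions]. *)
Lemma vector_sum_gt0 p : 0 < vector_sum ord0 p ^+ 2 + vector_sum ord_max p ^+ 2.
Proof.
rewrite lt0r addr_ge0 ?sqr_ge0 // andbT; apply/eqP => e.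
have e0 : vector_sum ord0 p = 0 by apply/eqP; rewrite -sqrf_eq0; nra.
have e1 : vector_sum ord_max p = 0 by apply/eqP; rewrite -sqrf_eq0; nra.
have lin0 u : lin (fun v => dot (val (f v)) u) p = 0.
  by rewrite vector_sum_dot e0 e1 !mul0r addr0.
have p0 := @pi_gt0 R; have [/fset0Pn[u up] pb] := supp_simplex p.
have b0 : 0 <= b by apply: le_trans (pb u u up up); exact: mdist_ge0.
have bpi : b <= pi by apply: ltW (lt_le_trans b_lt _); lra.
have far v w : v \in supp p -> w \in supp p -> - 2^-1 < dot (val (f v)) (val (f w)).
  move=> vp wp; rewrite -cos_2pi3; apply: (@lt_le_trans _ _ (cos b)).
    have bi : b \in `[0, pi] by rewrite in_itv /= b0 bpi.
    have ci : 2 * (pi / 3) \in `[0, pi : R] by rewrite in_itv /=; apply/andP; split; lra.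
    by rewrite ltr_cos.
  rewrite -sphere_le ?b0 //.
  by apply: (le_trans (f_lip _ _)); exact: pb.
have [|v vp uv] := lin_neg (lin0 (val (f u))) up; first by rewrite sphere_dot.
have lin1 : lin (fun w => dot (val (f w)) (val (f u)) + dot (val (f w)) (val (f v))) p = 0.
  rewrite -[RHS](addr0 0) -{1}(lin0 (val (f u))) -(lin0 (val (f v))).
  by rewrite /lin -big_split; apply: eq_bigr => w _ /=; rewrite mulrDr.
have uv' := far _ _ vp up.
have [|w wp] := lin_neg lin1 up; first by rewrite sphere_dot (dotC (val (f u))); lra.
rewrite ltNge => /negP; apply; apply: no_three_directions; try exact: far.
by rewrite (dotC (val (f u))) uv uv'.
Qed.

End vector_sum.

Definition circle (t : R) : sphere R 1.
Proof.
refine (exist _ (\row_(i < 2) if i == ord0 then cos t else sin t) _).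
by rewrite dot2E !mxE /= -!expr2 cos2Dsin2.
Defined.

Lemma dot_circle (u : 'rV[R]_2) t :
  dot u (val (circle t)) = u 0 ord0 * cos t + u 0 ord_max * sin t.
Proof. by rewrite dot2E !mxE. Qed.

Lemma dot_circles s t : dot (val (circle s)) (val (circle t)) = cos (s - t).
Proof. by rewrite dot_circle !mxE cosB. Qed.

(** Take [N > 2 * pi / e] equally spaced points. *)
Lemma circle_net (e : R) : 0 < e <= pi -> exists C : {fset sphere R 1},
  forall t, exists2 u, u \in C & cos e < dot (val u) (val (circle t)).
Proof.
move=> /andP[e0 ep]; have p0 := @pi_gt0 R.
pose N := (Num.truncn (2 * pi / e)).+1.
have N0 : 0 < N%:R :> R by rewrite ltr0n.
have Ne : 2 * pi / N%:R < e.
  rewrite ltr_pdivrMr // [ltRHS]mulrC -ltr_pdivrMr //.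
  have q0 : 0 <= 2 * pi / e by rewrite divr_ge0 ?mulr_ge0 ?ler0n ?pi_ge0 // ltW.
  have /andP[_ h] := Num.Theory.truncn_itv q0; exact: h.
exists [fset circle (2 * pi * (i%:R / N%:R)) | i in iota 0 N]%fset => t.
pose k := Num.floor (t / (2 * pi)).
pose r := t / (2 * pi) - k%:~R.
have /andP[r0 r1] : 0 <= r < 1.
  have /andP[h1 h2] := floor_itv (t / (2 * pi)); rewrite intrD in h2.
  by apply/andP; split; rewrite /r; lra.
have tE : t = 2 * pi * r + 2 * pi * k%:~R by rewrite /r; field; lra.
have /andP[i0 i1] := @Num.Theory.truncn_itv R (N%:R * r) (mulr_ge0 (ltW N0) r0).
set i := Num.truncn (N%:R * r) in i0 i1.
exists (circle (2 * pi * (i%:R / N%:R))).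
  apply/imfsetP; exists i => //; apply: (etrans (mem_iota 0 N i)); rewrite /= add0n.
  by rewrite -(ltr_nat R); apply: le_lt_trans i0 _; rewrite -[ltRHS]mulr1 ltr_pM2l.
rewrite dot_circles -[ltRHS]cosN opprB tE addrAC cosD2piz.
have -> : 2 * pi * r - 2 * pi * (i%:R / N%:R) = 2 * pi / N%:R * (N%:R * r - i%:R).
  by field; lra.
set d := N%:R * r - i%:R.
have d0 : 0 <= d by rewrite /d; lra.
have d1 : d < 1 by rewrite /d; rewrite -natr1 in i1; lra.
set c := 2 * pi / N%:R in Ne *.
have c0 : 0 < c by rewrite divr_gt0 // mulr_gt0.
rewrite ltr_cos ?in_itv /=; first by nra.
  by apply/andP; split; nra.
by apply/andP; split; nra.
Qed.

End planar.

(** * A singular torus in the Vietoris-Rips complex *)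

Section torus.
Context {R : realType} (a : R).
Hypothesis a0 : 0 < a.
Hypothesis api : a <= pi.
Import metric_structure.

Let torus : metricType R := (sphere R 1 * sphere R 1)%type.

Lemma sum_fsetM (U V : choiceType) (A : {fset U}) (B : {fset V}) (f : U -> R) (g : V -> R) :
  \sum_(x <- (A `*` B)%fset) f x.1 * g x.2 = (\sum_(u <- A) f u) * (\sum_(v <- B) g v).
Proof.
transitivity (\sum_(x <- [seq (u, v) | u <- A, v <- B]) f x.1 * g x.2).
  apply: perm_big; apply: uniq_perm; first exact: fset_uniq.
    by apply: allpairs_uniq; [exact: fset_uniq|exact: fset_uniq|move=> [? ?] [? ?]].
  move=> [u v]; rewrite in_fsetM /=.
  apply/andP/allpairsP => [[uA vB]|[[u' v'] [/= uA vB [-> ->]]]] //.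
  by exists (u, v).
rewrite big_allpairs /= mulr_suml; apply: eq_bigr => u _.
by rewrite mulr_sumr.
Qed.

Definition net : {fset sphere R 1}.
Proof.
refine (sval (cid (@circle_net R (a / 2) _))).
by rewrite divr_gt0 //= (le_trans _ api) // ler_pdivrMr // ler_peMr ?(ltW a0) // ler1n.
Defined.

Lemma netP t : exists2 u, u \in net & cos (a / 2) < dot (val u) (val (circle t)).
Proof. by rewrite /net; case: cid => C hC /=; exact: hC. Qed.

(** The functions [bump_weight u], for [u] in a net finer than [a / 2], are positive on
    caps of radius [a / 2]; [loop_weight] normalizes them to a partition of unity.
    It sends the circle to the Vietoris-Rips complex at scale [a], close to the
    identity. *)
Definition bump_weight (u : sphere R 1) (s : R) : R :=
  Num.max 0 (dot (val u) (val (circle (2 * pi * s))) - cos (a / 2)).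

Definition bump_total s : R := \sum_(u <- net) bump_weight u s.

Definition loop_weight u s : R := if u \in net then bump_weight u s / bump_total s else 0.

Definition near_net s : {fset sphere R 1} :=
  [fset u in net | cos (a / 2) < dot (val u) (val (circle (2 * pi * s)))]%fset.

Lemma bump_weight_ge0 u s : 0 <= bump_weight u s.
Proof. by rewrite le_max lexx. Qed.

Lemma bump_total_gt0 s : 0 < bump_total s.
Proof.
have [u uC hu] := netP (2 * pi * s).
rewrite /bump_total (big_fsetD1 u) //= ltr_pwDl //.
  by rewrite lt_max subr_gt0 hu orbT.
by apply: sumr_ge0 => v _; exact: bump_weight_ge0.
Qed.

Lemma loop_weight_ge0 u s : 0 <= loop_weight u s.
Proof.
rewrite /loop_weight; case: ifP => // _.
by rewrite divr_ge0 ?bump_weight_ge0 // ltW // bump_total_gt0.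
Qed.

Lemma loop_weight0 u s : u \notin near_net s -> loop_weight u s = 0.
Proof.
rewrite !inE /loop_weight /=; case: ifP => //= uC; rewrite -leNgt => h.
by rewrite /bump_weight max_l ?mul0r // subr_le0.
Qed.

Lemma loop_weight_sum s : \sum_(u <- near_net s) loop_weight u s = 1.
Proof.
have sub : (near_net s `<=` net)%fset by apply/fsubsetP => u; rewrite !inE => /andP[].
rewrite (big_fset_incl _ sub) => [|u _]; last exact: loop_weight0.
rewrite -(@divff _ (bump_total s)) ?gt_eqF ?bump_total_gt0 // {1}/bump_total mulr_suml.
by apply: eq_big_seq => u uC; rewrite /loop_weight uC.
Qed.

Lemma near_net_dist s u v : u \in near_net s -> v \in near_net s -> mdist u v <= a.
Proof.
rewrite !inE => /andP[_ hu] /andP[_ hv].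
have a2 : 0 <= a / 2 <= pi.
  by apply/andP; split; have := a0; have := api; lra.
apply: (le_trans (metric_triangle _ (circle (2 * pi * s)) _)).
rewrite [leRHS]splitr; apply: lerD; first by rewrite sphere_le // ltW.
by rewrite metric_sym sphere_le // ltW.
Qed.

Lemma near_net2_simplex s t :
  simplices (vr_complex torus a) (near_net s `*` near_net t)%fset.
Proof.
split=> [|[u v] [u' v']]; last first.
  rewrite !in_fsetM => /andP[/= us vt] /andP[/= us' vt'].
  rewrite -[mdist _ _]/(Num.max (mdist u u') (mdist v v')) ge_max.
  by rewrite (near_net_dist us us') (near_net_dist vt vt').
have [u uC hu] := netP (2 * pi * s); have [v vC hv] := netP (2 * pi * t).
by apply/fset0Pn; exists (u, v); rewrite in_fsetM !inE /= uC vC hu hv.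
Qed.

(** Products of the two partitions of unity; the carrier is a product of two simplices,
    and as such a simplex for the product metric. *)
Definition torus_point (s t : R) : realization R (vr_complex torus a).
Proof.
refine (@simplex_realization R torus (vr_complex torus a)
  (near_net s `*` near_net t)%fset (fun x => loop_weight x.1 s * loop_weight x.2 t) _ _
  (near_net2_simplex s t)) => [x|].
  by rewrite mulr_ge0 ?loop_weight_ge0.
by rewrite (sum_fsetM _ _ (loop_weight^~ s) (loop_weight^~ t)) !loop_weight_sum mulr1.
Defined.

Lemma torus_pointE s t x :
  val (torus_point s t) x = loop_weight x.1 s * loop_weight x.2 t.
Proof.
rewrite simplex_realizationE in_fsetM; case: ifP => // /negbT.
by rewrite negb_and => /orP[h|h]; rewrite (loop_weight0 h) ?mul0r ?mulr0.
Qed.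

Lemma supp_torus_point s t x : x \in supp (torus_point s t) ->
  cos (a / 2) < dot (val x.1) (val (circle (2 * pi * s))) /\
  cos (a / 2) < dot (val x.2) (val (circle (2 * pi * t))).
Proof.
move=> /(fsubsetP (supp_simplex_realization _ _ _)).
by rewrite in_fsetM !inE => /andP[/andP[_ ->] /andP[_ ->]].
Qed.

Lemma loop_weight_period u : loop_weight u 1 = loop_weight u 0.
Proof.
have c10 : circle (2 * pi * 1) = circle (2 * pi * 0) :> sphere R 1.
  apply: mdist_positivity; apply/eqP; rewrite eq_le mdist_ge0 andbT.
  rewrite sphere_le; last by rewrite lexx pi_ge0.
  by rewrite dot_circles mulr0 subr0 mulr1 mulr_natl cos2pi cos0.
have b10 v : bump_weight v 1 = bump_weight v 0 by rewrite /bump_weight c10.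
have t10 : bump_total 1 = bump_total 0 by apply: eq_bigr => v _.
by rewrite /loop_weight b10 t10.
Qed.

Lemma torus_point_period1 t : torus_point 1 t = torus_point 0 t.
Proof. by apply: realization_eq => x; rewrite !torus_pointE loop_weight_period. Qed.

Lemma torus_point_period2 s : torus_point s 1 = torus_point s 0.
Proof. by apply: realization_eq => x; rewrite !torus_pointE loop_weight_period. Qed.

Lemma loop_weight_cts u : continuous (loop_weight u).
Proof.
rewrite /loop_weight; case: (u \in net); last exact: cst_continuous.
have cb v : continuous (bump_weight v).
  apply: continuous_maxr; first exact: cst_continuous.
  have -> : (fun s => dot (val v) (val (circle (2 * pi * s))) - cos (a / 2)) =
      (fun s => val v 0 ord0 * cos (2 * pi * s) + val v 0 ord_max * sin (2 * pi * s) +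
        - cos (a / 2)).
    by apply/funext => s; rewrite dot_circle.
  have c2 : continuous (fun s : R => 2 * pi * s).
    by apply: continuous_mul; [exact: cst_continuous|move=> s; exact: cvg_id].
  apply: continuous_add; last exact: cst_continuous.
  apply: continuous_add; apply: continuous_mul; try exact: cst_continuous.
    by move=> s; apply: continuous_comp; [exact: c2|exact: continuous_cos].
  by move=> s; apply: continuous_comp; [exact: c2|exact: continuous_sin].
apply: continuous_div => [s||]; first by rewrite gt_eqF ?bump_total_gt0.
  exact: cb.
by apply: continuous_sum.
Qed.

Section torus_simplex.
Context {n : nat} (e e' : pred nat).

Definition torus_fun (x : stdsimplex R n) : realization R (vr_complex torus a) :=
  torus_point (upper_weight e x) (upper_weight e' x).

Lemma torus_fun_cts : continuous torus_fun.
Proof.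
apply: (@realization_cts R torus _ _ _ (net `*` net)%fset) => [x|v].
  apply: fsubset_trans (supp_simplex_realization _ _ _) _.
  by apply/fsubsetP => u; rewrite !in_fsetM !inE => /andP[/andP[-> _] /andP[-> _]].
have -> : (fun x => val (torus_fun x) v) = fun x =>
    loop_weight v.1 (upper_weight e x) * loop_weight v.2 (upper_weight e' x).
  by apply/funext => x; rewrite torus_pointE.
have cu d u : continuous (fun x : stdsimplex R n => loop_weight u (upper_weight d x)).
  move=> x; apply: (@continuous_comp _ _ _ (@upper_weight R n d) (loop_weight u)).
    exact: upper_weight_cts.
  exact: loop_weight_cts.
by apply: continuous_mul; exact: cu.
Qed.

HB.instance Definition _ := isContinuous.Build _ _ torus_fun torus_fun_cts.

(** The simplex of the unit square with vertices [(e k, e' k)], mapped to the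
    complex by [torus_point]. *)
Definition torus_simplex : singular_simplex R n (realization R (vr_complex torus a)) :=
  torus_fun.

End torus_simplex.

Lemma reindex_torus l n (f : 'I_l.+1 -> 'I_n.+1) (d d' e e' : pred nat) :
  (forall k : 'I_l.+1, d k = e (f k)) -> (forall k : 'I_l.+1, d' k = e' (f k)) ->
  reindex (torus_simplex (n := n) e e') f = torus_simplex d d'.
Proof.
move=> de de'; apply/continuousEP => x.
rewrite -[LHS]/(torus_point (upper_weight e (vertex_map R f x))
  (upper_weight e' (vertex_map R f x))).
by rewrite (upper_weight_map _ de) (upper_weight_map _ de').
Qed.

Lemma upper_weightT n (x : stdsimplex R n) : upper_weight predT x = 1.
Proof. exact: coord_sum. Qed.

Lemma upper_weight0 n (x : stdsimplex R n) : upper_weight pred0 x = 0.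
Proof. by rewrite /upper_weight big_pred0. Qed.

Lemma torus_simplexT1 n (e : pred nat) :
  torus_simplex (n := n) predT e = torus_simplex pred0 e.
Proof.
apply/continuousEP => x; rewrite -[LHS]/(torus_point _ _) -[RHS]/(torus_point _ _).
by rewrite upper_weightT upper_weight0 torus_point_period1.
Qed.

Lemma torus_simplexT2 n (e : pred nat) :
  torus_simplex (n := n) e predT = torus_simplex e pred0.
Proof.
apply/continuousEP => x; rewrite -[LHS]/(torus_point _ _) -[RHS]/(torus_point _ _).
by rewrite upper_weightT upper_weight0 torus_point_period2.
Qed.

(** The torus is the union of the two triangles of a square with opposite edges
    identified; the loops below are the images of two of its edges. *)
Definition triangle1 := torus_simplex (n := 2) (fun k => 0 < k)%N (fun k => 1 < k)%N.
Definition triangle2 := torus_simplex (n := 2) (fun k => 1 < k)%N (fun k => 0 < k)%N.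
Definition loop1 := torus_simplex (n := 1) (fun k => 0 < k)%N pred0.
Definition loop2 := torus_simplex (n := 1) pred0 (fun k => 0 < k)%N.

Lemma upper_weight_vertex n (e : pred nat) (i : 'I_n.+1) :
  upper_weight e (vertex i : stdsimplex R n) = (e i)%:R.
Proof.
rewrite /upper_weight; case ei : (e i); last first.
  rewrite big1 // => k ek; rewrite vertexE; case: eqP => // ki.
  by rewrite ki ei in ek.
rewrite (bigD1 i) //= vertexE eqxx big1 ?addr0 // => k /andP[_ ki].
by rewrite vertexE (negbTE ki).
Qed.

Lemma torus_simplex_vertex n (e e' : pred nat) i :
  torus_simplex (n := n) e e' (vertex i) = torus_point (e i)%:R (e' i)%:R.
Proof. by rewrite -[LHS]/(torus_point _ _) !upper_weight_vertex. Qed.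

Lemma loop1_closed : loop1 (vertex ord0) = loop1 (vertex ord_max).
Proof. by rewrite !torus_simplex_vertex /= torus_point_period1. Qed.

Lemma loop2_closed : loop2 (vertex ord0) = loop2 (vertex ord_max).
Proof. by rewrite !torus_simplex_vertex /= torus_point_period2. Qed.

Lemma reindex_loop1 (f : 'I_2 -> 'I_3) (e e' : pred nat) :
  e (f ord0) = false -> e (f ord_max) ->
  (forall k, e' (f k) = false) \/ (forall k, e' (f k)) ->
  reindex (torus_simplex (n := 2) e e') f = loop1.
Proof.
move=> e0 e1 e'E; pose d (b : bool) : pred nat := if b then predT else pred0.
have {e'E} [c e'E] : exists c, forall k, e' (f k) = c.
  by case: e'E => h; [exists false|exists true].
rewrite (@reindex_torus 1 2 f (fun k => 0 < k)%N (d c)) => [|k|k].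
- by case: (c); rewrite /d ?torus_simplexT2.
- case: k => -[|[|k]] //= k2.
    by rewrite (_ : Ordinal k2 = ord0) ?e0 //; exact: val_inj.
  by rewrite (_ : Ordinal k2 = ord_max) ?e1 //; exact: val_inj.
by rewrite e'E; case: (c).
Qed.

Lemma reindex_loop2 (f : 'I_2 -> 'I_3) (e e' : pred nat) :
  e' (f ord0) = false -> e' (f ord_max) ->
  (forall k, e (f k) = false) \/ (forall k, e (f k)) ->
  reindex (torus_simplex (n := 2) e e') f = loop2.
Proof.
move=> e0 e1 e'E; pose d (b : bool) : pred nat := if b then predT else pred0.
have {e'E} [c e'E] : exists c, forall k, e (f k) = c.
  by case: e'E => h; [exists false|exists true].
rewrite (@reindex_torus 1 2 f (d c) (fun k => 0 < k)%N) => [|k|k].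
- by case: (c); rewrite /d ?torus_simplexT1.
- by rewrite e'E; case: (c).
case: k => -[|[|k]] //= k2.
  by rewrite (_ : Ordinal k2 = ord0) ?e0 //; exact: val_inj.
by rewrite (_ : Ordinal k2 = ord_max) ?e1 //; exact: val_inj.
Qed.

(** Both triangles have the boundary that consists of the diagonal and one copy of
    each loop, with the same signs. *)
Lemma triangle_boundary (K : fieldType) (eta : cochain R K 1 (realization R (vr_complex torus a))) :
  coboundary eta triangle1 = coboundary eta triangle2.
Proof.
have k2 (P : nat -> Prop) : P 0%N -> P 1%N -> forall k : 'I_2, P k.
  by move=> P0 P1 [[|[|k]]].
rewrite /coboundary !big_ord_recl !big_ord0.
rewrite (@reindex_loop2 (lift ord0)) //; last by right.
rewrite (@reindex_loop1 (lift ord0)) //; last by right.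
rewrite (@reindex_loop1 (lift (lift ord0 (lift ord0 ord0)))) //; last first.
  by left; apply: (k2 (fun k => (1 < bump 2 k)%N = false)).
rewrite (@reindex_loop2 (lift (lift ord0 (lift ord0 ord0)))) //; last first.
  by left; apply: (k2 (fun k => (1 < bump 2 k)%N = false)).
have -> : reindex triangle1 (lift (lift ord0 ord0)) = reindex triangle2 (lift (lift ord0 ord0)).
  rewrite !(@reindex_torus 1 2 _ (fun k => 0 < k)%N (fun k => 0 < k)%N) //;
    by apply: (k2 (fun k => (0 < k)%N = (_ < bump 1 k)%N)).
rewrite /= /bump /= expr0 expr1 expr2; ring.
Qed.

Lemma triangle_cup (K : fieldType) (phi psi : cochain R K 1 (realization R (vr_complex torus a))) :
  cup_cochain phi psi triangle1 = phi loop1 * psi loop2 /\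
  cup_cochain phi psi triangle2 = phi loop2 * psi loop1.
Proof.
have k2 (P : nat -> Prop) : P 0%N -> P 1%N -> forall k : 'I_2, P k.
  by move=> P0 P1 [[|[|k]]].
split; congr (phi _ * psi _).
- apply: reindex_loop1; rewrite /front ?inordK //.
  by left=> k; rewrite inordK; case: k => -[|[|k]].
- apply: reindex_loop2; rewrite /back ?inordK //.
  by right=> k; rewrite inordK; case: k => -[|[|k]].
- apply: reindex_loop2; rewrite /front ?inordK //.
  by left=> k; rewrite inordK; case: k => -[|[|k]].
- apply: reindex_loop1; rewrite /back ?inordK //.
  by right=> k; rewrite inordK; case: k => -[|[|k]].
Qed.

End torus.

(** * Two classes on the torus with a non-zero product *)

Section torus_cup_length.
Context {R : realType} {K : fieldType} (a b : R).
Hypothesis a0 : 0 < a.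
Hypothesis b_lt : b < 2 * (pi / 3).
Hypothesis ab : a <= b.
Import metric_structure.

Let torus : metricType R := (sphere R 1 * sphere R 1)%type.
Context (incl : vr_complex torus a `<=` vr_complex torus b).
Let iota : continuousType (realization R (vr_complex torus a))
    (realization R (vr_complex torus b)) := inclusion incl.

Let a_le_pi : a <= pi.
Proof. by have := @pi_gt0 R; move: b_lt ab; lra. Qed.

Definition factor (c : bool) (x : torus) : sphere R 1 := if c then x.1 else x.2.

Lemma factor_lip c x y : mdist (factor c x) (factor c y) <= mdist x y.
Proof.
rewrite -[mdist x y]/(Num.max (mdist x.1 y.1) (mdist x.2 y.2)) le_max.
by case: c; rewrite lexx ?orbT.
Qed.

Definition torus_winding (c : bool) : cochain R K 1 (realization R (vr_complex torus b)) :=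
  winding (K := K) (@lin_cts R torus (vr_complex torus b) _)
    (@lin_cts R torus (vr_complex torus b) _) (vector_sum_gt0 (factor_lip c) b_lt).

(** The vertices of the carrier of a point on the loop have this coordinate within
    [a / 2], at most a right angle, of a point of the circle that turns [k] times;
    [winding_loop] applies. *)
Lemma torus_winding_loop c (e e' : pred nat) (k : int) :
  torus_simplex a0 a_le_pi e e' (vertex (ord0 : 'I_2)) =
  torus_simplex a0 a_le_pi e e' (vertex (ord_max : 'I_2)) ->
  ((if c then e else e') 1%N)%:R = ((if c then e else e') 0%N)%:R + k%:~R :> R ->
  torus_winding c (push iota (torus_simplex a0 a_le_pi e e')) = k%:~R.
Proof.
move=> closed ek; pose E := torus_simplex a0 a_le_pi (n := 1) e e'.
pose d := if c then e else e'.
apply: (@winding_loop R K _ _ _ _ _ _ (push iota E) (fun x => 2 * pi * upper_weight d x)).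
- apply: continuous_mul; first exact: cst_continuous.
  exact: upper_weight_cts.
- move=> x; set p := push iota E x.
  have := vector_sum_dot (factor c) p (val (circle (2 * pi * upper_weight d x))).
  rewrite !mxE /= => <-; apply: lin_gt0 => v vp.
  have vE : v \in supp (torus_point a0 a_le_pi (upper_weight e x) (upper_weight e' x)) by [].
  have [h1 h2] := supp_torus_point vE.
  have c0 : 0 <= cos (a / 2).
    by apply: cos_ge0_pihalf; have := a0; have := a_le_pi => ? ?; apply/andP; split; lra.
  by apply: (le_lt_trans c0); rewrite /factor /d; case: (c).
- exact: (congr1 iota closed).
rewrite !upper_weight_vertex /= ek; ring.
Qed.

Lemma coboundary_loop (X : topologicalType) (eta : cochain R K 0 X)
    (E : singular_simplex R 1 X) :
  E (vertex ord0) = E (vertex ord_max) -> coboundary eta E = 0.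
Proof.
move=> closed; rewrite /coboundary !big_ord_recl big_ord0 /= expr0 expr1 mul1r addr0.
suff -> : reindex E (lift ord0) = reindex E (lift (lift ord0 ord0)).
  by rewrite mulN1r subrr.
apply/continuousEP => x.
have -> : x = vertex ord0.
  apply: coord_inj => i; rewrite (ord1 i) vertexE eqxx.
  by have := coord_sum x; rewrite big_ord1.
rewrite /reindex /= !vertex_map_vertex.
have -> : lift ord0 ord0 = ord_max :> 'I_2 by exact: val_inj.
have -> : lift ord_max ord0 = ord0 :> 'I_2 by exact: val_inj.
by [].
Qed.

(** The winding cocycles of the two coordinates are 1 and 0, respectively 0 and 1, on
    the two loops. Their cup product is therefore 1 on the first triangle and 0 on
    the second, whereas a coboundary takes the same value on both by
    [triangle_boundary]. *)
Lemma torus_length_ge2 : (2%:R%:E <= image_length R K iota)%E.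
Proof.
pose w c := Cocycle (winding_cocycle (K := K) (@lin_cts R torus (vr_complex torus b) _)
  (@lin_cts R torus (vr_complex torus b) _) (vector_sum_gt0 (factor_lip c) b_lt)).
pose h c : cohomology R K 1 (realization R (vr_complex torus a)) :=
  cohomology_map iota (cohomology_class (w c)).
apply: ereal_sup_ubound; exists 2%N => //; right.
exists [:: homogeneous_class (h true); homogeneous_class (h false)]; split=> //.
  move=> x; rewrite !inE => /orP[]/eqP->; split=> //; apply/in_imageP;
  by eexists (homogeneous_class _).
have hE c (E : singular_simplex R 1 (realization R (vr_complex torus a))) :
    E (vertex ord0) = E (vertex ord_max) ->
    cocycle_val (repr (h c)) E = torus_winding c (push iota E).
  move=> closed; have [eta etaE] : exact (fun s => cocycle_val (repr (h c)) s -
      torus_winding c (push iota s)).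
    by rewrite /h map_class; exact: repr_class.
  have /(congr1 (fun f => f E)) := etaE; rewrite coboundary_loop //.
  by move/eqP; rewrite subr_eq0 => /eqP.
(* The iterated product ends with the unit class, which is absorbed into [u]. *)
set u := repr (cup_product (h false) (cohomology_one R K _)).
have uE (E : singular_simplex R 1 (realization R (vr_complex torus a))) :
    E (vertex ord0) = E (vertex ord_max) ->
    cocycle_val u E = torus_winding false (push iota E).
  move=> closed; rewrite -hE //.
  have one := repr_class (Cocycle (one_is_cocycle R K (realization R (vr_complex torus a)))).
  have [eta etaE] : exact (fun s => cocycle_val u s -
      cup_cochain (repr (h false)) (repr (cohomology_one R K _)) s).
    exact: repr_class.
  have /(congr1 (fun f => f E)) := etaE; rewrite coboundary_loop //.
  move/eqP; rewrite subr_eq0 => /eqP ->; rewrite /cup_cochain.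
  have -> : reindex E (@front 1 0) = E.
    by apply: reindex_id => i; apply: val_inj; rewrite /front /= inordK.
  have /(congr1 (fun f => f (reindex E (@back 1 0)))) := one.
  by move/eqP; rewrite subr_eq0 => /eqP ->; rewrite mulr1.
move=> /class_eq0 [eta etaE].
have l1 := loop1_closed a0 a_le_pi; have l2 := loop2_closed a0 a_le_pi.
have [c1 c2] := triangle_cup a0 a_le_pi (repr (h true)) u.
have cupE E : cup_cochain (repr (h true)) u E = coboundary eta E.
  exact: (congr1 (fun f => f E) etaE).
have : cup_cochain (repr (h true)) u (triangle1 a0 a_le_pi) =
       cup_cochain (repr (h true)) u (triangle2 a0 a_le_pi).
  by rewrite !cupE; exact: triangle_boundary.
rewrite c1 c2 !hE // !uE //.
rewrite (torus_winding_loop (k := 1) l1) //; last by rewrite /= add0r.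
rewrite (torus_winding_loop (k := 1) l2) //; last by rewrite /= add0r.
rewrite (torus_winding_loop (c := true) (k := 0) l2) //; last by rewrite /= addr0.
by rewrite mul0r mul1r => /eqP; rewrite oner_eq0.
Qed.

End torus_cup_length.

(** * The erosion distance *)

Section erosion_bounds.
Context {R : realType} {K : fieldType}.
Import metric_structure.

(** The three summands are spheres, so a contraction of each extends over the
    product and over the wedge. *)
Lemma torus_wedge_contraction (x0 : sphere R 1) (y0 : sphere R 2) (z0 : sphere R 1) :
  (exists f, @coarse_contraction R (2 * (pi / 3)) (sphere R 1 * sphere R 1)%type (x0, z0) f) /\
  (exists f, coarse_contraction (2 * (pi / 3)) (wedge_point (wedge_point x0 y0) z0) f).
Proof.
have [f hf] := sphere_contraction x0; have [g hg] := sphere_contraction y0.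
have [h hh] := sphere_contraction z0.
split; first exact: prod_contraction hf hh.
by have [k hk] := wedge_contraction hf hg; exact: wedge_contraction hk hh.
Qed.

(** Thickening by [c / 2] lengthens the interval by [c], the scale of the
    contraction, unless its left end falls where the complex is discrete. *)
Lemma cup_length_thicken_eq0 (X : metricType R) (c : R) (p : X) f (e : {nonneg R}) I :
  coarse_contraction c p f -> e%:num + e%:num = c ->
  cup_length K (@VR R X) (thicken I e) = 0%E.
Proof.
move=> hf ec; apply: image_length_eq0 => n y.
have I_le := left_le_right I; have e0 : 0 <= e%:num by [].
have [neg|pos] := leP (left_end I - e%:num) 0.
  by apply: inclusion_discrete; rewrite /= ge_max neg lexx.
apply: (contraction_null _ _ hf) => /=; first by rewrite le_max lexx orbT.
by rewrite max_l ?(ltW pos) // le_max; apply/orP; left; move: I_le; rewrite -ec; lra.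
Qed.

Lemma contractible_eroded (X Y : metricType R) (c : R) p f q g (e : {nonneg R}) :
  @coarse_contraction R c X p f -> @coarse_contraction R c Y q g ->
  e%:num + e%:num = c ->
  eroded (cup_length K (@VR R X)) (cup_length K (@VR R Y)) e.
Proof.
move=> hf hg ec I.
by rewrite (cup_length_thicken_eq0 _ hf) // (cup_length_thicken_eq0 _ hg) // !image_length_ge0.
Qed.

Lemma wedge_length_le1 (x0 : sphere R 1) (y0 : sphere R 2) (z0 : sphere R 1) (a b : R)
    (ab : vr_complex (metric_wedge (wedge_point x0 y0) z0) a `<=`
          vr_complex (metric_wedge (wedge_point x0 y0) z0) b) :
  a < pi / 2 -> 0 < b - a <= pi / 2 -> pi / 3 <= b ->
  (image_length R K (@inclusion R _ _ _ ab) <= 1%:E)%E.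
Proof.
move=> a2 ba b3; have [m hm] := sphere_hemi a2 ba b3.
have a_le_b : a <= b by case/andP: ba; rewrite subr_gt0 => /ltW.
have [A [M hA]] := hm _ x0; have [B [N hB]] := hm _ y0; have [C [S hC]] := hm _ z0.
have [D [T hD]] := wedge_hemi a_le_b hA hB.
have [E [U hE]] := wedge_hemi a_le_b hD hC.
by apply: image_length_le1 => i j x y; exact: hemi_cup hE.
Qed.

(** If [e < pi / 3], an interval slightly longer than [{pi / 3}] separates the two
    functions: on it the wedge has length at most 1, while its thickening stays
    inside the range [(0, 2 * pi / 3)] where the torus has length at least 2. *)
Lemma eroded_ge (x0 : sphere R 1) (y0 : sphere R 2) (z0 : sphere R 1) (e : {nonneg R}) :
  eroded (cup_length K (@VR R (sphere R 1 * sphere R 1)%type))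
    (cup_length K (@VR R (metric_wedge (wedge_point x0 y0) z0))) e ->
  pi / 3 <= e%:num.
Proof.
move=> he; rewrite leNgt; apply/negP => e3.
have pi0 := @pi_gt0 R; have e0 : 0 <= e%:num by [].
pose d := (pi / 3 - e%:num) / 2.
have d0 : 0 < d by rewrite /d; lra.
have I_le : pi / 3 - d <= pi / 3 + d by lra.
have [_] := he (ClosedInterval I_le); apply/negP; rewrite -ltNge.
have d3 : d <= pi / 6 by rewrite /d; lra.
apply: (@le_lt_trans _ _ 1%:E).
  apply: wedge_length_le1; rewrite /= !max_l; rewrite /d in d0 d3 *; lra.
apply: (@lt_le_trans _ _ 2%:R%:E); first by rewrite lte_fin ltr1n.
apply: torus_length_ge2; rewrite /= !max_l; rewrite /d in d0 d3 *; lra.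
Qed.

End erosion_bounds.

Local Open Scope ereal_scope.

Theorem proposition55 (R : realType) (K : fieldType)
    (x0 : sphere R 1) (y0 : sphere R 2) (z0 : sphere R 1) :
  let torus : metricType R := (sphere R 1 * sphere R 1)%type in
  let wedge121 : metricType R := metric_wedge (wedge_point x0 y0) z0 in
  (pi / 3)%:E = erosion_dist (cup_length K (VR torus)) (cup_length K (VR wedge121))
  /\ erosion_dist (cup_length K (VR torus)) (cup_length K (VR wedge121))
     <= 2%:E * gromov_hausdorff_dist torus wedge121.
Proof.
move=> torus wedge121; have pi0 := @pi_gt0 R.
have dE : (pi / 3)%:E = erosion_dist (cup_length K (VR torus)) (cup_length K (VR wedge121)).
  apply/eqP; rewrite eq_le; apply/andP; split.
    by apply: le_ereal_inf_tmp => _ [e he <-]; rewrite lee_fin; exact: eroded_ge he.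
  have e0 : (0 <= pi / 3 :> R)%R by rewrite divr_ge0 // ltW.
  apply: ereal_inf_lbound; exists (NngNum e0) => //.
  have [[f hf] [g hg]] := torus_wedge_contraction x0 y0 z0.
  by apply: (contractible_eroded hf hg) => /=; rewrite -mulr2n mulr_natl.
split=> //; rewrite -dE.
have -> : (pi / 3)%:E = 2%:E * (pi / 6)%:E :> \bar R.
  by rewrite -EFinM; congr _%:E; lra.
rewrite lee_pmul2l //; apply: le_ereal_inf_tmp => _ [Z [f [g [hf hg ->]]]].
rewrite leNgt; apply/negP => small.
set h := hausdorff_dist _ _ in small.
have h0 : 0 <= h.
  rewrite /h /hausdorff_dist le_max; apply/orP; left.
  apply: le_trans (ereal_sup_ubound _); last by exists (f (x0, z0)) => //; exists (x0, z0).
  by apply: le_ereal_inf_tmp => _ [z _ <-]; rewrite lee_fin mdist_ge0.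
have hE : h = (fine h)%:E by rewrite fineK // ge0_fin_numE // (lt_trans small) ?ltry.
rewrite hE lee_fin in h0; rewrite hE lte_fin in small.
have r0 : (0 <= (fine h + pi / 6) / 2)%R by lra.
have hr : h < ((NngNum r0)%:num)%:E by rewrite [ltLHS]hE lte_fin /=; lra.
by have /= := eroded_ge (hausdorff_eroded (K := K) hf hg hr); lra.
Qed.
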